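(* Let $w$ be a strictly positive analytic weight on the unit circle $\mathbb T_1$, let $\rho<1$ be the associated constant, and fix $r$ with $\rho<r<1$. Then for each $n\in\mathbb N$ the Verblunsky coefficient $\alpha_n$ satisfies $$\overline{\alpha_n}=\tau^2\,\mathcal I_{n+1}(0)=\tau^2\sum_{k=0}^\infty f_{n+1}^{(2k+1)}(0).$$
   Context: Notation: for $s>0$, $\mathbb T_s=\{z\in\mathbb C:|z|=s\}$, oriented counterclockwise. A strictly positive analytic weight on $\mathbb T_1$ is a function $w$ that is strictly positive on $\mathbb T_1$ and extends to a nowhere vanishing holomorphic function on an open set containing $\mathbb T_1$. The orthonormal polynomials $\varphi_n(z)=\kappa_nz^n+\dots$, $\kappa_n>0$, satisfy $\oint_{\mathbb T_1}\varphi_n\overline{\varphi_m}\,w\,|dz|=\delta_{mn}$, and $\Phi_n=\varphi_n/\kappa_n$ is monic. Verblunsky coefficients: $\alpha_n=-\overline{\Phi_{n+1}(0)}$. Szegő functions: $D(z)=\exp\left(\frac1{4\pi}\int_0^{2\pi}\log w(e^{i\theta})\frac{e^{i\theta}+z}{e^{i\theta}-z}\,d\theta\right)$ for $|z|\ne1$; $D_{\rm i}$ is its restriction to $|z|<1$ and $D_{\rm e}$ its restriction to $|z|>1$. Both extend holomorphically across $\mathbb T_1$ (same notation), and $D_{\rm i}/D_{\rm e}=w$, $\overline{D_{\rm i}(1/\overline z)}=1/D_{\rm e}(z)$. Put $\rho=\inf\{0<s<1: D_{\rm e}\text{ is (extends) holomorphic in }|z|>s\}<1$, $\tau=1/D_{\rm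 i}(0)=\exp\left(-\frac1{4\pi}\int_0^{2\pi}\log w(e^{i\theta})\,d\theta\right)>0$ and $\mathcal F(z)=D_{\rm i}(z)D_{\rm e}(z)$, which is holomorphic in $\rho<|z|<1$, while $1/\mathcal F$ is holomorphic in $1<|z|<1/\rho$. Operators (for fixed $r\in(\rho,1)$), acting on functions holomorphic in $\mathbb C\setminus(\mathbb T_r\cup\mathbb T_{1/r})$ with continuous boundary values, where $f_-$ denotes the boundary values of $f$ from the exterior side of the circle of integration: $$\mathcal M_n^{\rm i}(f)(z)=-\frac1{2\pi i\,\tau^2}\oint_{\mathbb T_r}f_-(t)\frac{\mathcal F(t)t^n}{t-z}\,dt,\qquad \mathcal M_n^{\rm e}(f)(z)=\frac{\tau^2}{2\pi i}\oint_{\mathbb T_{1/r}}f_-(t)\frac{1}{\mathcal F(t)\,t^n(t-z)}\,dt .$$ Define $f_n^{(0)}=1$, $f_n^{(2k+1)}=\mathcal M_n^{\rm i}(f_n^{(2k)})$, $f_n^{(2k+2)}=\mathcal M_n^{\rm e}(f_n^{(2k+1)})$ for $k\ge0$, and $\mathcal I_n(z)=\sum_{k=0}^\infty f_n^{(2k+1)}(z)$ for $|z|\neq r$. With $\Lambda=\max_{|z|=r}|\mathcal F(z)|$, the series defining $\mathcal I_n$ is known to converge absolutely when $\Lambda r^n<\frac1r-r$. *)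

(* Defs.v *)
(* Stdlib reals with Coquelicot; complex numbers are Coquelicot's [C]. *)
From Stdlib Require Import Reals.
From Coquelicot Require Import Coquelicot.

Open Scope R_scope.
Open Scope C_scope.

Definition cis (theta : R) : C := (cos theta, sin theta).

Definition Cexp (z : C) : C := RtoC (exp (Re z)) * cis (Im z).

(* Integral of a complex-valued function over a real interval. *)
Definition CRInt (g : R -> C) (a b : R) : C :=
  RInt (V := C_R_CompleteNormedModule) g a b.

(* The contour integral of [g] over |t| = s, counterclockwise. *)
Definition circle_int (s : R) (g : C -> C) : C :=
  CRInt (fun theta => let t := RtoC s * cis theta in g t * (Ci * t)) 0 (2 * PI).

Definition holomorphic_on (U : C -> Prop) (f : C -> C) : Prop :=
  forall z : C, U z ->
    ex_derive (K := C_AbsRing) (V := C_NormedModule) f z.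

(* Only the values of [w] on the unit circle matter. *)
Definition analytic_weight (w : C -> R) : Prop :=
  (forall z : C, Cmod z = 1%R -> (0 < w z)%R) /\
  exists (U : C -> Prop) (W : C -> C),
    open (T := C_UniformSpace) U /\
    (forall z : C, Cmod z = 1%R -> U z /\ W z = RtoC (w z)) /\
    holomorphic_on U W /\
    (forall z : C, U z -> W z <> 0).

(* A sequence of polynomials is given by its coefficients: [c n k] is the
   coefficient of z^k, k <= n, in the n-th polynomial. *)
Definition poly_val (c : nat -> nat -> C) (n : nat) (z : C) : C :=
  sum_n (G := C_AbelianMonoid) (fun k => c n k * z ^ k) n.

Definition orthonormal_polynomials (w : C -> R) (c : nat -> nat -> C) : Prop :=
  (forall n, Im (c n n) = 0%R /\ (0 < Re (c n n))%R) /\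
  forall n m,
    CRInt (fun theta =>
             poly_val c n (cis theta) * Cconj (poly_val c m (cis theta))
             * RtoC (w (cis theta))) 0 (2 * PI)
    = if Nat.eqb n m then 1 else 0.

Definition monic_val (c : nat -> nat -> C) (n : nat) (z : C) : C :=
  poly_val c n z / c n n.

Definition verblunsky (c : nat -> nat -> C) (n : nat) : C :=
  - Cconj (monic_val c (S n) 0).

Definition szego (w : C -> R) (z : C) : C :=
  Cexp (/ RtoC (4 * PI) *
        CRInt (fun theta =>
                 RtoC (ln (w (cis theta)))
                 * ((cis theta + z) / (cis theta - z))) 0 (2 * PI)).

Definition exterior_extends (w : C -> R) (s : R) : Prop :=
  exists g : C -> C,
    holomorphic_on (fun z => (s < Cmod z)%R) g /\
    (forall z : C, (1 < Cmod z)%R -> g z = szego w z).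

Definition rho (w : C -> R) : R :=
  real (Glb_Rbar (fun s => (0 < s < 1)%R /\ exterior_extends w s)).

Definition tau (w : C -> R) : R :=
  exp (- (/ (4 * PI) * RInt (fun theta => ln (w (cis theta))) 0 (2 * PI))).

Definition is_szego_e (w : C -> R) (De : C -> C) : Prop :=
  (forall z : C, (1 < Cmod z)%R -> De z = szego w z) /\
  holomorphic_on (fun z => (rho w < Cmod z)%R) De.

(* The extension of D_i to |z| < 1 / rho (written rho * |z| < 1 to allow
   rho = 0) is in general only meromorphic: D_e may vanish in rho < |z| < 1,
   and D_i then has poles at the reflected points.  It has no zeros, so what
   extends holomorphically is 1 / D_i.  Since [/ 0 = 0] in [C], [Di] takes the
   value 0 exactly at the poles, and [/ Di] is the holomorphic extension of
   1 / D_i at every point of |z| < 1 / rho. *)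
Definition is_szego_i (w : C -> R) (Di : C -> C) : Prop :=
  (forall z : C, (Cmod z < 1)%R -> Di z = szego w z) /\
  holomorphic_on (fun z => (rho w * Cmod z < 1)%R) (fun z => / Di z).

Definition calF (Di De : C -> C) (z : C) : C := Di z * De z.

(* Boundary value at [t], |t| = s, of [f] from the exterior of the circle.
   [lim] is total; it is the limit of the filter whenever there is one. *)
Definition ext_bv (s : R) (f : C -> C) (t : C) : C :=
  lim (T := C_CompleteNormedModule)
    (filtermap f (within (fun z => (s < Cmod z)%R)
                         (locally (T := C_UniformSpace) t))).

(* [F] is only required on the circles |t| = r and |t| = 1 / r; at a pole of
   [F] on the latter, [F] is 0 and so is the integrand of [Me], which is the
   value of the holomorphic extension of 1 / F there. *)
Definition Mi (w : C -> R) (F : C -> C) (r : R) (n : nat) (f : C -> C) (z : C)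
  : C :=
  - / (2 * RtoC PI * Ci * RtoC (tau w) ^ 2) *
  circle_int r (fun t => ext_bv r f t * (F t * t ^ n / (t - z))).

Definition Me (w : C -> R) (F : C -> C) (r : R) (n : nat) (f : C -> C) (z : C)
  : C :=
  RtoC (tau w) ^ 2 / (2 * RtoC PI * Ci) *
  circle_int (/ r)
    (fun t => ext_bv (/ r) f t * / (F t * t ^ n * (t - z))).

Fixpoint fseq (w : C -> R) (F : C -> C) (r : R) (n k : nat) : C -> C :=
  match k with
  | O => fun _ => 1
  | S j => if Nat.even j then Mi w F r n (fseq w F r n j)
           else Me w F r n (fseq w F r n j)
  end.

Definition calI (w : C -> R) (F : C -> C) (r : R) (n : nat) (z : C) : C :=
  lim (T := C_CompleteNormedModule)
    (filtermap
       (sum_n (G := C_AbelianMonoid) (fun k => fseq w F r n (2 * k + 1) z))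
       eventually).

(* Main.v *)
(* On the unit circle the reciprocal [E = 1 / D_i] satisfies [D_e = conj E] and
   [|E|^2 = 1 / w], so the symbol [S = t^N F], [F = D_e / E], is unimodular there.
   Moving all contours to the unit circle, [tau^2 f^(2k+1)] is the strictly
   negative part of [S f^(2k)], and [f^(2k+2)] is the nonnegative part of
   [tau^2 f^(2k+1) / S]; hence [f^(2k) = T^k 1] with [T] of the form [H^* H], [H]
   being the Hankel operator with symbol [S].  The factorization of [F] makes the
   corresponding Toeplitz operator bounded below, so [H] is a strict contraction and
   the series converges for every [N].  Its sum comes from the explicit
   solution of [h - T h = 1]: if [Phi_N w = t^N p + q] is the splitting forced by
   the orthogonality relations ([p] analytic inside, [q] outside and vanishing at
   infinity), then [h = tau p E], [S h = tau Phi_N / E - tau q D_e], and the mean of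
   [S h] over the circle is [tau Phi_N(0) / E(0) = Phi_N(0)]. *)
Require Import Defs.
From Stdlib Require Import Reals Lra Lia Psatz Classical IndefiniteDescription.
From Coquelicot Require Import Coquelicot.

Open Scope R_scope.
Open Scope C_scope.

(** * Limits and complex differentiability *)

(** Bounding the iterates by their size on the two circles requires Lambda r^N < 1/r - r; on the
    unit circle |S| = 1 gives a mean-square geometry that works for every N. The obstacle is that
    [E] may vanish beyond the unit circle and [De] within it, so [F] and 1/F are each known to be
    holomorphic on one side only. A radius R slightly above 1, with no zero of [E] in |z| <= R and
    none of [De] in |z| >= 1/R, lets the contours cross. No projection is constructed: being the
    negative or nonnegative part is a relation between a function and two summands, and Cauchy
    integrals supply the summands for the few functions that occur. Nor is 1 - T inverted: as h is
    explicit, removing the terms T^k 1 from h one by one leaves T^K h, which tends to 0. That h - T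
    h = 1 rests on the reversed polynomial Phi_N^*: on the circle, h minus the quotient by S of the
    negative part of S h is the conjugate of tau Phi_N^* / E, whose value at 0 is 1 because Phi_N^*
    is 1 there and E(0) = tau. *)

Lemma Cinv_0 : / (0 : C) = 0.
Proof. unfold Cinv, RtoC; simpl; unfold Rdiv; f_equal; ring. Qed.

(** Since the total inverse sends 0 to 0, this identity and the next two hold without side
    conditions. This makes the poles of [Di], encoded as zeros, harmless on the circle of radius
    [/ r]. *)
Lemma Cinv_mul (a b : C) : / (a * b) = / a * / b.
Proof.
destruct (Ceq_dec a 0) as [->|Ha]; [now rewrite Cmult_0_l, Cinv_0, Cmult_0_l|].
destruct (Ceq_dec b 0) as [->|Hb]; [now rewrite Cmult_0_r, Cinv_0, Cmult_0_r|].
now field.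
Qed.

Lemma Cinv_inv (a : C) : / / a = a.
Proof.
destruct (Ceq_dec a 0) as [->|Ha]; [now rewrite !Cinv_0|]; now field.
Qed.

Lemma Cconj_inv (a : C) : Cconj (/ a) = / Cconj a.
Proof.
destruct (Ceq_dec a 0) as [->|Ha]; [|now apply Cinv_conj].
assert (Cconj 0 = 0) as E by (unfold Cconj, RtoC; simpl; f_equal; ring).
now rewrite Cinv_0, E, Cinv_0.
Qed.

Lemma Cconj_R (x : R) : Cconj (RtoC x) = RtoC x.
Proof. unfold Cconj, RtoC; simpl; f_equal; ring. Qed.

Lemma Cmod_minus_sym (a b : C) : Cmod (a - b) = Cmod (b - a).
Proof. rewrite <- Cmod_opp; f_equal; ring. Qed.

Lemma Cmod_triangle_inv (a b : C) : (Cmod a - Cmod b <= Cmod (a - b))%R.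
Proof.
replace a with ((a - b) + b) at 1 by ring.
pose proof (Cmod_triangle (a - b) b); lra.
Qed.

Lemma Cmod_minus_le (a b : C) : (Cmod (a - b) <= Cmod a + Cmod b)%R.
Proof. unfold Cminus; rewrite <- (Cmod_opp b); apply Cmod_triangle. Qed.

Lemma Cmod_minus_triangle (a b c : C) :
  (Cmod (a - c) <= Cmod (a - b) + Cmod (b - c))%R.
Proof. replace (a - c) with ((a - b) + (b - c)) by ring; apply Cmod_triangle. Qed.

Lemma im_le_Cmod (c : C) : (Rabs (Im c) <= Cmod c)%R.
Proof.
eapply Rle_trans; [apply (Rmax_r (Rabs (fst c)))|apply Rmax_Cmod].
Qed.

Lemma Cmod_le_comp (c : C) : (Cmod c <= Rabs (Re c) + Rabs (Im c))%R.
Proof.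
destruct c as [x y].
replace (Cmod (x, y)) with (Cmod (RtoC x + Ci * RtoC y))
  by (f_equal; unfold Cplus, Cmult, RtoC, Ci; simpl; f_equal; ring).
eapply Rle_trans; [apply Cmod_triangle|].
rewrite Cmod_mult, Cmod_Ci, !Cmod_R; unfold Re, Im; simpl; lra.
Qed.

(** Stated with [Cmod] because [C] carries two uniform structures, that of its absolute value and
    the product one; the condition on the values is then independent of the choice. *)
Definition climit {T} (F : (T -> Prop) -> Prop) (f : T -> C) (l : C) : Prop :=
  forall eps : R, (0 < eps)%R -> F (fun x => (Cmod (f x - l) < eps)%R).

Section Climit.
Context {T : Type} {F : (T -> Prop) -> Prop} {FF : Filter F}.

Lemma climit_const c : climit F (fun _ => c) c.
Proof.
intros e He; apply filter_forall; intros _.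
replace (c - c) with (RtoC 0) by ring. now rewrite Cmod_0.
Qed.

Lemma climit_ext_loc f g l :
  F (fun x => f x = g x) -> climit F f l -> climit F g l.
Proof.
intros E H e He; generalize (filter_and _ _ E (H e He)).
apply filter_imp; intros x [-> Hx]; exact Hx.
Qed.

Lemma climit_ext f g l :
  (forall x, f x = g x) -> climit F f l -> climit F g l.
Proof. intros E; apply climit_ext_loc, filter_forall, E. Qed.

Lemma climit_plus f g a b :
  climit F f a -> climit F g b -> climit F (fun x => f x + g x) (a + b).
Proof.
intros Hf Hg e He; assert (He2 : (0 < e / 2)%R) by lra.
generalize (filter_and _ _ (Hf _ He2) (Hg _ He2)).
apply filter_imp; intros x [H1 H2].
replace (f x + g x - (a + b)) with ((f x - a) + (g x - b)) by ring.
eapply Rle_lt_trans; [apply Cmod_triangle|lra].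
Qed.

Lemma climit_bound f a :
  climit F f a -> F (fun x => (Cmod (f x) < Cmod a + 1)%R).
Proof.
intros H; generalize (H 1%R Rlt_0_1); apply filter_imp; intros x Hx.
pose proof (Cmod_triangle_inv (f x) a); lra.
Qed.

Lemma climit_mult f g a b :
  climit F f a -> climit F g b -> climit F (fun x => f x * g x) (a * b).
Proof.
intros Hf Hg e He.
pose proof (Cmod_ge_0 a) as Ha; pose proof (Cmod_ge_0 b) as Hb.
set (d := (e / (2 * (Cmod a + Cmod b + 1)))%R).
assert (Hd : (0 < d)%R) by (apply Rdiv_lt_0_compat; lra).
generalize (filter_and _ _ (climit_bound _ _ Hg)
  (filter_and _ _ (Hf d Hd) (Hg d Hd))).
apply filter_imp; intros x (H0 & H1 & H2).
replace (f x * g x - a * b) with ((f x - a) * g x + a * (g x - b)) by ring.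
eapply Rle_lt_trans; [apply Cmod_triangle|rewrite !Cmod_mult].
assert (d * (2 * (Cmod a + Cmod b + 1)) = e)%R as Ed by (unfold d; field; lra).
pose proof (Cmod_ge_0 (f x - a)); pose proof (Cmod_ge_0 (g x)); nra.
Qed.

Lemma climit_opp f a : climit F f a -> climit F (fun x => - f x) (- a).
Proof.
intros H e He; generalize (H e He); apply filter_imp; intros x Hx.
replace (- f x - - a) with (- (f x - a)) by ring; now rewrite Cmod_opp.
Qed.

Lemma climit_minus f g a b :
  climit F f a -> climit F g b -> climit F (fun x => f x - g x) (a - b).
Proof. intros Hf Hg; apply climit_plus; [exact Hf|now apply climit_opp]. Qed.

Lemma climit_conj f a : climit F f a -> climit F (fun x => Cconj (f x)) (Cconj a).
Proof.
intros H e He; generalize (H e He); apply filter_imp; intros x Hx.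
now rewrite <- Cminus_conj, Cmod_conj.
Qed.

Lemma climit_away f a :
  climit F f a -> a <> 0 -> F (fun x => (Cmod a / 2 < Cmod (f x))%R).
Proof.
intros H Ha; apply Cmod_gt_0 in Ha.
assert (Ha2 : (0 < Cmod a / 2)%R) by lra.
generalize (H _ Ha2); apply filter_imp; intros x Hx.
rewrite Cmod_minus_sym in Hx.
pose proof (Cmod_triangle_inv a (f x)); lra.
Qed.

Lemma climit_inv f a : climit F f a -> a <> 0 -> climit F (fun x => / f x) (/ a).
Proof.
intros H Ha e He; pose proof (climit_away _ _ H Ha) as H1.
pose proof (proj1 (Cmod_gt_0 a) Ha) as Ha'.
assert (He2 : (0 < e * (Cmod a * (Cmod a / 2)))%R)
  by (apply Rmult_lt_0_compat; [lra|apply Rmult_lt_0_compat; lra]).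
generalize (filter_and _ _ H1 (H _ He2)).
apply filter_imp; intros x [H2 H3].
assert (Hx : f x <> 0) by (apply Cmod_gt_0; lra).
replace (/ f x - / a) with (- (f x - a) * / (a * f x)) by (field; auto).
rewrite Cmod_mult, Cmod_opp, Cmod_inv, Cmod_mult by now apply Cmult_neq_0.
assert (0 < Cmod a * Cmod (f x))%R by (apply Rmult_lt_0_compat; lra).
apply Rmult_lt_reg_r with (Cmod a * Cmod (f x))%R; [assumption|].
rewrite Rmult_assoc, Rinv_l, Rmult_1_r by lra.
eapply Rlt_le_trans; [exact H3|].
apply Rmult_le_compat_l; [lra|]; apply Rmult_le_compat_l; lra.
Qed.

Lemma climit_pow f a n : climit F f a -> climit F (fun x => f x ^ n) (a ^ n).
Proof.
intros H; induction n as [|n IH]; simpl; [apply climit_const|].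
now apply climit_mult.
Qed.

End Climit.

Lemma climit_unique {T} {F : (T -> Prop) -> Prop} {FF : ProperFilter F} f a b :
  climit F f a -> climit F f b -> a = b.
Proof.
intros H1 H2; apply Ceq_minus, Cmod_eq_0.
destruct (Rle_lt_or_eq_dec 0 _ (Cmod_ge_0 (a - b))) as [H|H]; [exfalso|auto].
assert (He2 : (0 < Cmod (a - b) / 2)%R) by lra.
destruct (filter_ex _ (filter_and _ _ (H1 _ He2) (H2 _ He2))) as (x & Ha & Hb).
rewrite Cmod_minus_sym in Ha.
pose proof (Cmod_minus_triangle a (f x) b); lra.
Qed.

(** The neighbourhoods underlying [ex_derive] over [C_AbsRing]. Those of the product structure,
    which [ext_bv] uses, are the same by [locally_C]. *)
Definition cnear (z : C) : (C -> Prop) -> Prop :=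
  @locally (AbsRing_UniformSpace C_AbsRing) z.

#[global] Instance cnear_filter z : ProperFilter (cnear z).
Proof. exact (@locally_filter (AbsRing_UniformSpace C_AbsRing) z). Qed.

Lemma cnear_ball z (d : R) : (0 < d)%R -> cnear z (fun t => (Cmod (t - z) < d)%R).
Proof. intros Hd; exists (mkposreal d Hd); intros t Ht; exact Ht. Qed.

Lemma cnear_elim z P :
  cnear z P -> exists d : R, (0 < d)%R /\ forall t, (Cmod (t - z) < d)%R -> P t.
Proof. intros [d Hd]; exists d; split; [apply cond_pos|intros t Ht; apply Hd, Ht]. Qed.

Lemma cnear_self z P : cnear z P -> P z.
Proof.
intros H; destruct (cnear_elim _ _ H) as (d & Hd & H'); apply H'.
replace (z - z) with (RtoC 0) by ring; now rewrite Cmod_0.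
Qed.

Definition ccont (f : C -> C) (z : C) : Prop := climit (cnear z) f (f z).

Lemma climit_comp {T} (F : (T -> Prop) -> Prop) {FF : Filter F} (f : C -> C) g z :
  ccont f z -> climit F g z -> climit F (fun x => f (g x)) (f z).
Proof.
intros Hf Hg e He; destruct (cnear_elim _ _ (Hf e He)) as (d & Hd & H).
generalize (Hg d Hd); apply filter_imp; intros x Hx; now apply H.
Qed.

Lemma ccont_id z : ccont (fun t => t) z.
Proof. intros e He; now apply cnear_ball. Qed.

Lemma ccont_comp f g z : ccont f (g z) -> ccont g z -> ccont (fun t => f (g t)) z.
Proof. intros Hf Hg; now apply (climit_comp _ f g). Qed.

(* Caratheodory's form of complex differentiability. *)
Definition cdiff (f : C -> C) (z : C) : Prop :=
  exists phi, ccont phi z /\ cnear z (fun t => f t - f z = phi t * (t - z)).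

Lemma cdiff_ccont f z : cdiff f z -> ccont f z.
Proof.
intros (phi & Hp & H).
apply climit_ext_loc with (fun t => f z + phi t * (t - z)).
- revert H; apply filter_imp; intros t Ht; rewrite <- Ht; ring.
- assert (E : f z + phi z * (z - z) = f z) by ring.
  cut (climit (cnear z) (fun t => f z + phi t * (t - z)) (f z + phi z * (z - z))).
  { now rewrite E. }
  apply climit_plus; [apply climit_const|].
  apply climit_mult; [exact Hp|].
  apply climit_minus; [apply ccont_id|apply climit_const].
Qed.

Lemma cdiff_const c z : cdiff (fun _ => c) z.
Proof.
exists (fun _ => 0); split; [apply climit_const|].
apply filter_forall; intros t; ring.
Qed.

Lemma cdiff_id z : cdiff (fun t => t) z.
Proof.
exists (fun _ => 1); split; [apply climit_const|].
apply filter_forall; intros t; ring.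
Qed.

Lemma cdiff_plus f g z : cdiff f z -> cdiff g z -> cdiff (fun t => f t + g t) z.
Proof.
intros (p & Hp & H) (q & Hq & H'); exists (fun t => p t + q t); split.
- now apply climit_plus.
- generalize (filter_and _ _ H H'); apply filter_imp; intros t [H1 H2].
  replace (f t + g t - (f z + g z)) with ((f t - f z) + (g t - g z)) by ring.
  rewrite H1, H2; ring.
Qed.

Lemma cdiff_mult f g z : cdiff f z -> cdiff g z -> cdiff (fun t => f t * g t) z.
Proof.
intros Hf Hg; pose proof (cdiff_ccont _ _ Hg) as Cg.
destruct Hf as (p & Hp & H); destruct Hg as (q & Hq & H').
exists (fun t => p t * g t + f z * q t); split.
- apply climit_plus; apply climit_mult; auto; apply climit_const.
- generalize (filter_and _ _ H H'); apply filter_imp; intros t [H1 H2].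
  replace (f t * g t - f z * g z)
    with ((f t - f z) * g t + f z * (g t - g z)) by ring.
  rewrite H1, H2; ring.
Qed.

Lemma cdiff_opp f z : cdiff f z -> cdiff (fun t => - f t) z.
Proof.
intros (p & Hp & H); exists (fun t => - p t); split.
- now apply climit_opp.
- revert H; apply filter_imp; intros t Ht.
  replace (- f t - - f z) with (- (f t - f z)) by ring; rewrite Ht; ring.
Qed.

Lemma cdiff_minus f g z : cdiff f z -> cdiff g z -> cdiff (fun t => f t - g t) z.
Proof. intros Hf Hg; apply cdiff_plus; [exact Hf|now apply cdiff_opp]. Qed.

Lemma cdiff_inv f z : cdiff f z -> f z <> 0 -> cdiff (fun t => / f t) z.
Proof.
intros Hf Hz; pose proof (cdiff_ccont _ _ Hf) as Cf.
destruct Hf as (p & Hp & H).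
exists (fun t => - p t * / (f t * f z)); split.
- apply climit_mult; [now apply climit_opp|].
  apply climit_inv; [|now apply Cmult_neq_0].
  apply climit_mult; [exact Cf|apply climit_const].
- generalize (filter_and _ _ H (climit_away _ _ Cf Hz)).
  apply filter_imp; intros t [H1 H2].
  assert (f t <> 0) by (apply Cmod_gt_0; apply Cmod_gt_0 in Hz; lra).
  replace (/ f t - / f z) with (- (f t - f z) * / (f t * f z)) by (field; auto).
  rewrite H1; ring.
Qed.

Lemma cdiff_pow f n z : cdiff f z -> cdiff (fun t => f t ^ n) z.
Proof.
intros H; induction n as [|n IH]; simpl; [apply cdiff_const|].
now apply cdiff_mult.
Qed.

Lemma cdiff_comp f g z : cdiff f (g z) -> cdiff g z -> cdiff (fun t => f (g t)) z.
Proof.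
intros (p & Hp & H) Hg; pose proof (cdiff_ccont _ _ Hg) as Cg.
destruct Hg as (q & Hq & H').
exists (fun t => p (g t) * q t); split.
- apply climit_mult; [now apply (ccont_comp p g)|exact Hq].
- destruct (cnear_elim _ _ H) as (d & Hd & K).
  generalize (filter_and _ _ H' (Cg d Hd)); apply filter_imp; intros t [H1 H2].
  rewrite (K _ H2), H1; ring.
Qed.

Lemma cdiff_ext_loc f g z :
  cnear z (fun t => f t = g t) -> cdiff f z -> cdiff g z.
Proof.
intros E (p & Hp & H); exists p; split; [exact Hp|].
rewrite <- (cnear_self _ _ E).
generalize (filter_and _ _ E H); apply filter_imp; intros t [<- Ht]; exact Ht.
Qed.

Lemma cdiff_ext f g z : (forall t, f t = g t) -> cdiff f z -> cdiff g z.
Proof. intros E; apply cdiff_ext_loc, filter_forall, E. Qed.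

Lemma cdiff_expansion (f : C -> C) (z l : C) :
  (forall eps, (0 < eps)%R ->
    cnear z (fun t => (Cmod (f t - f z - (t - z) * l) <= eps * Cmod (t - z))%R)) ->
  cdiff f z.
Proof.
intros H.
exists (fun t => if Ceq_dec t z then l else (f t - f z) / (t - z)); split.
- intros e He.
  assert (He2 : (0 < e / 2)%R) by lra.
  generalize (H _ He2); apply filter_imp; intros t Ht.
  destruct (Ceq_dec z z) as [_|]; [|congruence].
  destruct (Ceq_dec t z) as [E|E].
  + replace (l - l) with (RtoC 0) by ring; now rewrite Cmod_0.
  + assert (t - z <> 0) as E' by now apply Cminus_eq_contra.
    replace ((f t - f z) / (t - z) - l)
      with (((f t - f z) - (t - z) * l) / (t - z)) by (field; auto).
    rewrite Cmod_div by auto; apply Cmod_gt_0 in E'.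
    apply Rle_lt_trans with (e / 2)%R; [|lra].
    apply Rmult_le_reg_r with (Cmod (t - z)); [auto|].
    unfold Rdiv at 1; rewrite Rmult_assoc, Rinv_l by lra; lra.
- apply filter_forall; intros t.
  destruct (Ceq_dec t z) as [->|E]; [ring|].
  field; now apply Cminus_eq_contra.
Qed.

Lemma ex_derive_cdiff (f : C -> C) (z : C) :
  ex_derive (K := C_AbsRing) (V := C_NormedModule) f z -> cdiff f z.
Proof.
intros (l & _ & H); apply cdiff_expansion with l; intros e He.
exact (H z (fun P HP => HP) (mkposreal e He)).
Qed.

(** * Continuity of complex functions along the real line *)

Definition rcont (g : R -> C) (x : R) : Prop := climit (locally x) g (g x).

Lemma rcont_continuous (g : R -> C) x :
  rcont g x -> continuous (U := C_R_CompleteNormedModule) g x.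
Proof.
intros H P [e He]. 
unfold filtermap; generalize (H e (cond_pos e)); apply filter_imp; intros y Hy; apply He.
apply C_NormedModule_mixin_compat1; exact Hy.
Qed.

Lemma continuous_RtoC (g : R -> R) x : continuous g x -> rcont (fun y => RtoC (g y)) x.
Proof.
intros H e He.
generalize (proj1 (filterlim_locally _ _) H (mkposreal e He)); apply filter_imp.
intros y Hy; rewrite <- RtoC_minus, Cmod_R; exact Hy.
Qed.

Lemma rcont_Re (g : R -> C) x : rcont g x -> continuous (fun y => Re (g y)) x.
Proof.
intros H; apply filterlim_locally; intros e.
generalize (H e (cond_pos e)); apply filter_imp; intros y Hy.
eapply Rle_lt_trans; [|exact Hy]; exact (re_le_Cmod (g y - g x)).
Qed.

Lemma rcont_pair (f g : R -> R) x :
  continuous f x -> continuous g x -> rcont (fun y => (f y, g y)) x.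
Proof.
intros Hf Hg.
apply climit_ext with (fun y => RtoC (f y) + Ci * RtoC (g y)).
- intros y; unfold Cplus, Cmult, RtoC, Ci; simpl; f_equal; ring.
- replace (f x, g x) with (RtoC (f x) + Ci * RtoC (g x))
    by (unfold Cplus, Cmult, RtoC, Ci; simpl; f_equal; ring).
  apply climit_plus; [now apply continuous_RtoC|].
  apply climit_mult; [apply climit_const|now apply continuous_RtoC].
Qed.

(** * Goursat's theorem on rectangles *)

Definition rcont_on (g : R -> C) (a b : R) : Prop :=
  forall x, (a <= x <= b)%R -> rcont g x.

Lemma is_CRInt (g : R -> C) (a b : R) :
  (a <= b)%R -> rcont_on g a b ->
  is_RInt (V := C_R_NormedModule) g a b (CRInt g a b).
Proof.
intros Hab H; apply (RInt_correct (V := C_R_CompleteNormedModule)).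
apply ex_RInt_continuous; intros z.
rewrite Rmin_left, Rmax_right by assumption.
intros Hz; apply rcont_continuous, H, Hz.
Qed.

Lemma CRInt_unique (g : R -> C) (a b : R) (l : C) :
  is_RInt (V := C_R_NormedModule) g a b l -> CRInt g a b = l.
Proof. apply (is_RInt_unique (V := C_R_CompleteNormedModule)). Qed.

Lemma is_CRInt_pair (g : R -> C) (a b : R) (l : C) :
  is_RInt (V := C_R_NormedModule) g a b l ->
  is_RInt (fun x => Re (g x)) a b (Re l) /\ is_RInt (fun x => Im (g x)) a b (Im l).
Proof.
intros H; split.
- exact (is_RInt_fct_extend_fst (U := R_NormedModule) (V := R_NormedModule) g a b l H).
- exact (is_RInt_fct_extend_snd (U := R_NormedModule) (V := R_NormedModule) g a b l H).
Qed.

Lemma pair_is_CRInt (g : R -> C) (a b : R) (l : C) :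
  is_RInt (fun x => Re (g x)) a b (Re l) -> is_RInt (fun x => Im (g x)) a b (Im l) ->
  is_RInt (V := C_R_NormedModule) g a b l.
Proof.
intros H1 H2; destruct l as [l1 l2].
exact (is_RInt_fct_extend_pair (U := R_NormedModule) (V := R_NormedModule) g a b
  l1 l2 H1 H2).
Qed.

Lemma CRInt_Re (g : R -> C) (a b : R) :
  (a <= b)%R -> rcont_on g a b -> Re (CRInt g a b) = RInt (fun x => Re (g x)) a b.
Proof.
intros Hab H; symmetry; apply is_RInt_unique.
apply (is_CRInt_pair g), is_CRInt; assumption.
Qed.

Lemma CRInt_ext (f g : R -> C) (a b : R) :
  (a <= b)%R -> (forall x, (a < x < b)%R -> f x = g x) -> CRInt f a b = CRInt g a b.
Proof.
intros Hab H; apply (RInt_ext (V := C_R_CompleteNormedModule)).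
intros x; rewrite Rmin_left, Rmax_right by assumption; apply H.
Qed.

Lemma CRInt_plus (f g : R -> C) (a b : R) :
  (a <= b)%R -> rcont_on f a b -> rcont_on g a b ->
  CRInt (fun x => f x + g x) a b = CRInt f a b + CRInt g a b.
Proof.
intros Hab Hf Hg; apply CRInt_unique.
apply (is_RInt_plus (V := C_R_NormedModule)); now apply is_CRInt.
Qed.

(** [CRInt] integrates in a real vector space, whose linearity covers real factors only; a complex
    factor is treated on the real and imaginary parts. *)
Lemma CRInt_scal (c : C) (f : R -> C) (a b : R) :
  (a <= b)%R -> rcont_on f a b -> CRInt (fun x => c * f x) a b = c * CRInt f a b.
Proof.
intros Hab Hf; apply CRInt_unique.
destruct (is_CRInt_pair _ _ _ _ (is_CRInt f a b Hab Hf)) as [H1 H2].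
apply pair_is_CRInt.
- apply (is_RInt_minus (V := R_NormedModule));
    apply (is_RInt_scal (V := R_NormedModule)); assumption.
- apply (is_RInt_plus (V := R_NormedModule));
    apply (is_RInt_scal (V := R_NormedModule)); assumption.
Qed.

Lemma CRInt_conj (f : R -> C) (a b : R) :
  (a <= b)%R -> rcont_on f a b ->
  CRInt (fun x => Cconj (f x)) a b = Cconj (CRInt f a b).
Proof.
intros Hab Hf; apply CRInt_unique.
destruct (is_CRInt_pair _ _ _ _ (is_CRInt f a b Hab Hf)) as [H1 H2].
apply pair_is_CRInt; [exact H1|].
exact (is_RInt_opp (V := R_NormedModule) _ _ _ _ H2).
Qed.

Lemma rcont_on_opp (f : R -> C) a b :
  rcont_on f a b -> rcont_on (fun x => - f x) a b.
Proof. intros H x Hx; now apply climit_opp, H. Qed.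

Lemma CRInt_opp (f : R -> C) (a b : R) :
  (a <= b)%R -> rcont_on f a b -> CRInt (fun x => - f x) a b = - CRInt f a b.
Proof.
intros Hab Hf.
rewrite (CRInt_ext (fun x => - f x) (fun x => - (1) * f x))
  by (assumption || intros; ring).
rewrite CRInt_scal by assumption; ring.
Qed.

Lemma CRInt_minus (f g : R -> C) (a b : R) :
  (a <= b)%R -> rcont_on f a b -> rcont_on g a b ->
  CRInt (fun x => f x - g x) a b = CRInt f a b - CRInt g a b.
Proof.
intros Hab Hf Hg; unfold Cminus.
rewrite CRInt_plus, CRInt_opp by (assumption || now apply rcont_on_opp); reflexivity.
Qed.

Lemma CRInt_const (c : C) (a b : R) : CRInt (fun _ => c) a b = RtoC (b - a) * c.
Proof.
apply CRInt_unique.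
rewrite <- scal_R_Cmult.
exact (is_RInt_const (V := C_R_NormedModule) a b c).
Qed.

Lemma CRInt_bound (f : R -> C) (a b M : R) :
  (a <= b)%R -> rcont_on f a b -> (forall x, (a <= x <= b)%R -> (Cmod (f x) <= M)%R) ->
  (Cmod (CRInt f a b) <= (b - a) * M)%R.
Proof.
intros Hab Hf HM.
(* The norm of the product module is the Euclidean norm of the absolute values of the components,
   hence [Cmod]. *)
assert (N : forall z : C, @norm R_AbsRing C_R_NormedModule z = Cmod z).
{ intros z; unfold Cmod; rewrite <- (pow2_abs (fst z)), <- (pow2_abs (snd z)).
  reflexivity. }
rewrite <- N; apply norm_RInt_le_const with (f := f); [assumption| |].
- intros x Hx; rewrite N; now apply HM.
- now apply is_CRInt.
Qed.

Lemma CRInt_Chasles (f : R -> C) (a b c : R) :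
  (a <= b)%R -> (b <= c)%R -> rcont_on f a c ->
  CRInt f a c = CRInt f a b + CRInt f b c.
Proof.
intros Hab Hbc H; symmetry.
apply (RInt_Chasles (V := C_R_CompleteNormedModule)); eexists; apply is_CRInt;
  try assumption; intros x Hx; apply H; lra.
Qed.

Lemma rcont_line_h (g : C -> C) x y : ccont g (x, y) -> rcont (fun t => g (t, y)) x.
Proof.
intros H; apply (climit_comp (locally x) g (fun t => (t, y))); [exact H|].
apply rcont_pair; [apply continuous_id|apply continuous_const].
Qed.

Lemma rcont_line_v (g : C -> C) x y : ccont g (x, y) -> rcont (fun t => g (x, t)) y.
Proof.
intros H; apply (climit_comp (locally y) g (fun t => (x, t))); [exact H|].
apply rcont_pair; [apply continuous_const|apply continuous_id].
Qed.

(* The integral of [g] over the positively oriented boundary of the rectangle. *)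
Definition rect_int (g : C -> C) (x1 x2 y1 y2 : R) : C :=
  CRInt (fun x => g (x, y1)) x1 x2 - CRInt (fun x => g (x, y2)) x1 x2 +
  Ci * (CRInt (fun y => g (x2, y)) y1 y2 - CRInt (fun y => g (x1, y)) y1 y2).

Definition ccont_rect (g : C -> C) (x1 x2 y1 y2 : R) : Prop :=
  forall x y, (x1 <= x <= x2)%R -> (y1 <= y <= y2)%R -> ccont g (x, y).

Lemma rect_int_split_x g x1 x x2 y1 y2 :
  (x1 <= x <= x2)%R -> (y1 <= y2)%R -> ccont_rect g x1 x2 y1 y2 ->
  rect_int g x1 x2 y1 y2 = rect_int g x1 x y1 y2 + rect_int g x x2 y1 y2.
Proof.
intros Hx Hy H; unfold rect_int.
rewrite (CRInt_Chasles (fun t => g (t, y1)) x1 x x2),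
  (CRInt_Chasles (fun t => g (t, y2)) x1 x x2); try lra; [ring| |];
  intros t Ht; apply rcont_line_h, H; lra.
Qed.

Lemma rect_int_split_y g x1 x2 y1 y y2 :
  (x1 <= x2)%R -> (y1 <= y <= y2)%R -> ccont_rect g x1 x2 y1 y2 ->
  rect_int g x1 x2 y1 y2 = rect_int g x1 x2 y1 y + rect_int g x1 x2 y y2.
Proof.
intros Hx Hy H; unfold rect_int.
rewrite (CRInt_Chasles (fun t => g (x1, t)) y1 y y2),
  (CRInt_Chasles (fun t => g (x2, t)) y1 y y2); try lra; [ring| |];
  intros t Ht; apply rcont_line_v, H; lra.
Qed.

Lemma rect_int_minus f g x1 x2 y1 y2 :
  (x1 <= x2)%R -> (y1 <= y2)%R -> ccont_rect f x1 x2 y1 y2 ->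
  ccont_rect g x1 x2 y1 y2 ->
  rect_int (fun z => f z - g z) x1 x2 y1 y2 =
  rect_int f x1 x2 y1 y2 - rect_int g x1 x2 y1 y2.
Proof.
intros Hx Hy Hf Hg; unfold rect_int.
rewrite !CRInt_minus; try assumption; try (intros t Ht);
  try (apply rcont_line_h; (apply Hf || apply Hg); lra);
  try (apply rcont_line_v; (apply Hf || apply Hg); lra); ring.
Qed.

Lemma rect_int_bound g x1 x2 y1 y2 M :
  (x1 <= x2)%R -> (y1 <= y2)%R -> ccont_rect g x1 x2 y1 y2 ->
  (forall x y, (x1 <= x <= x2)%R -> (y1 <= y <= y2)%R -> (Cmod (g (x, y)) <= M)%R) ->
  (Cmod (rect_int g x1 x2 y1 y2) <= 2 * ((x2 - x1) + (y2 - y1)) * M)%R.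
Proof.
intros Hx Hy Hg HM; unfold rect_int.
assert (Hh : forall y, (y1 <= y <= y2)%R ->
  (Cmod (CRInt (fun x => g (x, y)) x1 x2) <= (x2 - x1) * M)%R).
{ intros y Hy'; apply CRInt_bound; [assumption| |].
  - intros x Hx'; now apply rcont_line_h, Hg.
  - intros x Hx'; now apply HM. }
assert (Hv : forall x, (x1 <= x <= x2)%R ->
  (Cmod (CRInt (fun y => g (x, y)) y1 y2) <= (y2 - y1) * M)%R).
{ intros x Hx'; apply CRInt_bound; [assumption| |].
  - intros y Hy'; now apply rcont_line_v, Hg.
  - intros y Hy'; now apply HM. }
pose proof (Hh y1 ltac:(lra)); pose proof (Hh y2 ltac:(lra)).
pose proof (Hv x1 ltac:(lra)); pose proof (Hv x2 ltac:(lra)).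
eapply Rle_trans; [apply Cmod_triangle|].
rewrite Cmod_mult, Cmod_Ci.
eapply Rle_trans; [apply Rplus_le_compat; [apply Cmod_minus_le|
  apply Rmult_le_compat_l; [lra|apply Cmod_minus_le]]|].
lra.
Qed.

Lemma is_RInt_affine (p q a b : R) :
  is_RInt (fun x => p + q * x)%R a b (p * (b - a) + q * ((b * b - a * a) / 2))%R.
Proof.
evar_last.
- apply (is_RInt_derive (V := R_CompleteNormedModule)
    (fun x => p * x + q * (x * x / 2))%R (fun x => p + q * x)%R).
  + intros x _; auto_derive; [exact I|field].
  + intros x _; apply (ex_derive_continuous (V := R_NormedModule)); auto_derive; exact I.
- unfold minus, plus, opp; simpl; field.
Qed.

Lemma CRInt_affine (P Q : C) (a b : R) :
  CRInt (fun x => P + Q * RtoC x) a b =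
  P * RtoC (b - a) + Q * RtoC ((b * b - a * a) / 2).
Proof.
apply CRInt_unique, pair_is_CRInt.
- eapply is_RInt_ext; [|evar_last; [apply (is_RInt_affine (Re P) (Re Q) a b)|]].
  + intros x _; unfold Re; simpl; ring.
  + unfold Re; simpl; ring.
- eapply is_RInt_ext; [|evar_last; [apply (is_RInt_affine (Im P) (Im Q) a b)|]].
  + intros x _; unfold Im; simpl; ring.
  + unfold Im; simpl; ring.
Qed.

Lemma pair_C (x y : R) : ((x, y) : C) = RtoC x + Ci * RtoC y.
Proof. unfold Cplus, Cmult, RtoC, Ci; simpl; f_equal; ring. Qed.

(** This removes the tangent part of a differentiable function from the integral over a small
    rectangle. *)
Lemma rect_int_affine (A B : C) x1 x2 y1 y2 :
  (x1 <= x2)%R -> (y1 <= y2)%R ->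
  rect_int (fun z => A + B * z) x1 x2 y1 y2 = 0.
Proof.
intros Hx Hy; unfold rect_int.
assert (Hh : forall y, CRInt (fun x => A + B * (x, y)) x1 x2 =
  (A + B * (Ci * RtoC y)) * RtoC (x2 - x1) + B * RtoC ((x2 * x2 - x1 * x1) / 2)).
{ intros y; rewrite <- CRInt_affine; apply CRInt_ext; [assumption|].
  intros x _; rewrite pair_C; ring. }
assert (Hv : forall x, CRInt (fun y => A + B * (x, y)) y1 y2 =
  (A + B * RtoC x) * RtoC (y2 - y1) + B * Ci * RtoC ((y2 * y2 - y1 * y1) / 2)).
{ intros x; rewrite <- CRInt_affine; apply CRInt_ext; [assumption|].
  intros y _; rewrite pair_C; ring. }
rewrite !Hh, !Hv, !RtoC_minus; ring.
Qed.

Lemma ccont_affine (A B z : C) : ccont (fun t => A + B * t) z.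
Proof.
apply climit_plus; [apply climit_const|].
apply climit_mult; [apply climit_const|apply ccont_id].
Qed.

(* On a small rectangle around a point of differentiability only the remainder
   of the first-order expansion contributes. *)
Lemma rect_int_local g z eps :
  cdiff g z -> (0 < eps)%R ->
  exists d, (0 < d)%R /\ forall x1 x2 y1 y2, (x1 <= Re z <= x2)%R -> (y1 <= Im z <= y2)%R ->
    (x2 - x1 + (y2 - y1) < d)%R -> ccont_rect g x1 x2 y1 y2 ->
    (Cmod (rect_int g x1 x2 y1 y2) <=
      eps * ((x2 - x1) ^ 2 + (y2 - y1) ^ 2))%R.
Proof.
intros (p & Hp & H) He.
(* The 4 pays for the 2 in the perimeter 2 (a + b) and for the 2 in (a + b)^2 <= 2 (a^2 + b^2). *)
assert (He4 : (0 < eps / 4)%R) by lra.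
destruct (cnear_elim _ _ (filter_and _ _ H (Hp _ He4))) as (d & Hd & K).
exists d; split; [assumption|].
intros x1 x2 y1 y2 Hx Hy Hs Hg.
set (A := g z - p z * z).
assert (E : rect_int g x1 x2 y1 y2 =
  rect_int (fun t => g t - (A + p z * t)) x1 x2 y1 y2).
{ rewrite rect_int_minus, rect_int_affine by (lra || exact Hg || intros ? ? ? ?; apply ccont_affine).
  ring. }
rewrite E.
eapply Rle_trans; [apply rect_int_bound with
  (M := (eps / 4 * (x2 - x1 + (y2 - y1)))%R); try lra|].
- intros x y Hx' Hy'; apply climit_minus; [now apply Hg|apply ccont_affine].
- intros x y Hx' Hy'.
  assert (Hz : (Cmod ((x, y) - z) <= x2 - x1 + (y2 - y1))%R).
  { eapply Rle_trans; [apply Cmod_le_comp|].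
    assert (Re ((x, y) - z) = x - Re z)%R as -> by (unfold Re; simpl; ring).
    assert (Im ((x, y) - z) = y - Im z)%R as -> by (unfold Im; simpl; ring).
    apply Rplus_le_compat; apply Rabs_le; lra. }
  destruct (K (x, y)) as [K1 K2]; [lra|].
  replace (g (x, y) - (A + p z * (x, y)))
    with ((g (x, y) - g z) - p z * ((x, y) - z)) by (unfold A; ring).
  rewrite K1.
  replace (p (x, y) * ((x, y) - z) - p z * ((x, y) - z))
    with ((p (x, y) - p z) * ((x, y) - z)) by ring.
  rewrite Cmod_mult; apply Rmult_le_compat; try apply Cmod_ge_0; lra.
- set (a := (x2 - x1)%R); set (b := (y2 - y1)%R).
  replace (2 * (a + b) * (eps / 4 * (a + b)))%R
    with (eps * ((a + b) ^ 2 / 2))%R by field.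
  apply Rmult_le_compat_l; [lra|].
  pose proof (pow2_ge_0 (a - b)); nra.
Qed.

(** The [u k] are left ends of nested intervals of length L / 2^k. They increase while the right
    ends decrease, so the limit lies in every interval. *)
Lemma nested_limit (u : nat -> R) (L : R) :
  (0 <= L)%R ->
  (forall k, (u k <= u (S k) <= u k + L / 2 ^ S k)%R) ->
  exists l, forall k, (u k <= l <= u k + L / 2 ^ k)%R.
Proof.
intros HL Hu.
assert (P : forall k, (0 < 2 ^ k)%R) by (intros; apply pow_lt; lra).
assert (Hup : forall m k, (u k <= u (k + m)%nat <= u k + (L / 2 ^ k - L / 2 ^ (k + m)))%R).
{ induction m as [|m IH]; intros k.
  - rewrite Nat.add_0_r; lra.
  - rewrite <- plus_n_Sm; pose proof (IH k); pose proof (Hu (k + m)%nat).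
    assert (L / 2 ^ (k + m) = 2 * (L / 2 ^ S (k + m)))%R
      by (simpl; field; apply Rgt_not_eq, P).
    lra. }
destruct (ex_finite_lim_seq_incr u (u 0%nat + L)) as [l Hl].
- intros k; apply Hu.
- intros k; pose proof (Hup k 0%nat) as H; simpl Nat.add in H; simpl pow in H.
  assert (0 <= L / 2 ^ k)%R by (apply Rdiv_le_0_compat; auto); lra.
- exists l; intros k; split.
  + apply (is_lim_seq_incr_compare u); [exact Hl|intros; apply Hu].
  + assert (Hk : is_lim_seq (fun m => u (m + k)%nat) l) by now apply is_lim_seq_incr_n.
    apply (is_lim_seq_le (fun m => u (m + k)%nat) (fun _ => (u k + L / 2 ^ k)%R)
      (Finite l) (Finite (u k + L / 2 ^ k)%R)); [|exact Hk|apply is_lim_seq_const].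
    intros m; rewrite Nat.add_comm; pose proof (Hup m k).
    assert (0 <= L / 2 ^ (k + m))%R by (apply Rdiv_le_0_compat; auto); lra.
Qed.

(** Bisection: the bound eps (a^2 + b^2) drops by the factor 4 when both sides are halved, which is
    exactly what is lost by passing to the worst of four quarters. A large integral thus survives
    down to a point, where [rect_int_local] forbids it. *)
Theorem goursat (g : C -> C) (x1 x2 y1 y2 : R) :
  (x1 <= x2)%R -> (y1 <= y2)%R ->
  (forall x y, (x1 <= x <= x2)%R -> (y1 <= y <= y2)%R -> cdiff g (x, y)) ->
  rect_int g x1 x2 y1 y2 = 0.
Proof.
intros Hx Hy Hg.
assert (Cg : ccont_rect g x1 x2 y1 y2) by (intros x y Hx' Hy'; now apply cdiff_ccont, Hg).
set (a := (x2 - x1)%R); set (b := (y2 - y1)%R).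
assert (P : forall k, (0 < 2 ^ k)%R) by (intros; apply pow_lt; lra).
assert (Pa : forall k, (0 <= a / 2 ^ k)%R)
  by (intros; apply Rdiv_le_0_compat; [unfold a; lra|auto]).
assert (Pb : forall k, (0 <= b / 2 ^ k)%R)
  by (intros; apply Rdiv_le_0_compat; [unfold b; lra|auto]).
apply Cmod_eq_0.
destruct (Rle_lt_or_eq_dec 0 _ (Cmod_ge_0 (rect_int g x1 x2 y1 y2)))
  as [Hpos|Hz]; [exfalso|now symmetry].
assert (Hab : (0 <= a ^ 2 + b ^ 2)%R) by (pose proof (pow2_ge_0 a); pose proof (pow2_ge_0 b); lra).
(* Chosen so that the initial rectangle is [bad]; the + 1 keeps the denominator positive for a
   rectangle reduced to a point. *)
set (eps := (Cmod (rect_int g x1 x2 y1 y2) / (2 * (a ^ 2 + b ^ 2 + 1)))%R).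
assert (He : (0 < eps)%R) by (apply Rdiv_lt_0_compat; lra).
set (Q := fun (k : nat) (p : R * R) =>
  rect_int g (fst p) (fst p + a / 2 ^ k) (snd p) (snd p + b / 2 ^ k)).
set (bad := fun (k : nat) (p : R * R) =>
  (x1 <= fst p /\ fst p + a / 2 ^ k <= x2)%R /\ (y1 <= snd p /\ snd p + b / 2 ^ k <= y2)%R /\
  (eps * (a ^ 2 + b ^ 2) / 4 ^ k < Cmod (Q k p))%R).
(* The premise [bad] sits under the existential so that every pair has some image and the choice
   principle applies to all of them. *)
assert (Hstep : forall kp : nat * (R * R), exists p' : R * R, bad (fst kp) (snd kp) ->
  bad (S (fst kp)) p' /\
  (fst (snd kp) <= fst p' <= fst (snd kp) + a / 2 ^ S (fst kp))%R /\
  (snd (snd kp) <= snd p' <= snd (snd kp) + b / 2 ^ S (fst kp))%R).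
{ intros [k [x y]]; cbn [fst snd].
  destruct (classic (bad k (x, y))) as [B|NB]; [|exists (x, y); intros; contradiction].
  assert (B' := B); destruct B' as (Bx & By & BQ); cbn [fst snd] in Bx, By.
  set (hx := (a / 2 ^ S k)%R); set (hy := (b / 2 ^ S k)%R).
  assert (Ex : (a / 2 ^ k = hx + hx)%R) by (unfold hx; simpl; field; apply Rgt_not_eq, P).
  assert (Ey : (b / 2 ^ k = hy + hy)%R) by (unfold hy; simpl; field; apply Rgt_not_eq, P).
  assert (hx0 : (0 <= hx)%R) by apply Pa; assert (hy0 : (0 <= hy)%R) by apply Pb.
  assert (S4 : Q k (x, y) = Q (S k) (x, y) + Q (S k) ((x + hx)%R, y) +
    (Q (S k) (x, (y + hy)%R) + Q (S k) ((x + hx)%R, (y + hy)%R))).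
  { unfold Q; cbn [fst snd]; fold hx hy; rewrite Ex, Ey.
    replace (x + (hx + hx))%R with (x + hx + hx)%R by ring.
    replace (y + (hy + hy))%R with (y + hy + hy)%R by ring.
    rewrite (rect_int_split_y g x _ y (y + hy)%R (y + hy + hy)%R),
      (rect_int_split_x g x (x + hx)%R (x + hx + hx)%R y (y + hy)%R),
      (rect_int_split_x g x (x + hx)%R (x + hx + hx)%R (y + hy)%R (y + hy + hy)%R);
      try lra; try reflexivity; intros u v Hu Hv; apply Cg; lra. }
  set (M := (eps * (a ^ 2 + b ^ 2) / 4 ^ S k)%R).
  assert (EM : (eps * (a ^ 2 + b ^ 2) / 4 ^ k = 4 * M)%R)
    by (unfold M; simpl; field; apply Rgt_not_eq, pow_lt; lra).
  rewrite EM, S4 in BQ.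
  assert (T : forall p, (x <= fst p <= x + hx)%R -> (y <= snd p <= y + hy)%R ->
    (M < Cmod (Q (S k) p))%R -> exists p' : R * R, bad k (x, y) ->
    bad (S k) p' /\ (x <= fst p' <= x + hx)%R /\ (y <= snd p' <= y + hy)%R).
  { intros p Hp1 Hp2 HM; exists p; intros _; split; [|now split].
    repeat split; fold hx hy; try lra; exact HM. }
  destruct (Rlt_le_dec M (Cmod (Q (S k) (x, y)))) as [L1|L1];
    [apply (T _) in L1; cbn [fst snd]; auto; lra|].
  destruct (Rlt_le_dec M (Cmod (Q (S k) ((x + hx)%R, y)))) as [L2|L2];
    [apply (T _) in L2; cbn [fst snd]; auto; lra|].
  destruct (Rlt_le_dec M (Cmod (Q (S k) (x, (y + hy)%R)))) as [L3|L3];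
    [apply (T _) in L3; cbn [fst snd]; auto; lra|].
  destruct (Rlt_le_dec M (Cmod (Q (S k) ((x + hx)%R, (y + hy)%R)))) as [L4|L4];
    [apply (T _) in L4; cbn [fst snd]; auto; lra|].
  exfalso; revert BQ; apply Rle_not_lt.
  eapply Rle_trans; [apply Cmod_triangle|].
  eapply Rle_trans; [apply Rplus_le_compat; apply Cmod_triangle|lra]. }
destruct (functional_choice _ Hstep) as [f Hf].
set (s := fix s (k : nat) : R * R :=
  match k with O => (x1, y1) | S j => f (j, s j) end).
assert (Hs : forall k, bad k (s k)).
{ induction k as [|k IH]; [|exact (proj1 (Hf (k, s k) IH))].
  unfold bad, Q; simpl; unfold a, b; repeat split; try lra.
  replace (x1 + (x2 - x1) / 1)%R with x2 by field.
  replace (y1 + (y2 - y1) / 1)%R with y2 by field.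
  fold a b; change (a * (a * 1))%R with (a ^ 2)%R; change (b * (b * 1))%R with (b ^ 2)%R.
  assert (eps * (2 * (a ^ 2 + b ^ 2 + 1)) = Cmod (rect_int g x1 x2 y1 y2))%R
    by (unfold eps; field; lra).
  nra. }
destruct (nested_limit (fun k => fst (s k)) a) as [lx Hlx];
  [unfold a; lra|intros k; exact (proj1 (proj2 (Hf (k, s k) (Hs k))))|].
destruct (nested_limit (fun k => snd (s k)) b) as [ly Hly];
  [unfold b; lra|intros k; exact (proj2 (proj2 (Hf (k, s k) (Hs k))))|].
destruct (rect_int_local g (lx, ly) eps) as (d & Hd & K); [|exact He|].
{ destruct (Hs 0%nat) as (B1 & B2 & _); specialize (Hlx 0%nat); specialize (Hly 0%nat).
  apply Hg; lra. }
assert (Hk : exists k, (a / 2 ^ k + b / 2 ^ k < d)%R).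
{ destruct (nfloor_ex ((a + b) / d)) as [n Hn].
  { apply Rdiv_le_0_compat; unfold a, b; lra. }
  exists (S n); rewrite <- Rdiv_plus_distr; apply Rlt_div_l; [apply P|].
  assert (INR (S n) <= 2 ^ S n)%R.
  { clear; induction (S n) as [|m IH]; [simpl; lra|rewrite S_INR; simpl].
    assert (1 <= 2 ^ m)%R by (apply pow_R1_Rle; lra); lra. }
  rewrite S_INR in H.
  apply Rlt_le_trans with (d * (INR n + 1))%R; [|apply Rmult_le_compat_l; lra].
  destruct Hn as [_ Hn]; apply Rlt_div_l in Hn; lra. }
destruct Hk as [k Hk]; destruct (Hs k) as (B1 & B2 & BQ).
specialize (Hlx k); specialize (Hly k).
assert (C1 := K (fst (s k)) (fst (s k) + a / 2 ^ k)%R (snd (s k)) (snd (s k) + b / 2 ^ k)%R).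
apply (Rlt_not_le _ _ BQ); eapply Rle_trans; [apply C1|].
- exact Hlx.
- exact Hly.
- lra.
- intros u v Hu Hv; apply Cg; lra.
- apply Req_le.
  replace (4 ^ k)%R with (2 ^ k * 2 ^ k)%R
    by (rewrite <- Rpow_mult_distr; f_equal; ring).
  field; apply Rgt_not_eq, P.
Qed.

(** * Means over circles *)

Lemma cis_plus (a b : R) : cis (a + b) = cis a * cis b.
Proof. unfold cis, Cmult; simpl; rewrite cos_plus, sin_plus; f_equal; ring. Qed.

Lemma cis_0 : cis 0 = 1.
Proof. unfold cis; rewrite cos_0, sin_0; reflexivity. Qed.

Lemma cis_2PI : cis (2 * PI) = 1.
Proof. unfold cis; rewrite cos_2PI, sin_2PI; reflexivity. Qed.

Lemma Cmod_cis (a : R) : Cmod (cis a) = 1%R.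
Proof.
unfold Cmod, cis; simpl fst; simpl snd.
rewrite <- sqrt_1; f_equal.
rewrite Rplus_comm, <- !Rsqr_pow2; apply sin2_cos2.
Qed.

Lemma cis_neq_0 (a : R) : cis a <> 0.
Proof. apply Cmod_gt_0; rewrite Cmod_cis; lra. Qed.

Lemma Cconj_cis (a : R) : Cconj (cis a) = / cis a.
Proof.
pose proof (Cmod2_conj (cis a)) as H; rewrite Cmod_cis in H.
replace (Cconj (cis a)) with (/ cis a * (cis a * Cconj (cis a)))
  by (field; apply cis_neq_0).
rewrite <- H; replace (RtoC (1 ^ 2)) with (RtoC 1) by (f_equal; ring); ring.
Qed.

Lemma unit_conj (t : C) : Cmod t = 1%R -> t <> 0 /\ Cconj t = / t.
Proof.
intros Ht; assert (t <> 0) by (apply Cmod_gt_0; lra); split; [assumption|].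
pose proof (Cmod2_conj t) as H1; rewrite Ht in H1.
replace (Cconj t) with (/ t * (t * Cconj t)) by (field; assumption).
rewrite <- H1; replace (RtoC (1 ^ 2)) with (RtoC 1) by (f_equal; ring); ring.
Qed.

Lemma polar (z : C) : exists theta, (0 <= theta <= 2 * PI)%R /\ z = RtoC (Cmod z) * cis theta.
Proof.
destruct (Ceq_dec z 0) as [->|Hz].
{ exists 0%R; split; [pose proof PI_RGT_0; lra|rewrite Cmod_0; ring]. }
apply Cmod_gt_0 in Hz; set (s := Cmod z) in *.
destruct z as [x y].
assert (E : (x ^ 2 + y ^ 2 = s ^ 2)%R).
{ unfold s, Cmod; simpl fst; simpl snd; rewrite pow2_sqrt; [ring|nra]. }
set (u := (x / s)%R); set (v := (y / s)%R).
assert (Ex : x = (s * u)%R) by (unfold u; field; lra).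
assert (Ey : y = (s * v)%R) by (unfold v; field; lra).
assert (Euv : (u ^ 2 + v ^ 2 = 1)%R).
{ apply Rmult_eq_reg_l with (s ^ 2)%R; [|apply Rgt_not_eq; nra]; rewrite Ex, Ey in E; lra. }
assert (Hu : (-1 <= u <= 1)%R) by nra.
pose proof (acos_bound u) as Ha.
assert (Hs : sin (acos u) = Rabs v).
{ rewrite sin_acos by assumption; rewrite <- sqrt_Rsqr_abs; f_equal; unfold Rsqr; nra. }
destruct (Rle_lt_dec 0 v) as [Hv|Hv].
- exists (acos u); split; [lra|].
  unfold cis; rewrite Hs, cos_acos, Rabs_pos_eq by assumption.
  unfold Cmult, RtoC; simpl; f_equal; lra.
- exists (2 * PI - acos u)%R; split; [lra|].
  unfold cis; rewrite cos_minus, sin_minus, cos_2PI, sin_2PI, Hs, cos_acos,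
    Rabs_left by assumption.
  unfold Cmult, RtoC; simpl; f_equal; lra.
Qed.

Lemma Cmod_polar (s theta : R) : (0 <= s)%R -> Cmod (RtoC s * cis theta) = s.
Proof. intros Hs; rewrite Cmod_mult, Cmod_cis, Cmod_R, Rabs_pos_eq by assumption; ring. Qed.

Lemma rcont_cis (x : R) : rcont cis x.
Proof.
apply rcont_pair; apply (ex_derive_continuous (V := R_NormedModule)); auto_derive; exact I.
Qed.

Lemma Cexp_pair (x y : R) : Cexp (x, y) = RtoC (exp x) * cis y.
Proof. reflexivity. Qed.

Lemma Cexp_plus (a b : C) : Cexp (a + b) = Cexp a * Cexp b.
Proof.
unfold Cexp.
assert (Re (a + b) = Re a + Re b)%R as -> by reflexivity.
assert (Im (a + b) = Im a + Im b)%R as -> by reflexivity.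
rewrite exp_plus, cis_plus, RtoC_mult; ring.
Qed.

Lemma Cexp_neq_0 (a : C) : Cexp a <> 0.
Proof.
apply Cmult_neq_0; [|apply cis_neq_0].
intros H; apply RtoC_inj in H; pose proof (exp_pos (Re a)); lra.
Qed.

Lemma derivable_pt_lim_expansion (f : R -> R) (l : R) :
  derivable_pt_lim f 0 l -> forall eps, (0 < eps)%R ->
  exists d, (0 < d)%R /\
    forall h, (Rabs h < d)%R -> (Rabs (f h - f 0 - l * h) <= eps * Rabs h)%R.
Proof.
intros H eps He; destruct (H eps He) as [d Hd]; exists d; split; [apply cond_pos|].
intros h Hh; destruct (Req_dec h 0) as [->|Hn].
- rewrite Rabs_R0, !Rmult_0_r, Rminus_diag; unfold Rminus.
  rewrite Ropp_0, Rplus_0_r, Rabs_R0; lra.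
- specialize (Hd h Hn Hh); rewrite Rplus_0_l in Hd.
  replace (f h - f 0 - l * h)%R with (((f h - f 0) / h - l) * h)%R by (field; assumption).
  rewrite Rabs_mult; apply Rmult_le_compat_r; [apply Rabs_pos|lra].
Qed.

Lemma Cexp_cdiff_0 : cdiff Cexp 0.
Proof.
apply cdiff_expansion with (RtoC 1); intros eps0 He0.
(* The three error terms below carry the constants 1, 3 and 2; the 3, from [Kc'], uses eps <= 1. *)
set (eps := Rmin (eps0 / 6) 1).
assert (He : (0 < eps)%R) by (apply Rmin_pos; lra).
assert (He1 : (eps <= 1)%R) by apply Rmin_r.
assert (He6 : (6 * eps <= eps0)%R) by (pose proof (Rmin_l (eps0 / 6) 1); fold eps in H; lra).
assert (D1 : derivable_pt_lim exp 0 1).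
{ pose proof (derivable_pt_lim_exp 0) as H; now rewrite exp_0 in H. }
assert (D2 : derivable_pt_lim cos 0 0).
{ pose proof (derivable_pt_lim_cos 0) as H; now rewrite sin_0, Ropp_0 in H. }
assert (D3 : derivable_pt_lim sin 0 1).
{ pose proof (derivable_pt_lim_sin 0) as H; now rewrite cos_0 in H. }
destruct (derivable_pt_lim_expansion _ _ D1 eps He) as (d1 & Hd1 & K1).
destruct (derivable_pt_lim_expansion _ _ D2 eps He) as (d2 & Hd2 & K2).
destruct (derivable_pt_lim_expansion _ _ D3 eps He) as (d3 & Hd3 & K3).
rewrite exp_0 in K1; rewrite cos_0 in K2; rewrite sin_0 in K3.
set (d := Rmin (Rmin d1 d2) (Rmin d3 eps)).
assert (Hd : (0 < d)%R) by (apply Rmin_pos; apply Rmin_pos; assumption).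
assert (Hdd : (d <= d1 /\ d <= d2 /\ d <= d3 /\ d <= eps)%R).
{ unfold d; repeat split;
    [eapply Rle_trans; [apply Rmin_l|apply Rmin_l]
    |eapply Rle_trans; [apply Rmin_l|apply Rmin_r]
    |eapply Rle_trans; [apply Rmin_r|apply Rmin_l]
    |eapply Rle_trans; [apply Rmin_r|apply Rmin_r]]. }
generalize (cnear_ball 0 d Hd); apply filter_imp; intros [a b] Ht.
assert (Z0 : forall z : C, z - 0 = z) by (intros z; ring).
rewrite Z0 in Ht |- *.
pose proof (re_le_Cmod (a, b)) as Ra; pose proof (im_le_Cmod (a, b)) as Rb.
unfold Re in Ra; unfold Im in Rb; simpl fst in Ra; simpl snd in Rb.
assert (E0 : Cexp 0 = 1).
{ unfold Cexp; simpl; rewrite exp_0, cis_0; ring. }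
rewrite E0, Cexp_pair.
assert (Kc : (Cmod (cis b - 1 - Ci * RtoC b) <= 2 * eps * Rabs b)%R).
{ eapply Rle_trans; [apply Cmod_le_comp|].
  assert (Re (cis b - 1 - Ci * RtoC b) = cos b - 1 - 0 * b)%R as ->
    by (unfold Re, cis; simpl; ring).
  assert (Im (cis b - 1 - Ci * RtoC b) = sin b - 0 - 1 * b)%R as ->
    by (unfold Im, cis; simpl; ring).
  specialize (K2 b ltac:(lra)); specialize (K3 b ltac:(lra)); lra. }
assert (Kc' : (Cmod (cis b - 1) <= 3 * eps)%R).
{ replace (cis b - 1) with ((cis b - 1 - Ci * RtoC b) + Ci * RtoC b) by ring.
  eapply Rle_trans; [apply Cmod_triangle|].
  rewrite Cmod_mult, Cmod_Ci, Cmod_R; nra. }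
replace (RtoC (exp a) * cis b - 1 - (a, b) * 1) with
  (RtoC (exp a - 1 - 1 * a) * cis b + RtoC a * (cis b - 1) + (cis b - 1 - Ci * RtoC b))
  by (rewrite (pair_C a b), !RtoC_minus, RtoC_mult; ring).
eapply Rle_trans; [apply Cmod_triangle|].
eapply Rle_trans; [apply Rplus_le_compat_r, Cmod_triangle|].
rewrite !Cmod_mult, Cmod_cis, !Cmod_R.
specialize (K1 a ltac:(lra)).
pose proof (Rabs_pos a); pose proof (Rabs_pos b).
pose proof (Cmod_ge_0 (a, b)); nra.
Qed.

Lemma Cexp_cdiff (z : C) : cdiff Cexp z.
Proof.
apply cdiff_ext with (fun t => Cexp z * Cexp (t - z)).
{ intros t; rewrite <- Cexp_plus; f_equal; ring. }
apply cdiff_mult; [apply cdiff_const|].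
apply (cdiff_comp Cexp (fun t => t - z)).
- replace (z - z) with (RtoC 0) by ring; apply Cexp_cdiff_0.
- apply cdiff_minus; [apply cdiff_id|apply cdiff_const].
Qed.

Definition circ_cont (s : R) (f : C -> C) : Prop :=
  forall theta, rcont (fun x => f (RtoC s * cis x)) theta.

(** Normalized so that constants are their own means. As dt = i t dtheta, the contour integral of g
    is 2 pi i times the mean of t g(t). *)
Definition cmean (s : R) (f : C -> C) : C :=
  CRInt (fun x => f (RtoC s * cis x)) 0 (2 * PI) / RtoC (2 * PI).

Lemma two_PI_pos : (0 <= 2 * PI)%R.
Proof. pose proof PI_RGT_0; lra. Qed.

Lemma two_PI_neq : RtoC (2 * PI) <> 0.
Proof. intros H; apply RtoC_inj in H; pose proof PI_RGT_0; lra. Qed.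

Lemma circ_cont_on s f a b : circ_cont s f -> rcont_on (fun x => f (RtoC s * cis x)) a b.
Proof. intros H x _; apply H. Qed.

Lemma rcont_polar s x : rcont (fun y => RtoC s * cis y) x.
Proof. apply climit_mult; [apply climit_const|apply rcont_cis]. Qed.

Lemma ccont_circ s f : (0 <= s)%R -> (forall z, Cmod z = s -> ccont f z) -> circ_cont s f.
Proof.
intros Hs H x; apply (climit_comp (locally x) f (fun y => RtoC s * cis y)).
- apply H; now apply Cmod_polar.
- apply rcont_polar.
Qed.

Lemma cdiff_circ s f : (0 <= s)%R -> (forall z, Cmod z = s -> cdiff f z) -> circ_cont s f.
Proof. intros Hs H; apply ccont_circ; [assumption|]; intros z Hz; now apply cdiff_ccont, H. Qed.

Lemma circ_cont_const s c : circ_cont s (fun _ => c).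
Proof. intros x; apply climit_const. Qed.

Lemma circ_cont_id s : circ_cont s (fun t => t).
Proof. intros x; apply rcont_polar. Qed.

Lemma circ_cont_plus s f g :
  circ_cont s f -> circ_cont s g -> circ_cont s (fun t => f t + g t).
Proof. intros Hf Hg x; now apply climit_plus; [apply Hf|apply Hg]. Qed.

Lemma circ_cont_minus s f g :
  circ_cont s f -> circ_cont s g -> circ_cont s (fun t => f t - g t).
Proof. intros Hf Hg x; now apply climit_minus; [apply Hf|apply Hg]. Qed.

Lemma circ_cont_mult s f g :
  circ_cont s f -> circ_cont s g -> circ_cont s (fun t => f t * g t).
Proof. intros Hf Hg x; now apply climit_mult; [apply Hf|apply Hg]. Qed.

Lemma circ_cont_conj s f : circ_cont s f -> circ_cont s (fun t => Cconj (f t)).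
Proof. intros Hf x; now apply climit_conj; apply Hf. Qed.

Lemma circ_cont_pow s f n : circ_cont s f -> circ_cont s (fun t => f t ^ n).
Proof. intros Hf x; apply climit_pow; apply Hf. Qed.

Lemma circ_cont_inv s (f : C -> C) :
  (0 <= s)%R -> (forall t, Cmod t = s -> f t <> 0) ->
  circ_cont s f -> circ_cont s (fun t => / f t).
Proof. intros Hs H Hf x; apply climit_inv; [apply Hf|apply H; now apply Cmod_polar]. Qed.

Lemma circ_cont_ext s (f g : C -> C) :
  (0 <= s)%R -> (forall t, Cmod t = s -> f t = g t) -> circ_cont s f -> circ_cont s g.
Proof.
intros Hs E H x; unfold rcont; rewrite <- E by now apply Cmod_polar.
apply climit_ext with (2 := H x); intros y; apply E; now apply Cmod_polar.
Qed.

Lemma circ_cont_bounded s (f : C -> C) :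
  circ_cont s f -> exists M, (0 < M)%R /\ forall t, Cmod t = s -> (Cmod (f t) <= M)%R.
Proof.
intros H.
destruct (continuity_ab_maj (fun x => Cmod (f (RtoC s * cis x))) 0 (2 * PI) two_PI_pos)
  as (x0 & Hx0 & _).
{ intros x _; apply continuity_pt_filterlim, filterlim_locally; intros e.
  generalize (H x e (cond_pos e)); apply filter_imp; intros y Hy.
  eapply Rle_lt_trans; [|exact Hy]; apply Rabs_le; split.
  - rewrite Cmod_minus_sym; pose proof (Cmod_triangle_inv (f (RtoC s * cis x)) (f (RtoC s * cis y))).
    unfold minus, plus, opp; simpl; lra.
  - apply Cmod_triangle_inv. }
exists (Cmod (f (RtoC s * cis x0)%C) + 1)%R; split.
- pose proof (Cmod_ge_0 (f (RtoC s * cis x0))); lra.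
- intros t Ht; destruct (polar t) as (x & Hx & E); rewrite Ht in E; rewrite E.
  specialize (Hx0 x Hx); simpl in Hx0; lra.
Qed.

Lemma cmean_plus s f g : circ_cont s f -> circ_cont s g ->
  cmean s (fun t => f t + g t) = cmean s f + cmean s g.
Proof.
intros Hf Hg; unfold cmean; rewrite CRInt_plus;
  try (apply two_PI_pos || now apply circ_cont_on).
field; apply two_PI_neq.
Qed.

Lemma cmean_minus s f g : circ_cont s f -> circ_cont s g ->
  cmean s (fun t => f t - g t) = cmean s f - cmean s g.
Proof.
intros Hf Hg; unfold cmean; rewrite CRInt_minus;
  try (apply two_PI_pos || now apply circ_cont_on).
field; apply two_PI_neq.
Qed.

Lemma cmean_scal s c f : circ_cont s f -> cmean s (fun t => c * f t) = c * cmean s f.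
Proof.
intros Hf; unfold cmean; rewrite CRInt_scal;
  try (apply two_PI_pos || now apply circ_cont_on).
field; apply two_PI_neq.
Qed.

Lemma cmean_const s c : cmean s (fun _ => c) = c.
Proof.
unfold cmean; rewrite CRInt_const, Rminus_0_r; field; apply two_PI_neq.
Qed.

Lemma cmean_conj s f : circ_cont s f -> cmean s (fun t => Cconj (f t)) = Cconj (cmean s f).
Proof.
intros Hf; unfold cmean; rewrite CRInt_conj;
  try (apply two_PI_pos || now apply circ_cont_on).
rewrite Cdiv_conj, Cconj_R by apply two_PI_neq; reflexivity.
Qed.

Lemma cmean_ext s (f g : C -> C) :
  (0 <= s)%R -> (forall t, Cmod t = s -> f t = g t) -> cmean s f = cmean s g.
Proof.
intros Hs H; unfold cmean; f_equal; apply CRInt_ext; [apply two_PI_pos|].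
intros x _; apply H; now apply Cmod_polar.
Qed.

Lemma cmean_bound s (f : C -> C) M :
  (0 <= s)%R -> circ_cont s f -> (forall t, Cmod t = s -> (Cmod (f t) <= M)%R) ->
  (Cmod (cmean s f) <= M)%R.
Proof.
intros Hs Hf HM; unfold cmean; rewrite Cmod_div, Cmod_R by apply two_PI_neq.
rewrite Rabs_pos_eq by apply two_PI_pos.
apply Rle_div_l; [pose proof PI_RGT_0; lra|].
replace (M * (2 * PI))%R with ((2 * PI - 0) * M)%R by ring.
apply CRInt_bound; [apply two_PI_pos|now apply circ_cont_on|].
intros x _; apply HM; now apply Cmod_polar.
Qed.

Lemma exp_le_mono (x y : R) : (x <= y)%R -> (exp x <= exp y)%R.
Proof. intros [H| ->]; [now apply Rlt_le, exp_increasing|apply Rle_refl]. Qed.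

(* In logarithmic coordinates a circle is a vertical segment of length [2 * PI],
   and periodicity cancels the horizontal sides in Goursat's theorem. *)
Lemma cmean_annulus f a b :
  (0 < a <= b)%R -> (forall z, (a <= Cmod z <= b)%R -> cdiff f z) -> cmean a f = cmean b f.
Proof.
intros [Ha Hab] Hf.
assert (Hl : (ln a <= ln b)%R) by (apply ln_le; lra).
pose proof (goursat (fun z => f (Cexp z)) (ln a) (ln b) 0 (2 * PI) Hl two_PI_pos) as G.
unfold rect_int in G; unfold cmean; f_equal.
assert (E : forall s, (0 < s)%R -> CRInt (fun y => f (Cexp (ln s, y))) 0 (2 * PI) =
  CRInt (fun x => f (RtoC s * cis x)) 0 (2 * PI)).
{ intros s Hs; apply CRInt_ext; [apply two_PI_pos|]; intros y _.
  rewrite Cexp_pair, exp_ln by assumption; reflexivity. }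
rewrite !E in G by lra.
rewrite (CRInt_ext (fun x => f (Cexp (x, 2 * PI)%R)) (fun x => f (Cexp (x, 0%R)))) in G
  by (assumption || intros x _; now rewrite !Cexp_pair, cis_2PI, cis_0).
symmetry; apply Ceq_minus.
assert (G' : Ci * (CRInt (fun x => f (RtoC b * cis x)) 0 (2 * PI) -
  CRInt (fun x => f (RtoC a * cis x)) 0 (2 * PI)) = 0).
{ rewrite <- G; [ring|].
  intros x y Hx _; apply (cdiff_comp f Cexp); [|apply Cexp_cdiff].
  apply Hf; rewrite Cexp_pair, Cmod_polar by (apply Rlt_le, exp_pos).
  split; [rewrite <- (exp_ln a)|rewrite <- (exp_ln b)]; try lra; apply exp_le_mono; lra. }
destruct (Ceq_dec (CRInt (fun x => f (RtoC b * cis x)) 0 (2 * PI) -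
  CRInt (fun x => f (RtoC a * cis x)) 0 (2 * PI)) 0) as [Z|NZ]; [exact Z|].
exfalso; revert G'; apply Cmult_neq_0; [apply Ci_nz|exact NZ].
Qed.

Lemma Cmod_small_eq (a b : C) :
  (forall eps, (0 < eps)%R -> (Cmod (a - b) <= eps)%R) -> a = b.
Proof.
intros H; apply Ceq_minus, Cmod_eq_0.
pose proof (Cmod_ge_0 (a - b)); destruct (Rle_lt_or_eq_dec _ _ H0); [|auto].
specialize (H (Cmod (a - b) / 2)%R ltac:(lra)); lra.
Qed.

(** The mean does not change when the circle shrinks, and on small circles it is close to f(0) by
    continuity. *)
Lemma cmean_disk f b :
  (0 < b)%R -> (forall z, (Cmod z <= b)%R -> cdiff f z) -> cmean b f = f 0.
Proof.
intros Hb Hf; apply Cmod_small_eq; intros e He.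
destruct (cnear_elim _ _ (cdiff_ccont f 0 (Hf 0 ltac:(rewrite Cmod_0; lra)) e He))
  as (d & Hd & K).
set (a := Rmin b (d / 2)).
assert (Ha : (0 < a)%R) by (apply Rmin_pos; lra).
assert (Hab : (a <= b)%R) by apply Rmin_l.
assert (Had : (a < d)%R) by (pose proof (Rmin_r b (d / 2)); fold a in H; lra).
rewrite <- (cmean_annulus f a b) by (lra || intros z Hz; apply Hf; lra).
assert (Hc : circ_cont a f) by (apply cdiff_circ; [lra|intros z Hz; apply Hf; lra]).
rewrite <- (cmean_const a (f 0)), <- cmean_minus by (assumption || apply circ_cont_const).
apply cmean_bound; [lra|apply circ_cont_minus; [assumption|apply circ_cont_const]|].
intros t Ht; apply Rlt_le, K.
replace (t - 0) with t by ring; lra.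
Qed.

(** * Cauchy's formula *)

Lemma continuity_2d_polar (f : C -> C) (x y : R) :
  (0 <= x)%R -> ccont f (RtoC x * cis y) ->
  continuity_2d_pt (fun u v => Re (f (RtoC u * cis v))) x y /\
  continuity_2d_pt (fun u v => Im (f (RtoC u * cis v))) x y.
Proof.
intros Hx Hf.
assert (K : forall eps : posreal, locally_2d (fun u v =>
  (Cmod (f (RtoC u * cis v)%C - f (RtoC x * cis y)%C) < eps)%R) x y).
{ intros eps; destruct (cnear_elim _ _ (Hf eps (cond_pos eps))) as (d & Hd & K).
  assert (He : (0 < d / (2 * (x + 1)))%R) by (apply Rdiv_lt_0_compat; lra).
  destruct (rcont_cis y _ He) as [e K'].
  assert (Hm : (0 < Rmin e (d / 2))%R) by (apply Rmin_pos; [apply cond_pos|lra]).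
  exists (mkposreal _ Hm); intros u v Hu Hv; simpl in Hu, Hv.
  pose proof (Rmin_l e (d / 2)); pose proof (Rmin_r e (d / 2)).
  apply K.
  replace (RtoC u * cis v - RtoC x * cis y) with
    (RtoC (u - x) * cis v + RtoC x * (cis v - cis y)) by (rewrite RtoC_minus; ring).
  eapply Rle_lt_trans; [apply Cmod_triangle|].
  rewrite !Cmod_mult, Cmod_cis, !Cmod_R, (Rabs_pos_eq x) by assumption.
  assert (Hc : (Cmod (cis v - cis y) < d / (2 * (x + 1)))%R).
  { apply K'. change (Rabs (v - y) < e)%R; lra. }
  assert (E : (d / (2 * (x + 1)) * (x + 1) = d / 2)%R) by (field; lra).
  pose proof (Cmod_ge_0 (cis v - cis y)); nra. }
split; intros eps; destruct (K eps) as [d Hd]; exists d; intros u v Hu Hv;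
  (eapply Rle_lt_trans; [|exact (Hd u v Hu Hv)]);
  [exact (re_le_Cmod (f (RtoC u * cis v) - f (RtoC x * cis y)))
  |exact (im_le_Cmod (f (RtoC u * cis v) - f (RtoC x * cis y)))].
Qed.

(** Polar coordinates make the annulus a compact rectangle, where uniform continuity in two
    variables applies to the real and imaginary parts. *)
Lemma polar_uniform (f : C -> C) (a b : R) :
  (0 < a <= b)%R -> (forall z, (a <= Cmod z <= b)%R -> ccont f z) ->
  forall eps, (0 < eps)%R -> exists d, (0 < d)%R /\
  forall s s' x, (a <= s <= b)%R -> (a <= s' <= b)%R -> (Rabs (s - s') < d)%R ->
    (0 <= x <= 2 * PI)%R ->
    (Cmod (f (RtoC s * cis x)%C - f (RtoC s' * cis x)%C) < eps)%R.
Proof.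
intros Hab Hf eps He.
assert (He2 : (0 < eps / 2)%R) by lra.
assert (P : forall x y, (a <= x <= b)%R -> ccont f (RtoC x * cis y)).
{ intros x y Hx; apply Hf; rewrite Cmod_polar; lra. }
destruct (uniform_continuity_2d (fun u v => Re (f (RtoC u * cis v))) a b 0 (2 * PI))
  with (eps := mkposreal _ He2) as [d1 K1].
{ intros x y Hx _; apply continuity_2d_polar; [lra|now apply P]. }
destruct (uniform_continuity_2d (fun u v => Im (f (RtoC u * cis v))) a b 0 (2 * PI))
  with (eps := mkposreal _ He2) as [d2 K2].
{ intros x y Hx _; apply continuity_2d_polar; [lra|now apply P]. }
exists (Rmin d1 d2); split; [apply Rmin_pos; apply cond_pos|].
intros s s' x Hs Hs' Hd Hx.
pose proof (Rmin_l d1 d2); pose proof (Rmin_r d1 d2).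
eapply Rle_lt_trans; [apply Cmod_le_comp|].
assert (A1 := K1 s' x s x Hs' Hx Hs Hx ltac:(lra) ltac:(rewrite Rminus_diag, Rabs_R0; apply cond_pos)).
assert (A2 := K2 s' x s x Hs' Hx Hs Hx ltac:(lra) ltac:(rewrite Rminus_diag, Rabs_R0; apply cond_pos)).
simpl in A1, A2.
change (Re (f (RtoC s * cis x) - f (RtoC s' * cis x)))
  with (Re (f (RtoC s * cis x)%C) - Re (f (RtoC s' * cis x)%C))%R.
change (Im (f (RtoC s * cis x) - f (RtoC s' * cis x)))
  with (Im (f (RtoC s * cis x)%C) - Im (f (RtoC s' * cis x)%C))%R.
lra.
Qed.

Lemma cmean_continuous (f : C -> C) (a b : R) :
  (0 < a <= b)%R -> (forall z, (a <= Cmod z <= b)%R -> ccont f z) ->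
  forall eps, (0 < eps)%R -> exists d, (0 < d)%R /\
  forall s s', (a <= s <= b)%R -> (a <= s' <= b)%R -> (Rabs (s - s') < d)%R ->
    (Cmod (cmean s f - cmean s' f) <= eps)%R.
Proof.
intros Hab Hf eps He.
destruct (polar_uniform f a b Hab Hf eps He) as (d & Hd0 & K).
exists d; split; [assumption|]; intros s s' Hs Hs' Hd.
assert (Cs : circ_cont s f) by (apply ccont_circ; [lra|intros z Hz; apply Hf; lra]).
assert (Cs' : circ_cont s' f) by (apply ccont_circ; [lra|intros z Hz; apply Hf; lra]).
unfold cmean.
replace (CRInt (fun x => f (RtoC s * cis x)) 0 (2 * PI) / RtoC (2 * PI) -
  CRInt (fun x => f (RtoC s' * cis x)) 0 (2 * PI) / RtoC (2 * PI)) with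
  (CRInt (fun x => f (RtoC s * cis x) - f (RtoC s' * cis x)) 0 (2 * PI) / RtoC (2 * PI)).
2: { rewrite CRInt_minus by (apply two_PI_pos || now apply circ_cont_on).
  field; apply two_PI_neq. }
rewrite Cmod_div, Cmod_R, Rabs_pos_eq by (apply two_PI_neq || apply two_PI_pos).
apply Rle_div_l; [pose proof PI_RGT_0; lra|].
replace (eps * (2 * PI))%R with ((2 * PI - 0) * eps)%R by ring.
apply CRInt_bound; [apply two_PI_pos| |].
- intros x _; apply climit_minus; [apply Cs|apply Cs'].
- intros x Hx; left; now apply K.
Qed.

(** The function 1/f is bounded by some M on the unit circle, so |f| >= 1/M there, and along a ray f
    changes by less than 1/M over a distance d that is uniform in the angle. *)
Lemma nonzero_near_circle (f : C -> C) (a b : R) :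
  (0 < a < 1)%R -> (1 < b)%R -> (forall z, (a <= Cmod z <= b)%R -> ccont f z) ->
  (forall z, Cmod z = 1%R -> f z <> 0) ->
  exists d, (0 < d)%R /\ forall z, (a <= Cmod z <= b)%R -> (Rabs (Cmod z - 1) < d)%R -> f z <> 0.
Proof.
intros Ha Hb Hf H0.
assert (Ci' : circ_cont 1 (fun t => / f t)).
{ apply circ_cont_inv; [lra|assumption|].
  apply ccont_circ; [lra|intros z Hz; apply Hf; lra]. }
destruct (circ_cont_bounded 1 _ Ci') as (M & HM0 & HM).
destruct (polar_uniform f a b ltac:(lra) Hf (/ M) ltac:(now apply Rinv_0_lt_compat))
  as (d & Hd & K).
exists d; split; [assumption|]; intros z Hz Hzd E.
destruct (polar z) as (x & Hx & Ex).
specialize (K (Cmod z) 1%R x Hz ltac:(lra) Hzd Hx).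
rewrite <- Ex, E in K.
assert (H1 : Cmod (RtoC 1 * cis x) = 1%R) by (apply Cmod_polar; lra).
specialize (HM _ H1); specialize (H0 _ H1).
rewrite Cmod_inv in HM by assumption; apply Cmod_gt_0 in H0.
rewrite Cmod_minus_sym in K.
replace (f (RtoC 1 * cis x) - 0) with (f (RtoC 1 * cis x)) in K by ring.
apply Rinv_le_contravar in HM; [|now apply Rinv_0_lt_compat].
rewrite Rinv_inv in HM; lra.
Qed.

(** A removable-singularity form of [cmean_annulus]: the mean is constant on each side of the unit
    circle and continuous across it. It serves for a difference quotient at a point of the
    circle. *)
Lemma cmean_across (f : C -> C) (a b : R) :
  (0 < a < 1)%R -> (1 < b)%R -> (forall z, (a <= Cmod z <= b)%R -> ccont f z) ->
  (forall z, (a <= Cmod z <= b)%R -> Cmod z <> 1%R -> cdiff f z) ->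
  cmean a f = cmean b f.
Proof.
intros Ha Hb Hc Hd; apply Cmod_small_eq; intros e He.
destruct (cmean_continuous f a b ltac:(lra) Hc e He) as (d & Hd0 & K).
set (s := Rmax a (1 - d / 4)); set (s' := Rmin b (1 + d / 4)).
assert (Hs : (a <= s < 1)%R /\ (1 - d / 4 <= s)%R).
{ unfold s; repeat split; [apply Rmax_l|apply Rmax_lub_lt; lra|apply Rmax_r]. }
assert (Hs' : (1 < s' <= b)%R /\ (s' <= 1 + d / 4)%R).
{ unfold s'; repeat split; [apply Rmin_glb_lt; lra|apply Rmin_l|apply Rmin_r]. }
rewrite (cmean_annulus f a s), <- (cmean_annulus f s' b); try lra;
  try (intros z Hz; apply Hd; lra).
apply K; try lra; apply Rabs_lt_between; lra.
Qed.

(* The Cauchy integral [1/(2 pi i) * oint_{|t| = s} g(t)/(t - z) dt]. *)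
Definition cauchy_int (s : R) (g : C -> C) (z : C) : C :=
  cmean s (fun t => g t * (t / (t - z))).

Lemma circ_neq s z t : Cmod z <> s -> Cmod t = s -> t - z <> 0.
Proof. intros Hz Ht E; apply Hz; rewrite <- Ht; f_equal; symmetry; now apply Ceq_minus. Qed.

Lemma circ_cont_kernel s z :
  (0 <= s)%R -> Cmod z <> s -> circ_cont s (fun t => t / (t - z)).
Proof.
intros Hs Hz; apply circ_cont_mult; [apply circ_cont_id|].
apply circ_cont_inv; [assumption| |].
- intros t Ht; now apply circ_neq with s.
- apply circ_cont_minus; [apply circ_cont_id|apply circ_cont_const].
Qed.

Lemma cdiff_kernel z t : t <> z -> cdiff (fun t => t / (t - z)) t.
Proof.
intros H; apply cdiff_mult; [apply cdiff_id|].
apply cdiff_inv; [|now apply Cminus_eq_contra].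
apply cdiff_minus; [apply cdiff_id|apply cdiff_const].
Qed.

Lemma cauchy_int_one_out s z : (0 < s)%R -> (s < Cmod z)%R -> cauchy_int s (fun _ => 1) z = 0.
Proof.
intros Hs Hz; unfold cauchy_int.
rewrite (cmean_ext s _ (fun t => t / (t - z))) by (lra || intros; ring).
rewrite cmean_disk; [unfold Cdiv; ring|assumption|].
intros t Ht; apply cdiff_kernel; intros ->; lra.
Qed.

(** The kernel has its pole inside the circle, so the mean value property does not apply to it. But
    on |t| = s it is the conjugate of s^2 / (s^2 - Cconj z * t), which is holomorphic on the closed
    disc and equals 1 at 0. *)
Lemma cauchy_int_one_in s z : (Cmod z < s)%R -> cauchy_int s (fun _ => 1) z = 1.
Proof.
intros Hz; pose proof (Cmod_ge_0 z) as Hz0; unfold cauchy_int.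
assert (Hs2 : RtoC (s * s) <> 0) by (intros E; apply RtoC_inj in E; nra).
set (f := fun t => RtoC (s * s) / (RtoC (s * s) - Cconj z * t)).
assert (Hn : forall t, (Cmod t <= s)%R -> RtoC (s * s) - Cconj z * t <> 0).
{ intros t Ht; apply Cmod_gt_0.
  pose proof (Cmod_triangle_inv (RtoC (s * s)) (Cconj z * t)) as H.
  rewrite Cmod_R, Rabs_pos_eq, Cmod_mult, Cmod_conj in H by nra.
  pose proof (Cmod_ge_0 t); nra. }
assert (Hf : forall t, (Cmod t <= s)%R -> cdiff f t).
{ intros t Ht; apply cdiff_mult; [apply cdiff_const|apply cdiff_inv; [|now apply Hn]].
  apply cdiff_minus; [apply cdiff_const|apply cdiff_mult; [apply cdiff_const|apply cdiff_id]]. }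
rewrite (cmean_ext s _ (fun t => Cconj (f t))).
- rewrite cmean_conj, cmean_disk; [|lra|exact Hf|].
  + unfold f; rewrite Cmult_0_r; replace (RtoC (s * s) / (RtoC (s * s) - 0)) with (RtoC 1)
      by (field; assumption).
    apply Cconj_R.
  + apply cdiff_circ; [lra|intros t Ht; apply Hf; lra].
- lra.
- intros t Ht.
  assert (Hst : RtoC (s * s) = t * Cconj t).
  { rewrite <- Cmod2_conj, Ht; now replace (s * s)%R with (s ^ 2)%R by ring. }
  assert (Ht0 : t <> 0) by (apply Cmod_gt_0; lra).
  assert (Htz : t - z <> 0) by (apply circ_neq with s; lra).
  assert (Hct : Cconj t <> 0) by (apply Cmod_gt_0; rewrite Cmod_conj; lra).
  assert (E : Cconj (f t) = (t * Cconj t) / (t * Cconj t - z * Cconj t)).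
  { unfold f; rewrite Cdiv_conj by (apply Hn; lra).
    rewrite Cminus_conj, Cmult_conj, Cconj_conj, Cconj_R, Hst; reflexivity. }
  rewrite E; field; split; [|assumption].
  replace (t * Cconj t - z * Cconj t) with ((t - z) * Cconj t) by ring.
  now apply Cmult_neq_0.
Qed.

(** The difference quotient of g at z, completed by the derivative, is continuous at z, so its
    weighted means over the two circles agree. The term g(z) times the kernel contributes 1 on the
    outer circle and 0 on the inner one. *)
Theorem cauchy_formula (g : C -> C) (a b : R) :
  (0 < a < 1)%R -> (1 < b)%R -> (forall z, (a <= Cmod z <= b)%R -> cdiff g z) ->
  forall z, Cmod z = 1%R -> g z = cauchy_int b g z - cauchy_int a g z.
Proof.
intros Ha Hb Hg z Hz.
destruct (Hg z ltac:(lra)) as (p & Hp & H).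
set (phi := fun t => if Ceq_dec t z then p z else (g t - g z) / (t - z)).
assert (Hd : forall t, (a <= Cmod t <= b)%R -> t <> z -> cdiff phi t).
{ intros t Ht Htz.
  apply cdiff_ext_loc with (fun t => (g t - g z) / (t - z)).
  - assert (Hpos : (0 < Cmod (t - z))%R) by (apply Cmod_gt_0; now apply Cminus_eq_contra).
    generalize (cnear_ball t _ Hpos); apply filter_imp; intros u Hu; unfold phi.
    destruct (Ceq_dec u z) as [->|]; [|reflexivity].
    rewrite Cmod_minus_sym in Hu; lra.
  - apply cdiff_mult; [apply cdiff_minus; [now apply Hg|apply cdiff_const]|].
    apply cdiff_inv; [apply cdiff_minus; [apply cdiff_id|apply cdiff_const]|].
    now apply Cminus_eq_contra. }
assert (Hc : forall t, (a <= Cmod t <= b)%R -> ccont phi t).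
{ intros t Ht; destruct (Ceq_dec t z) as [->|Htz]; [|now apply cdiff_ccont, Hd].
  unfold ccont; assert (phi z = p z) as ->.
  { unfold phi; destruct (Ceq_dec z z); congruence. }
  apply climit_ext_loc with (2 := Hp).
  revert H; apply filter_imp; intros u Hu; unfold phi.
  destruct (Ceq_dec u z) as [->|Huz]; [reflexivity|].
  rewrite Hu; field; now apply Cminus_eq_contra. }
assert (E : cmean a (fun t => t * phi t) = cmean b (fun t => t * phi t)).
{ apply cmean_across; [assumption|assumption| |].
  - intros t Ht; apply climit_mult; [apply ccont_id|now apply Hc].
  - intros t Ht Ht1; apply cdiff_mult; [apply cdiff_id|apply Hd; [assumption|]].
    intros ->; lra. }
assert (S : forall s, (a <= s <= b)%R -> s <> 1%R ->
  cmean s (fun t => t * phi t) = cauchy_int s g z - g z * cauchy_int s (fun _ => 1) z).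
{ intros s Hs Hs1; unfold cauchy_int.
  assert (Ck : circ_cont s (fun t => t / (t - z))) by (apply circ_cont_kernel; lra).
  assert (Cg : circ_cont s g) by (apply cdiff_circ; [lra|intros t Ht; apply Hg; lra]).
  rewrite <- cmean_scal, <- cmean_minus.
  - apply cmean_ext; [lra|]; intros t Ht; unfold phi.
    destruct (Ceq_dec t z) as [->|Htz]; [lra|].
    field; now apply Cminus_eq_contra.
  - now apply circ_cont_mult.
  - apply circ_cont_mult; [apply circ_cont_const|].
    apply circ_cont_mult; [apply circ_cont_const|assumption].
  - apply circ_cont_mult; [apply circ_cont_const|assumption]. }
rewrite !S in E by lra.
rewrite cauchy_int_one_out, cauchy_int_one_in in E by lra.
apply Ceq_minus; apply Ceq_minus in E; rewrite <- E; ring.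
Qed.

Lemma circ_dist s z t :
  Cmod t = s -> (Rabs (s - Cmod z) <= Cmod (t - z))%R.
Proof.
intros <-; apply Rabs_le; split; [|apply Cmod_triangle_inv].
rewrite Cmod_minus_sym; pose proof (Cmod_triangle_inv z t); lra.
Qed.

Lemma cauchy_int_bound s g z M :
  (0 < s)%R -> Cmod z <> s -> circ_cont s g ->
  (forall t, Cmod t = s -> (Cmod (g t) <= M)%R) ->
  (Cmod (cauchy_int s g z) <= M * (s / Rabs (s - Cmod z)))%R.
Proof.
intros Hs Hz Hg HM; unfold cauchy_int.
assert (Hd : (0 < Rabs (s - Cmod z))%R) by (apply Rabs_pos_lt; lra).
apply cmean_bound; [lra|apply circ_cont_mult; [assumption|apply circ_cont_kernel; lra]|].
intros t Ht; rewrite Cmod_mult, Cmod_div, Ht by now apply circ_neq with s.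
apply Rmult_le_compat; [apply Cmod_ge_0| |now apply HM|].
- apply Rdiv_le_0_compat; [lra|]; pose proof (circ_dist s z t Ht); lra.
- apply Rmult_le_compat_l; [lra|]; apply Rinv_le_contravar; [assumption|].
  now apply circ_dist.
Qed.

Lemma cauchy_int_cdiff s g z :
  (0 < s)%R -> Cmod z <> s -> circ_cont s g -> cdiff (cauchy_int s g) z.
Proof.
intros Hs Hz Hg.
destruct (circ_cont_bounded s g Hg) as (M & HM0 & HM).
set (d := Rabs (s - Cmod z)).
assert (Hd : (0 < d)%R) by (apply Rabs_pos_lt; lra).
set (K := (M * s * (2 / (d * d * d)))%R).
assert (HK : (0 < K)%R).
{ unfold K; apply Rmult_lt_0_compat; [nra|]. apply Rdiv_lt_0_compat; [lra|].
  repeat apply Rmult_lt_0_compat; assumption. }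
assert (Cinv' : forall y, Cmod y <> s -> circ_cont s (fun t => / (t - y))).
{ intros y Hy; apply circ_cont_inv; [lra|intros t Ht; now apply circ_neq with s|].
  apply circ_cont_minus; [apply circ_cont_id|apply circ_cont_const]. }
assert (Cgt : circ_cont s (fun t => g t * t))
  by (apply circ_cont_mult; [assumption|apply circ_cont_id]).
apply cdiff_expansion with (cmean s (fun t => g t * t * / (t - z) * / (t - z))).
intros e He.
assert (Hr : (0 < Rmin (d / 2) (e / K))%R)
  by (apply Rmin_pos; [lra|now apply Rdiv_lt_0_compat]).
generalize (cnear_ball z _ Hr); apply filter_imp; intros y Hy.
assert (Hy1 : (Cmod (y - z) < d / 2)%R) by (eapply Rlt_le_trans; [exact Hy|apply Rmin_l]).
assert (Hy2 : (Cmod (y - z) < e / K)%R) by (eapply Rlt_le_trans; [exact Hy|apply Rmin_r]).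
assert (Hty : forall t, Cmod t = s -> (d / 2 <= Cmod (t - y))%R).
{ intros t Ht; pose proof (circ_dist s z t Ht); fold d in H.
  pose proof (Cmod_minus_triangle t y z); lra. }
assert (Hys : Cmod y <> s).
{ intros E; pose proof (Hty y E) as H; replace (y - y) with (RtoC 0) in H by ring.
  rewrite Cmod_0 in H; lra. }
(* The remainder is exactly quadratic: 1/(t - y) - 1/(t - z) - (y - z)/(t - z)^2 = (y - z)^2 / ((t -
   z)^2 (t - y)). [K] bounds the remaining mean because |t - z| >= d and |t - y| >= d / 2. *)
assert (E : cauchy_int s g y - cauchy_int s g z -
  (y - z) * cmean s (fun t => g t * t * / (t - z) * / (t - z)) =
  (y - z) * (y - z) * cmean s (fun t => g t * t * / (t - z) * / (t - z) * / (t - y))).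
{ unfold cauchy_int.
  rewrite <- cmean_minus, <- !cmean_scal, <- cmean_minus;
    repeat (assumption || apply Cinv' || apply circ_cont_mult || apply circ_cont_const ||
      apply circ_cont_minus || apply circ_cont_id).
  apply cmean_ext; [lra|]; intros t Ht; field; split; now apply circ_neq with s. }
rewrite E, !Cmod_mult.
assert (B : (Cmod (cmean s (fun t => g t * t * / (t - z) * / (t - z) * / (t - y))%C) <= K)%R).
{ apply cmean_bound; [lra| |].
  - repeat (assumption || apply Cinv' || apply circ_cont_mult).
  - intros t Ht; pose proof (circ_dist s z t Ht) as D1; fold d in D1.
    pose proof (Hty t Ht) as D2.
    rewrite !Cmod_mult, !Cmod_inv, Ht by now apply circ_neq with s.
    unfold K; replace (2 / (d * d * d))%R with (/ d * / d * / (d / 2))%R by (field; lra).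
    rewrite <- !Rmult_assoc.
    repeat apply Rmult_le_compat;
      repeat (apply Rmult_le_pos); try apply Cmod_ge_0; try lra;
      try (left; apply Rinv_0_lt_compat; lra); try (now apply HM);
      apply Rinv_le_contravar; lra. }
pose proof (Cmod_ge_0 (y - z)) as P0.
assert (e / K * K = e)%R by (field; lra).
assert (HyK : (Cmod (y - z) * K <= e)%R)
  by (rewrite <- H; apply Rmult_le_compat_r; lra).
apply Rle_trans with (Cmod (y - z) * (Cmod (y - z) * K))%R;
  [|rewrite (Rmult_comm e); now apply Rmult_le_compat_l].
rewrite Rmult_assoc; apply Rmult_le_compat_l; [assumption|].
now apply Rmult_le_compat_l.
Qed.

(** * Boundary values of analytic functions *)

(* Boundary values of the disc algebra, as the closure of the polynomials under
   uniform convergence on the unit circle. *)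
Inductive disk_alg : (C -> C) -> Prop :=
| disk_const c : disk_alg (fun _ => c)
| disk_id_mult f : disk_alg f -> disk_alg (fun t => t * f t)
| disk_plus f g : disk_alg f -> disk_alg g -> disk_alg (fun t => f t + g t)
| disk_lim (g : nat -> C -> C) f :
    (forall n, disk_alg (g n)) ->
    (forall eps, (0 < eps)%R -> exists n, forall t, Cmod t = 1%R ->
       (Cmod (g n t - f t) <= eps)%R) ->
    disk_alg f.

(** On the unit circle these are the functions with strictly negative frequencies only; the factor t
    excludes the constant term. *)
Definition disk_neg (v : C -> C) : Prop :=
  exists a, disk_alg a /\ forall t, Cmod t = 1%R -> v t = Cconj (t * a t).

(** The limit constructor looks at the unit circle only, so a constant sequence transfers membership
    between functions that agree there. *)
Lemma disk_ext (f g : C -> C) :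
  (forall t, Cmod t = 1%R -> f t = g t) -> disk_alg f -> disk_alg g.
Proof.
intros E H; apply disk_lim with (fun _ => f); [easy|].
intros e He; exists 0%nat; intros t Ht; rewrite E by assumption.
replace (g t - g t) with (RtoC 0) by ring; rewrite Cmod_0; lra.
Qed.

Lemma disk_circ_cont f : disk_alg f -> circ_cont 1 f.
Proof.
induction 1 as [c|f _ IH|f g _ IHf _ IHg|g f _ IH L].
- apply circ_cont_const.
- apply circ_cont_mult; [apply circ_cont_id|assumption].
- now apply circ_cont_plus.
- intros x e He; assert (He3 : (0 < e / 4)%R) by lra.
  destruct (L _ He3) as [n Hn].
  generalize (IH n x _ He3); apply filter_imp; intros y Hy.
  pose proof (Hn _ (Cmod_polar 1 x Rle_0_1)) as A1.
  pose proof (Hn _ (Cmod_polar 1 y Rle_0_1)) as A2.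
  rewrite Cmod_minus_sym in A2.
  pose proof (Cmod_minus_triangle (f (RtoC 1 * cis y)) (g n (RtoC 1 * cis y)) (f (RtoC 1 * cis x))).
  pose proof (Cmod_minus_triangle (g n (RtoC 1 * cis y)) (g n (RtoC 1 * cis x)) (f (RtoC 1 * cis x))).
  lra.
Qed.

Lemma disk_scal c f : disk_alg f -> disk_alg (fun t => c * f t).
Proof.
induction 1 as [d|f _ IH|f g _ IHf _ IHg|g f _ IH L].
- apply (disk_const (c * d)).
- apply disk_ext with (2 := disk_id_mult _ IH); intros t _; ring.
- apply disk_ext with (2 := disk_plus _ _ IHf IHg); intros t _; ring.
- apply disk_lim with (1 := IH); intros e He.
  pose proof (Cmod_ge_0 c).
  destruct (L (e / (Cmod c + 1))%R) as [n Hn]; [apply Rdiv_lt_0_compat; lra|].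
  exists n; intros t Ht; specialize (Hn t Ht).
  replace (c * g n t - c * f t) with (c * (g n t - f t)) by ring; rewrite Cmod_mult.
  apply Rle_trans with (Cmod c * (e / (Cmod c + 1)))%R; [now apply Rmult_le_compat_l|].
  assert (e / (Cmod c + 1) * (Cmod c + 1) = e)%R by (field; lra).
  assert (0 < e / (Cmod c + 1))%R by (apply Rdiv_lt_0_compat; lra). nra.
Qed.

Lemma disk_mult f g : disk_alg f -> disk_alg g -> disk_alg (fun t => f t * g t).
Proof.
intros Hf Hg.
induction Hf as [c|f _ IH|f f' _ IHf _ IHf'|f' f _ IH L].
- now apply disk_scal.
- apply disk_ext with (2 := disk_id_mult _ IH); intros t _; ring.
- apply disk_ext with (2 := disk_plus _ _ IHf IHf'); intros t _; ring.
- apply disk_lim with (1 := IH); intros e He.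
  destruct (circ_cont_bounded 1 g (disk_circ_cont g Hg)) as (M & HM0 & HM).
  destruct (L (e / M)%R) as [n Hn]; [now apply Rdiv_lt_0_compat|].
  exists n; intros t Ht; specialize (Hn t Ht); specialize (HM t Ht).
  replace (f' n t * g t - f t * g t) with ((f' n t - f t) * g t) by ring; rewrite Cmod_mult.
  replace e with (e / M * M)%R by (field; lra).
  apply Rmult_le_compat; try apply Cmod_ge_0; assumption.
Qed.

Lemma disk_minus f g : disk_alg f -> disk_alg g -> disk_alg (fun t => f t - g t).
Proof.
intros Hf Hg.
apply disk_ext with (2 := disk_plus _ _ Hf (disk_scal (- (1)) _ Hg)); intros t _; ring.
Qed.

Lemma disk_pow n : disk_alg (fun t => t ^ n).
Proof. induction n as [|n IH]; simpl; [apply disk_const|now apply disk_id_mult]. Qed.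

(** Treating all exponents at once makes the induction close: multiplication by t merely raises k,
    and for a constant the mean value property applies. *)
Lemma disk_mean_pow f k : disk_alg f -> cmean 1 (fun t => t ^ S k * f t) = 0.
Proof.
intros H; revert k; induction H as [c|f _ IH|f g Hf IHf Hg IHg|g f Hg IH L]; intros k.
- rewrite cmean_disk; [simpl; ring|lra|].
  intros z _; apply cdiff_mult; [apply cdiff_pow, cdiff_id|apply cdiff_const].
- rewrite <- (IH (S k)); apply cmean_ext; [lra|]; intros t _; simpl; ring.
- transitivity (cmean 1 (fun t => t ^ S k * f t) + cmean 1 (fun t => t ^ S k * g t)).
  + rewrite <- cmean_plus; [apply cmean_ext; [lra|]; intros t _; ring| |];
      (apply circ_cont_mult; [apply circ_cont_pow, circ_cont_id|now apply disk_circ_cont]).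
  + rewrite IHf, IHg; ring.
- assert (Hf : disk_alg f) by now apply disk_lim with g.
  apply Cmod_small_eq; intros e He; destruct (L e He) as [n Hn].
  rewrite Cmod_minus_sym, <- (IH n k), <- cmean_minus;
    try (apply circ_cont_mult; [apply circ_cont_pow, circ_cont_id|now apply disk_circ_cont]).
  apply cmean_bound; [lra| |].
  + apply circ_cont_minus;
      (apply circ_cont_mult; [apply circ_cont_pow, circ_cont_id|now apply disk_circ_cont]).
  + intros t Ht.
    replace (t ^ S k * g n t - t ^ S k * f t) with (t ^ S k * (g n t - f t)) by ring.
    rewrite Cmod_mult, Cmod_pow, Ht, pow1, Rmult_1_l; now apply Hn.
Qed.

Lemma disk_mean_id f : disk_alg f -> cmean 1 (fun t => t * f t) = 0.
Proof.
intros H; rewrite <- (disk_mean_pow f 0 H); apply cmean_ext; [lra|]; intros; simpl; ring.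
Qed.

(** The backward shift. On t f(t) the mean vanishes and the shift returns f; the other cases follow
    from linearity and from the continuity of the mean under uniform limits. *)
Lemma disk_shift f : disk_alg f -> disk_alg (fun t => (f t - cmean 1 f) / t).
Proof.
induction 1 as [c|f H IH|f g Hf IHf Hg IHg|g f Hg IH L].
- rewrite cmean_const.
  apply disk_ext with (2 := disk_const 0); intros t _; unfold Cdiv; ring.
- rewrite disk_mean_id by assumption.
  apply disk_ext with (2 := H); intros t Ht; destruct (unit_conj t Ht).
  field; assumption.
- rewrite cmean_plus by now apply disk_circ_cont.
  apply disk_ext with (2 := disk_plus _ _ IHf IHg); intros t Ht.
  destruct (unit_conj t Ht); field; assumption.
- assert (Hf : disk_alg f) by now apply disk_lim with g.
  apply disk_lim with (1 := IH); intros e He.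
  assert (He2 : (0 < e / 2)%R) by lra.
  destruct (L _ He2) as [n Hn]; exists n; intros t Ht.
  destruct (unit_conj t Ht) as [Ht0 _].
  replace ((g n t - cmean 1 (g n)) / t - (f t - cmean 1 f) / t) with
    (((g n t - f t) - (cmean 1 (g n) - cmean 1 f)) / t) by (field; assumption).
  rewrite Cmod_div, Ht by assumption.
  eapply Rle_trans; [unfold Rdiv; rewrite Rinv_1, Rmult_1_r; apply Cmod_minus_le|].
  specialize (Hn t Ht) as Hn1.
  assert (Cmod (cmean 1 (g n) - cmean 1 f) <= e / 2)%R; [|lra].
  rewrite <- cmean_minus by now apply disk_circ_cont.
  apply cmean_bound; [lra|apply circ_cont_minus; now apply disk_circ_cont|exact Hn].
Qed.

Lemma disk_neg_ext (f g : C -> C) :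
  (forall t, Cmod t = 1%R -> f t = g t) -> disk_neg f -> disk_neg g.
Proof.
intros E (a & Ha & H); exists a; split; [assumption|].
intros t Ht; rewrite <- E by assumption; now apply H.
Qed.

Lemma disk_neg_mult v b : disk_neg v -> disk_alg b -> disk_neg (fun t => v t * Cconj (b t)).
Proof.
intros (a & Ha & H) Hb; exists (fun t => a t * b t); split; [now apply disk_mult|].
intros t Ht; rewrite H by assumption; rewrite !Cmult_conj; ring.
Qed.

Lemma disk_neg_minus u v : disk_neg u -> disk_neg v -> disk_neg (fun t => u t - v t).
Proof.
intros (a & Ha & H) (b & Hb & H'); exists (fun t => a t - b t); split; [now apply disk_minus|].
intros t Ht; rewrite H, H' by assumption; rewrite <- Cminus_conj; f_equal; ring.
Qed.

Lemma disk_neg_scal c v : disk_neg v -> disk_neg (fun t => c * v t).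
Proof.
intros H; apply disk_neg_ext with (2 := disk_neg_mult v _ H (disk_const (Cconj c))).
intros t _; rewrite Cconj_conj; ring.
Qed.

Lemma disk_neg_circ_cont v : disk_neg v -> circ_cont 1 v.
Proof.
intros (a & Ha & H).
apply circ_cont_ext with (fun t => Cconj (t * a t)); [lra|intros; now rewrite H|].
apply circ_cont_conj, circ_cont_mult; [apply circ_cont_id|now apply disk_circ_cont].
Qed.

(** With v = Cconj (t * a) on the circle, the integrand is t f a, a function of the disc algebra
    that vanishes at 0. *)
Lemma disk_neg_orth f v : disk_alg f -> disk_neg v -> cmean 1 (fun t => f t * Cconj (v t)) = 0.
Proof.
intros Hf (a & Ha & H).
rewrite <- (disk_mean_id (fun t => f t * a t)) by now apply disk_mult.
apply cmean_ext; [lra|]; intros t Ht; rewrite H, Cconj_conj by assumption; ring.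
Qed.

(** One step of the geometric expansion, t / (t - z) = 1 + z / (t - z). *)
Lemma cauchy_int_expand s g z :
  (0 < s)%R -> Cmod z <> s -> circ_cont s g ->
  cauchy_int s g z = cmean s g + z * cauchy_int s (fun t => g t / t) z.
Proof.
intros Hs Hz Hg; unfold cauchy_int.
assert (Hi : circ_cont s (fun t => / t)).
{ apply circ_cont_inv; [lra| |apply circ_cont_id].
  intros t Ht; apply Cmod_gt_0; lra. }
assert (Hk : circ_cont s (fun t => g t / t * (t / (t - z)))).
{ apply circ_cont_mult; [now apply circ_cont_mult|apply circ_cont_kernel; lra]. }
rewrite <- cmean_scal, <- cmean_plus; try assumption.
- apply cmean_ext; [lra|]; intros t Ht; field; split.
  + now apply circ_neq with s.
  + apply Cmod_gt_0; lra.
- apply circ_cont_mult; [apply circ_cont_const|assumption].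
Qed.

(** The sum over k < N of z^k times the mean of g(t) / t^k, in Horner form: a Taylor polynomial of
    the Cauchy integral. Each step divides g by t, which gains a factor 1/s on the circle. *)
Fixpoint taylor (s : R) (N : nat) (g : C -> C) (z : C) : C :=
  match N with
  | O => 0
  | S N => cmean s g + z * taylor s N (fun t => g t / t) z
  end.

Lemma disk_taylor s N g : disk_alg (taylor s N g).
Proof.
revert g; induction N as [|N IH]; intros g; simpl; [apply disk_const|].
apply (disk_plus (fun _ => cmean s g) (fun z => z * taylor s N (fun t => g t / t) z)).
- apply disk_const.
- apply disk_id_mult, IH.
Qed.

Lemma taylor_error s N g M z :
  (1 < s)%R -> Cmod z = 1%R -> circ_cont s g ->
  (forall t, Cmod t = s -> (Cmod (g t) <= M)%R) ->
  (Cmod (taylor s N g z - cauchy_int s g z) <= M * (/ s) ^ N * (s / (s - 1)))%R.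
Proof.
intros Hs Hz; revert g M; induction N as [|N IH]; intros g M Hg HM; simpl.
- rewrite Cmod_minus_sym; replace (cauchy_int s g z - 0) with (cauchy_int s g z) by ring.
  pose proof (cauchy_int_bound s g z M ltac:(lra) ltac:(lra) Hg HM) as B.
  rewrite Hz, Rabs_pos_eq in B by lra; lra.
- rewrite (cauchy_int_expand s g z) by (lra || assumption).
  replace (cmean s g + z * taylor s N (fun t => g t / t) z -
    (cmean s g + z * cauchy_int s (fun t => g t / t) z)) with
    (z * (taylor s N (fun t => g t / t) z - cauchy_int s (fun t => g t / t) z)) by ring.
  rewrite Cmod_mult, Hz, Rmult_1_l.
  eapply Rle_trans; [apply (IH _ (M * / s)%R)|].
  + apply circ_cont_mult; [assumption|apply circ_cont_inv; [lra| |apply circ_cont_id]].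
    intros t Ht; apply Cmod_gt_0; lra.
  + intros t Ht; rewrite Cmod_div, Ht by (apply Cmod_gt_0; lra).
    apply Rmult_le_compat_r; [left; apply Rinv_0_lt_compat; lra|now apply HM].
  + apply Req_le; ring.
Qed.

Lemma cauchy_int_disk s g : (1 < s)%R -> circ_cont s g -> disk_alg (cauchy_int s g).
Proof.
intros Hs Hg; apply disk_lim with (fun N => taylor s N g); [intros; apply disk_taylor|].
intros e He; destruct (circ_cont_bounded s g Hg) as (M & HM0 & HM).
assert (P : (0 < M * (s / (s - 1)))%R)
  by (apply Rmult_lt_0_compat; [|apply Rdiv_lt_0_compat]; lra).
destruct (pow_lt_1_zero (/ s)) with (y := (e / (M * (s / (s - 1))))%R) as [N HN].
- rewrite Rabs_pos_eq by (left; apply Rinv_0_lt_compat; lra).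
  rewrite <- Rinv_1; apply Rinv_lt_contravar; lra.
- now apply Rdiv_lt_0_compat.
- exists N; intros t Ht.
  eapply Rle_trans; [now apply taylor_error with (M := M)|].
  specialize (HN N (Nat.le_refl N)); apply Rabs_def2 in HN as [HN _].
  apply (Rmult_lt_compat_r _ _ _ P) in HN.
  replace (e / (M * (s / (s - 1))) * (M * (s / (s - 1))))%R with e in HN by (field; lra).
  lra.
Qed.

Lemma cmean_reflect s f :
  (0 < s)%R -> cmean (/ s) (fun u => f (/ Cconj u)) = cmean s f.
Proof.
intros Hs; unfold cmean; f_equal; apply CRInt_ext; [apply two_PI_pos|].
intros x _; f_equal.
rewrite Cmult_conj, Cconj_R, Cconj_cis, RtoC_inv by lra.
field; split; [apply cis_neq_0|]; intros E; apply RtoC_inj in E; lra.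
Qed.

Lemma circ_cont_reflect s f :
  (0 < s)%R -> circ_cont s f -> circ_cont (/ s) (fun u => f (/ Cconj u)).
Proof.
intros Hs Hf x.
assert (E : forall y, / Cconj (RtoC (/ s) * cis y) = RtoC s * cis y).
{ intros y; rewrite Cmult_conj, Cconj_R, Cconj_cis, RtoC_inv by lra.
  field; split; [apply cis_neq_0|]; intros E; apply RtoC_inj in E; lra. }
unfold rcont; rewrite E; apply climit_ext with (2 := Hf x).
intros y; now rewrite E.
Qed.

(** The reflection u -> 1 / Cconj u exchanges the circles of radii s and 1/s and preserves angles.
    The factor z that appears is what makes an inner Cauchy integral strictly negative in
    [cauchy_int_neg]. *)
Lemma cauchy_int_reflect s g z :
  (0 < s < 1)%R -> Cmod z = 1%R -> circ_cont s g ->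
  Cconj (cauchy_int s g z) =
  - (z * cauchy_int (/ s) (fun u => Cconj (g (/ Cconj u)) / u) z).
Proof.
intros Hs Hz Hg; unfold cauchy_int.
assert (Hs' : (1 < / s)%R) by (rewrite <- Rinv_1; apply Rinv_lt_contravar; lra).
assert (Hk : circ_cont s (fun t => g t * (t / (t - z))))
  by (apply circ_cont_mult; [assumption|apply circ_cont_kernel; lra]).
rewrite <- cmean_conj by assumption.
rewrite <- (cmean_reflect s) by lra.
rewrite <- cmean_scal.
- transitivity (cmean (/ s) (fun u => - (1) *
    (z * (Cconj (g (/ Cconj u)) / u * (u / (u - z)))))).
  + apply cmean_ext; [lra|]; intros u Hu.
    assert (Hu0 : u <> 0) by (apply Cmod_gt_0; lra).
    destruct (unit_conj z Hz) as [Hz0 Hzc].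
    assert (Huz : u - z <> 0) by (apply circ_neq with (/ s)%R; lra).
    rewrite Cmult_conj; unfold Cdiv; rewrite Cmult_conj, !Cconj_inv, Cminus_conj,
      Cconj_inv, Cconj_conj, Hzc.
    assert (/ u - / z <> 0).
    { intros E; apply Huz.
      replace (u - z) with (- (u * z * (/ u - / z))) by (field; auto). rewrite E; ring. }
    field; repeat split; try assumption.
    intros E; apply Huz; rewrite <- (Copp_0), <- E; ring.
  + rewrite cmean_scal.
    * ring.
    * apply circ_cont_mult; [apply circ_cont_const|apply circ_cont_mult].
      -- apply circ_cont_mult; [now apply circ_cont_conj, circ_cont_reflect|].
         apply circ_cont_inv; [lra| |apply circ_cont_id].
         intros t Ht; apply Cmod_gt_0; lra.
      -- apply circ_cont_kernel; lra.
- apply circ_cont_mult.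
  + apply circ_cont_mult; [now apply circ_cont_conj, circ_cont_reflect|].
    apply circ_cont_inv; [lra| |apply circ_cont_id].
    intros t Ht; apply Cmod_gt_0; lra.
  + apply circ_cont_kernel; lra.
Qed.

Lemma cauchy_int_neg s g : (0 < s < 1)%R -> circ_cont s g -> disk_neg (cauchy_int s g).
Proof.
intros Hs Hg.
assert (Hs' : (1 < / s)%R) by (rewrite <- Rinv_1; apply Rinv_lt_contravar; lra).
exists (fun z => - (1) * cauchy_int (/ s) (fun u => Cconj (g (/ Cconj u)) / u) z); split.
- apply disk_scal, cauchy_int_disk; [assumption|].
  apply circ_cont_mult; [apply circ_cont_conj, circ_cont_reflect; lra || assumption|].
  apply circ_cont_inv; [lra| |apply circ_cont_id].
  intros t Ht; apply Cmod_gt_0; lra.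
- intros z Hz; rewrite <- (Cconj_conj (cauchy_int s g z)), cauchy_int_reflect by assumption.
  f_equal; ring.
Qed.

(** In Cauchy's formula between radii 1/2 and R the inner integral vanishes, its integrand being
    holomorphic in the small disc with value 0 at 0. *)
Lemma cdiff_disk f R : (1 < R)%R -> (forall z, (Cmod z <= R)%R -> cdiff f z) -> disk_alg f.
Proof.
intros HR Hf.
assert (Cf : circ_cont R f) by (apply cdiff_circ; [lra|intros z Hz; apply Hf; lra]).
apply disk_ext with (2 := cauchy_int_disk R f HR Cf).
intros z Hz.
rewrite (cauchy_formula f (1 / 2) R) by (lra || (intros t Ht; apply Hf; lra) || assumption).
assert (cauchy_int (1 / 2) f z = 0) as ->; [|ring].
unfold cauchy_int; rewrite cmean_disk; [unfold Cdiv; ring|lra|].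
intros t Ht; apply cdiff_mult; [apply Hf; lra|apply cdiff_kernel; intros ->; lra].
Qed.

(** * Contractivity and the Neumann series *)

Lemma csum_S (f : nat -> C) (n : nat) :
  sum_n (G := C_AbelianMonoid) f (S n) = sum_n (G := C_AbelianMonoid) f n + f (S n).
Proof. exact (sum_Sn (G := C_AbelianMonoid) f n). Qed.

Lemma csum_0 (f : nat -> C) : sum_n (G := C_AbelianMonoid) f 0 = f 0%nat.
Proof. exact (sum_O (G := C_AbelianMonoid) f). Qed.

(** * The mean-square norm on the unit circle *)

Definition sqnorm (f : C -> C) : R := Re (cmean 1 (fun t => f t * Cconj (f t))).

Lemma cmean_le f g :
  circ_cont 1 f -> circ_cont 1 g ->
  (forall t, Cmod t = 1%R -> (Re (f t) <= Re (g t))%R) ->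
  (Re (cmean 1 f) <= Re (cmean 1 g))%R.
Proof.
intros Hf Hg H.
assert (E : forall h, circ_cont 1 h -> Re (cmean 1 h) =
  (RInt (fun x => Re (h (RtoC 1 * cis x)%C)) 0 (2 * PI) * / (2 * PI))%R).
{ intros h Hh; unfold cmean; rewrite <- (CRInt_Re (fun x => h (RtoC 1 * cis x)));
    [|apply two_PI_pos|now apply circ_cont_on].
  unfold Cdiv; rewrite <- RtoC_inv by (pose proof PI_RGT_0; lra); apply re_scal_r. }
rewrite !E by assumption.
apply Rmult_le_compat_r; [left; apply Rinv_0_lt_compat; pose proof PI_RGT_0; lra|].
apply RInt_le; [apply two_PI_pos| | |].
- apply (ex_RInt_continuous (V := R_CompleteNormedModule)).
  intros x _; apply (rcont_Re (fun x => f (RtoC 1 * cis x))), Hf.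
- apply (ex_RInt_continuous (V := R_CompleteNormedModule)).
  intros x _; apply (rcont_Re (fun x => g (RtoC 1 * cis x))), Hg.
- intros x _; apply H, Cmod_polar; lra.
Qed.

Lemma circ_cont_sq f : circ_cont 1 f -> circ_cont 1 (fun t => f t * Cconj (f t)).
Proof. intros H; apply circ_cont_mult; [|apply circ_cont_conj]; assumption. Qed.

Lemma sqnorm_le k f g :
  circ_cont 1 f -> circ_cont 1 g ->
  (forall t, Cmod t = 1%R -> (Cmod (f t) ^ 2 <= k * Cmod (g t) ^ 2)%R) ->
  (sqnorm f <= k * sqnorm g)%R.
Proof.
intros Hf Hg H; unfold sqnorm.
rewrite <- re_scal_l, <- cmean_scal by now apply circ_cont_sq.
apply cmean_le.
- now apply circ_cont_sq.
- apply circ_cont_mult; [apply circ_cont_const|now apply circ_cont_sq].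
- intros t Ht; rewrite <- !Cmod2_conj, <- RtoC_mult; simpl Re; now apply H.
Qed.

Lemma sqnorm_mono f g :
  circ_cont 1 f -> circ_cont 1 g ->
  (forall t, Cmod t = 1%R -> (Cmod (f t) <= Cmod (g t))%R) -> (sqnorm f <= sqnorm g)%R.
Proof.
intros Hf Hg H; rewrite <- (Rmult_1_l (sqnorm g)); apply sqnorm_le; [assumption|assumption|].
intros t Ht; rewrite Rmult_1_l; apply pow_incr; split; [apply Cmod_ge_0|now apply H].
Qed.

Lemma sqnorm_pos f : circ_cont 1 f -> (0 <= sqnorm f)%R.
Proof.
intros Hf; replace 0%R with (Re (cmean 1 (fun _ => 0))) by now rewrite cmean_const.
apply cmean_le; [apply circ_cont_const|now apply circ_cont_sq|].
intros t Ht; rewrite <- Cmod2_conj; simpl Re; apply pow2_ge_0.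
Qed.

Lemma sqnorm_ext (f g : C -> C) :
  (forall t, Cmod t = 1%R -> f t = g t) -> sqnorm f = sqnorm g.
Proof.
intros E; unfold sqnorm; f_equal; apply cmean_ext; [lra|].
intros t Ht; now rewrite E.
Qed.

Lemma sqnorm_orth u v :
  circ_cont 1 u -> circ_cont 1 v -> cmean 1 (fun t => u t * Cconj (v t)) = 0 ->
  sqnorm (fun t => u t + v t) = (sqnorm u + sqnorm v)%R.
Proof.
intros Hu Hv H; unfold sqnorm.
assert (Cuv : circ_cont 1 (fun t => u t * Cconj (v t)))
  by (apply circ_cont_mult; [|apply circ_cont_conj]; assumption).
transitivity (Re (cmean 1 (fun t => (u t * Cconj (u t) + v t * Cconj (v t)) +
  (u t * Cconj (v t) + Cconj (u t * Cconj (v t)))))).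
- f_equal; apply cmean_ext; [lra|]; intros t _.
  rewrite Cplus_conj, Cmult_conj, Cconj_conj; ring.
- rewrite !cmean_plus, cmean_conj, H;
    repeat (apply circ_cont_plus || apply circ_cont_sq || assumption || apply circ_cont_conj).
  assert (Cconj 0 = 0) as -> by apply Cconj_R.
  rewrite !Cplus_0_r; reflexivity.
Qed.

(** Pythagoras for f = (f - c) + c, c being the mean: f - c is orthogonal to the constants. *)
Lemma cmean_sqnorm f : circ_cont 1 f -> (Cmod (cmean 1 f) ^ 2 <= sqnorm f)%R.
Proof.
intros Hf; set (c := cmean 1 f).
assert (Hfc : circ_cont 1 (fun t => f t - c))
  by (apply circ_cont_minus; [assumption|apply circ_cont_const]).
rewrite (sqnorm_ext f (fun t => (f t - c) + c)) by (intros; ring).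
rewrite (sqnorm_orth (fun t => f t - c) (fun _ => c)); [|assumption|apply circ_cont_const|].
- pose proof (sqnorm_pos _ Hfc).
  assert (sqnorm (fun _ => c) = Cmod c ^ 2)%R as ->; [|lra].
  unfold sqnorm; rewrite cmean_const, <- Cmod2_conj; reflexivity.
- rewrite (cmean_ext 1 _ (fun t => Cconj c * (f t - c))) by (lra || intros; ring).
  rewrite cmean_scal, cmean_minus, cmean_const by (assumption || apply circ_cont_const).
  fold c; ring.
Qed.

Section Contraction.
Variables (e : C -> C) (n : nat).
Hypotheses (He : disk_alg e) (Hei : disk_alg (fun t => / e t)).
Hypothesis He0 : forall t, Cmod t = 1%R -> e t <> 0.

(* On the unit circle [calF] is [Cconj e / e] with [e = / Di]. *)
Let S t := t ^ n * (Cconj (e t) / e t).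

Lemma symbol_mod t : Cmod t = 1%R -> Cmod (S t) = 1%R.
Proof.
intros Ht; unfold S; rewrite Cmod_mult, Cmod_pow, Ht, pow1, Cmod_div, Cmod_conj by now apply He0.
field; apply Rgt_not_eq, Cmod_gt_0, He0, Ht.
Qed.

Lemma symbol_circ_cont : circ_cont 1 S.
Proof.
apply circ_cont_mult; [apply circ_cont_pow, circ_cont_id|].
apply circ_cont_mult; [now apply circ_cont_conj, disk_circ_cont|now apply disk_circ_cont].
Qed.

(* Dividing [S a = u + v] by [Cconj e] gives [t^n a / e = u / Cconj e + v / Cconj e],
   whose left-hand side is orthogonal to the last term: hence [u], not only [v],
   is bounded below in terms of [a]. *)
Lemma hankel_contraction :
  exists k, (0 <= k < 1)%R /\ forall a v, disk_alg a -> disk_neg v ->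
    disk_alg (fun t => S t * a t - v t) -> (sqnorm v <= k * sqnorm a)%R.
Proof.
destruct (circ_cont_bounded 1 e (disk_circ_cont e He)) as (M & HM0 & HM).
destruct (circ_cont_bounded 1 _ (disk_circ_cont _ Hei)) as (M' & HM0' & HM').
(* With M bounding e and M' bounding 1/e, the argument gives |a|^2 <= M^2 M'^2 |u|^2 in mean square,
   hence |u|^2 >= q |a|^2; the + 1 ensures q < 1. As |a|^2 = |u|^2 + |v|^2, at most the fraction 1 -
   q is left for v. *)
set (q := (/ (M ^ 2 * M' ^ 2 + 1))%R).
assert (Hq : (0 < M ^ 2 * M' ^ 2)%R) by (apply Rmult_lt_0_compat; nra).
assert (Hq0 : (0 < q)%R) by (apply Rinv_0_lt_compat; lra).
assert (Hq1 : (q < 1)%R).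
{ apply Rmult_lt_reg_r with (M ^ 2 * M' ^ 2 + 1)%R; [lra|]; unfold q; rewrite Rinv_l; lra. }
exists (1 - q)%R; split; [lra|].
intros a v Ha Hv Hu; set (u := fun t => S t * a t - v t) in *.
assert (Ca : circ_cont 1 a) by now apply disk_circ_cont.
assert (Cu : circ_cont 1 u) by now apply disk_circ_cont.
assert (Cv : circ_cont 1 v) by now apply disk_neg_circ_cont.
assert (Ci' : circ_cont 1 (fun t => / Cconj (e t))).
{ apply circ_cont_inv; [lra| |now apply circ_cont_conj, disk_circ_cont].
  intros t Ht; apply Cmod_gt_0; rewrite Cmod_conj; apply Cmod_gt_0, He0, Ht. }
assert (Hsum : sqnorm a = (sqnorm u + sqnorm v)%R).
{ rewrite <- sqnorm_orth; [|assumption|assumption|now apply disk_neg_orth].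
  assert (CSa : circ_cont 1 (fun t => S t * a t))
    by (apply circ_cont_mult; [apply symbol_circ_cont|assumption]).
  rewrite (sqnorm_ext (fun t => u t + v t) (fun t => S t * a t))
    by (intros; unfold u; ring).
  apply Rle_antisym; (apply sqnorm_mono; [assumption|assumption|]); intros t Ht;
    rewrite Cmod_mult, symbol_mod by assumption; lra. }
set (X := fun t => t ^ n * a t * / e t); set (Y := fun t => - (1) * (v t * / Cconj (e t))).
assert (CX : circ_cont 1 X).
{ apply circ_cont_mult; [|now apply disk_circ_cont].
  apply circ_cont_mult; [apply circ_cont_pow, circ_cont_id|assumption]. }
assert (NY : disk_neg Y).
{ apply disk_neg_scal.
  apply disk_neg_ext with (2 := disk_neg_mult v _ Hv Hei).
  intros t _; now rewrite Cconj_inv. }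
assert (CY : circ_cont 1 Y) by now apply disk_neg_circ_cont.
assert (HXY : sqnorm (fun t => u t * / Cconj (e t)) = (sqnorm X + sqnorm Y)%R).
{ rewrite <- sqnorm_orth; [|assumption|assumption|].
  - apply sqnorm_ext; intros t Ht; unfold u, X, Y, S.
    assert (Cconj (e t) <> 0)
      by (apply Cmod_gt_0; rewrite Cmod_conj; apply Cmod_gt_0, He0, Ht).
    pose proof (He0 t Ht); field; split; assumption.
  - apply disk_neg_orth; [|assumption].
    apply disk_mult; [apply disk_mult; [apply disk_pow|assumption]|assumption]. }
assert (B1 : (sqnorm (fun t => u t * / Cconj (e t))%C <= M' ^ 2 * sqnorm u)%R).
{ apply sqnorm_le; [now apply circ_cont_mult|assumption|].
  intros t Ht; rewrite Cmod_mult, <- Cconj_inv, Cmod_conj, Rpow_mult_distr, Rmult_comm.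
  apply Rmult_le_compat_r; [apply pow2_ge_0|].
  apply pow_incr; split; [apply Cmod_ge_0|now apply HM']. }
assert (B2 : (sqnorm a <= M ^ 2 * sqnorm X)%R).
{ apply sqnorm_le; [assumption|assumption|].
  intros t Ht; unfold X; rewrite !Cmod_mult, Cmod_pow, Ht, pow1, Rmult_1_l.
  rewrite Cmod_inv by now apply He0.
  assert (P : (0 < Cmod (e t))%R) by (apply Cmod_gt_0, He0, Ht).
  specialize (HM t Ht).
  rewrite <- Rpow_mult_distr; apply pow_incr; split; [apply Cmod_ge_0|].
  rewrite (Rmult_comm (Cmod (a t))), <- Rmult_assoc.
  rewrite <- (Rmult_1_l (Cmod (a t))) at 1.
  apply Rmult_le_compat_r; [apply Cmod_ge_0|].
  apply Rmult_le_reg_r with (Cmod (e t)); [assumption|].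
  rewrite Rmult_assoc, Rinv_l by lra; lra. }
pose proof (sqnorm_pos Y CY); pose proof (sqnorm_pos u Cu).
assert (B3 : (sqnorm a <= M ^ 2 * M' ^ 2 * sqnorm u)%R).
{ eapply Rle_trans; [exact B2|]; rewrite Rmult_assoc.
  apply Rmult_le_compat_l; [apply pow2_ge_0|lra]. }
assert (B4 : (q * sqnorm a <= sqnorm u)%R).
{ apply Rmult_le_reg_l with (M ^ 2 * M' ^ 2 + 1)%R; [lra|].
  rewrite <- Rmult_assoc; unfold q; rewrite Rinv_r by lra; lra. }
lra.
Qed.

Lemma conj_symbol t : Cmod t = 1%R -> / S t = Cconj (S t).
Proof.
intros Ht; destruct (unit_conj t Ht) as [Ht0 Htc].
assert (Cconj (e t) <> 0)
  by (apply Cmod_gt_0; rewrite Cmod_conj; apply Cmod_gt_0, He0, Ht).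
unfold S; rewrite Cmult_conj, Cpow_conj, Htc; unfold Cdiv.
rewrite Cmult_conj, Cconj_conj, Cconj_inv, Cpow_inv by assumption.
pose proof (He0 t Ht); pose proof (Cpow_nz t n Ht0); field; repeat split; assumption.
Qed.

(** Here a is the nonnegative part of v / S: dividing by the unimodular S preserves the norm, and
    taking an orthogonal part does not increase it. *)
Lemma toeplitz_contraction a v :
  disk_alg a -> disk_neg v -> disk_neg (fun t => v t / S t - a t) ->
  (sqnorm a <= sqnorm v)%R.
Proof.
intros Ha Hv H.
assert (Ca : circ_cont 1 a) by now apply disk_circ_cont.
assert (Cv : circ_cont 1 v) by now apply disk_neg_circ_cont.
assert (CS : circ_cont 1 (fun t => v t * Cconj (S t))).
{ apply circ_cont_mult; [assumption|apply circ_cont_conj, symbol_circ_cont]. }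
pose proof (sqnorm_orth a _ Ca (disk_neg_circ_cont _ H) (disk_neg_orth _ _ Ha H)) as E.
pose proof (sqnorm_pos _ (disk_neg_circ_cont _ H)).
apply Rle_trans with (sqnorm (fun t => a t + (v t / S t - a t))%C); [lra|].
rewrite (sqnorm_ext _ (fun t => v t * Cconj (S t)))
  by (intros t Ht; rewrite <- conj_symbol by assumption; unfold Cdiv; ring).
apply sqnorm_mono; [assumption|assumption|].
intros t Ht; rewrite Cmod_mult, Cmod_conj, symbol_mod by assumption; lra.
Qed.

(** The hypotheses express a (k+1) = T (a k) and T h = h - 1 through their splittings, v k and v0
    being the intermediate negative parts. The remainder of the series is the mean of S times
    T^(K+1) h, which decays geometrically. *)
Lemma neumann_series (h v0 : C -> C) (a v : nat -> C -> C) :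
  disk_alg h -> disk_neg v0 -> disk_alg (fun t => S t * h t - v0 t) ->
  disk_neg (fun t => v0 t / S t - (h t - 1)) ->
  (forall t, Cmod t = 1%R -> a 0%nat t = 1) ->
  (forall k, disk_alg (a k)) -> (forall k, disk_neg (v k)) ->
  (forall k, disk_alg (fun t => S t * a k t - v k t)) ->
  (forall k, disk_neg (fun t => v k t / S t - a (Datatypes.S k) t)) ->
  is_series (V := C_NormedModule)
    (fun k => cmean 1 (fun t => S t * a k t)) (cmean 1 (fun t => S t * h t)).
Proof.
intros Hh Hv0 Hhv Hvh Ha0 Ha Hv Hav Hva.
(* [d K] is h minus the first K terms and [q K] is v0 minus the first K of the v. Since [a 0] is 1,
   the relation T h = h - 1 starts the recursion d (K+1) = T (d K), with [q K] as intermediate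
   function. *)
set (d := fix d K := match K with O => h | Datatypes.S K => fun t => d K t - a K t end).
set (q := fix q K := match K with O => v0 | Datatypes.S K => fun t => q K t - v K t end).
assert (Hd : forall K, disk_alg (d K)).
{ induction K as [|K IH]; [exact Hh|now apply disk_minus]. }
assert (Hq : forall K, disk_neg (q K)).
{ induction K as [|K IH]; [exact Hv0|now apply disk_neg_minus]. }
assert (Hdq : forall K, disk_alg (fun t => S t * d K t - q K t)).
{ induction K as [|K IH]; [exact Hhv|].
  apply disk_ext with (2 := disk_minus _ _ IH (Hav K)); intros t _; simpl; ring. }
assert (Hqd : forall K, disk_neg (fun t => q K t / S t - d (Datatypes.S K) t)).
{ induction K as [|K IH].
  - apply disk_neg_ext with (2 := Hvh); intros t Ht; simpl; now rewrite Ha0.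
  - apply disk_neg_ext with (2 := disk_neg_minus _ _ IH (Hva K)); intros t _; simpl.
    unfold Cdiv; ring. }
destruct hankel_contraction as (k & Hk & HC).
assert (Hdn : forall K, (sqnorm (d K) <= k ^ K * sqnorm h)%R).
{ induction K as [|K IH]; [simpl; lra|].
  eapply Rle_trans; [apply (toeplitz_contraction _ (q K)); auto|].
  eapply Rle_trans; [apply (HC (d K)); auto|].
  simpl; rewrite Rmult_assoc; apply Rmult_le_compat_l; lra. }
assert (CSf : forall f, disk_alg f -> circ_cont 1 (fun t => S t * f t)).
{ intros f Hf; apply circ_cont_mult; [apply symbol_circ_cont|now apply disk_circ_cont]. }
assert (Hsum : forall K, (sum_n (G := C_AbelianMonoid)
  (fun k => cmean 1 (fun t => S t * a k t)) K : C) =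
  cmean 1 (fun t => S t * h t) - cmean 1 (fun t => S t * d (Datatypes.S K) t)).
{ induction K as [|K IH].
  - rewrite csum_0, <- cmean_minus by auto; apply cmean_ext; [lra|]; intros t _; simpl; ring.
  - rewrite csum_S, IH.
    assert (cmean 1 (fun t => S t * d (Datatypes.S (Datatypes.S K)) t) =
      cmean 1 (fun t => S t * d (Datatypes.S K) t) -
      cmean 1 (fun t => S t * a (Datatypes.S K) t)) as ->.
    { rewrite <- cmean_minus by auto; apply cmean_ext; [lra|]; intros t _; simpl; ring. }
    match goal with |- @eq _ ?x ?y => change (@eq C x y) end; ring. }
intros P [eps HP].
assert (Hh0 : (0 <= sqnorm h)%R) by now apply sqnorm_pos, disk_circ_cont.
(* The threshold is eps^2 because squares are compared, the mean being controlled by its mean-square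
   norm; the + 1 covers h of norm zero. *)
destruct (pow_lt_1_zero k) with (y := (eps ^ 2 / (sqnorm h + 1))%R) as [N HN].
- rewrite Rabs_pos_eq; lra.
- apply Rdiv_lt_0_compat; [apply pow_lt, cond_pos|lra].
- exists N; intros K HK; apply HP, C_NormedModule_mixin_compat1.
  change (Cmod (sum_n (G := C_AbelianMonoid) (fun k => cmean 1 (fun t => (S t * a k t)%C)) K -
    cmean 1 (fun t => (S t * h t)%C)) < eps)%R.
  rewrite Hsum.
  replace (cmean 1 (fun t => S t * h t) - cmean 1 (fun t => S t * d (Datatypes.S K) t) -
    cmean 1 (fun t => S t * h t)) with (- cmean 1 (fun t => S t * d (Datatypes.S K) t)) by ring.
  rewrite Cmod_opp.
  apply Rsqr_incrst_0; [|apply Cmod_ge_0|left; apply cond_pos]; rewrite !Rsqr_pow2.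
  eapply Rle_lt_trans; [apply cmean_sqnorm, CSf, Hd|].
  apply Rle_lt_trans with (sqnorm (d (Datatypes.S K))).
  { apply sqnorm_mono; [now apply CSf|now apply disk_circ_cont|].
    intros t Ht; rewrite Cmod_mult, symbol_mod by assumption; lra. }
  eapply Rle_lt_trans; [apply Hdn|].
  apply Rle_lt_trans with (k ^ Datatypes.S K * (sqnorm h + 1))%R.
  { apply Rmult_le_compat_l; [apply pow_le|]; lra. }
  replace (eps ^ 2)%R with (eps ^ 2 / (sqnorm h + 1) * (sqnorm h + 1))%R by (field; lra).
  apply Rmult_lt_compat_r; [lra|].
  assert (HK' : (Datatypes.S K >= N)%nat) by lia.
  specialize (HN _ HK'); apply Rabs_def2 in HN; lra.
Qed.

End Contraction.

(** * The Poisson kernel *)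

Lemma Cmod_Cexp (a : C) : Cmod (Cexp a) = exp (Re a).
Proof. apply Cmod_polar; left; apply exp_pos. Qed.

Lemma Cinv_Cexp (a : C) : / Cexp a = Cexp (- a).
Proof.
assert (E : Cexp a * Cexp (- a) = 1).
{ rewrite <- Cexp_plus; replace (a + - a) with (RtoC 0) by ring.
  unfold Cexp; simpl; rewrite exp_0, cis_0; ring. }
replace (Cexp (- a)) with (/ Cexp a * (Cexp a * Cexp (- a))) by (field; apply Cexp_neq_0).
rewrite E; ring.
Qed.

Lemma Cconj_Cexp (a : C) : Cconj (Cexp a) = Cexp (Cconj a).
Proof.
unfold Cexp; rewrite Cmult_conj, Cconj_R, re_conj, im_conj; f_equal.
unfold Cconj, cis; simpl; rewrite cos_neg, sin_neg; reflexivity.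
Qed.

(** The kernel equals 2 t / (t - z) - 1, so its mean is 2 - 1. *)
Lemma cmean_szego_kernel (z : C) : (Cmod z < 1)%R -> cmean 1 (fun t => (t + z) / (t - z)) = 1.
Proof.
intros Hz.
pose proof (cauchy_int_one_in 1 z Hz) as H; unfold cauchy_int in H.
assert (Ck : circ_cont 1 (fun t => 1 * (t / (t - z)))).
{ apply circ_cont_mult; [apply circ_cont_const|apply circ_cont_kernel; lra]. }
transitivity (cmean 1 (fun t => 2 * (1 * (t / (t - z))) - 1)).
- apply cmean_ext; [lra|]; intros t Ht; field; apply circ_neq with 1%R; lra.
- rewrite cmean_minus, cmean_scal, cmean_const, H; try assumption; [ring| |].
  + apply circ_cont_mult; [apply circ_cont_const|assumption].
  + apply circ_cont_const.
Qed.

Lemma circ_cont_szego_kernel (z : C) : Cmod z <> 1%R -> circ_cont 1 (fun t => (t + z) / (t - z)).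
Proof.
intros Hz; apply circ_cont_mult.
- apply circ_cont_plus; [apply circ_cont_id|apply circ_cont_const].
- apply circ_cont_inv; [lra|intros t Ht; now apply circ_neq with 1%R|].
  apply circ_cont_minus; [apply circ_cont_id|apply circ_cont_const].
Qed.

Lemma szego_kernel_conj (t z : C) :
  Cmod t = 1%R -> z <> 0 -> t - z <> 0 ->
  Cconj ((t + / Cconj z) / (t - / Cconj z)) = - ((t + z) / (t - z)).
Proof.
intros Ht Hz Htz; destruct (unit_conj t Ht) as [Ht0 Htc].
unfold Cdiv; rewrite Cmult_conj, Cconj_inv, Cplus_conj, Cminus_conj, !Cconj_inv,
  Cconj_conj, Htc.
assert (/ t - / z <> 0).
{ intros E; apply Htz.
  replace (t - z) with (- (t * z * (/ t - / z))) by (field; auto). rewrite E; ring. }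
field; repeat split; try assumption.
intros E; apply Htz; rewrite <- Copp_0, <- E; ring.
Qed.

(** The right-hand side is the Poisson kernel; its positivity for |z| < 1 drives the next limit. *)
Lemma Re_szego_kernel (t z : C) :
  Cmod t = 1%R -> t - z <> 0 ->
  (Re ((t + z) / (t - z)) = (1 - Cmod z ^ 2) / Cmod (t - z) ^ 2)%R.
Proof.
intros Ht Htz.
assert (Hc : Cconj (t - z) <> 0) by (apply Cmod_gt_0; rewrite Cmod_conj; now apply Cmod_gt_0).
assert (P : (0 < Cmod (t - z))%R) by now apply Cmod_gt_0.
assert (Hn : RtoC (Cmod (t - z) ^ 2) <> 0).
{ intros E; apply RtoC_inj in E; pose proof (pow_lt _ 2 P); lra. }
replace ((t + z) / (t - z)) with
  (RtoC (/ Cmod (t - z) ^ 2) * (t * Cconj t - z * Cconj z + (z * Cconj t - Cconj (z * Cconj t)))).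
- rewrite re_scal_l, <- !Cmod2_conj, Ht.
  set (u := z * Cconj t); unfold Rdiv; rewrite Rmult_comm; f_equal.
  unfold Re, RtoC, Cconj; simpl; ring.
- rewrite RtoC_inv by (pose proof (pow_lt _ 2 P); lra).
  rewrite Cmod2_conj, !Cmult_conj, Cconj_conj.
  rewrite Cminus_conj in *.
  field; split; assumption.
Qed.

(** The radial limit of a Poisson integral. As the kernel is positive with mean 1, it is enough to
    integrate a pointwise bound of l(t) - l(zeta) against it. *)
Lemma poisson_limit (l : C -> R) (zeta : C) :
  Cmod zeta = 1%R -> circ_cont 1 (fun t => RtoC (l t)) ->
  (forall eps, (0 < eps)%R -> exists d, (0 < d)%R /\ forall t, Cmod t = 1%R ->
     (Cmod (t - zeta) < d)%R -> (Rabs (l t - l zeta) < eps)%R) ->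
  forall eps, (0 < eps)%R -> exists d, (0 < d)%R /\ forall s, (1 - d < s < 1)%R -> (0 < s)%R ->
    (Rabs (Re (cmean 1 (fun t => RtoC (l t) * ((t + RtoC s * zeta) / (t - RtoC s * zeta)))%C) - l zeta)
      <= eps)%R.
Proof.
intros Hz Hl Hc eps He.
destruct (circ_cont_bounded 1 _ Hl) as (B & HB0 & HB).
assert (He2 : (0 < eps / 2)%R) by lra.
destruct (Hc _ He2) as (d & Hd & K).
set (A := (2 * B / d ^ 2)%R).
assert (HA : (0 < A)%R) by (apply Rdiv_lt_0_compat; [lra|apply pow_lt, Hd]).
(* Away from [zeta] the crude bound [2 B] is absorbed by [A |t - zeta|^2], which
   cancels the singularity of the Poisson kernel. *)
assert (Hlt : forall t, Cmod t = 1%R ->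
  (Rabs (l t - l zeta) <= eps / 2 + A * Cmod (t - zeta) ^ 2)%R).
{ intros t Ht; pose proof (pow2_ge_0 (Cmod (t - zeta))).
  destruct (Rlt_le_dec (Cmod (t - zeta)) d) as [Hlt|Hge].
  - specialize (K t Ht Hlt).
    assert (0 <= A * Cmod (t - zeta) ^ 2)%R by (apply Rmult_le_pos; lra). lra.
  - pose proof (HB t Ht) as B1; pose proof (HB zeta Hz) as B2; rewrite Cmod_R in B1, B2.
    apply Rle_trans with (2 * B)%R.
    + unfold Rminus; eapply Rle_trans; [apply Rabs_triang|rewrite Rabs_Ropp; lra].
    + apply Rle_trans with (A * d ^ 2)%R; [unfold A; apply Req_le; field; lra|].
      assert (d ^ 2 <= Cmod (t - zeta) ^ 2)%R by (apply pow_incr; lra).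
      assert (A * d ^ 2 <= A * Cmod (t - zeta) ^ 2)%R by (apply Rmult_le_compat_l; lra).
      lra. }
(* From 4 A (1 - s^2) <= 8 A (1 - s), this keeps the far contribution below eps / 2. *)
exists (eps / (16 * A))%R; split; [apply Rdiv_lt_0_compat; lra|].
intros s Hs Hs0; set (z := RtoC s * zeta).
assert (Hzs : Cmod z = s).
{ unfold z; rewrite Cmod_mult, Hz, Cmod_R, Rabs_pos_eq; lra. }
assert (HAs : (4 * A * (1 - s ^ 2) <= eps / 2)%R).
{ assert (A * (1 - s) <= eps / 16)%R.
  { replace (eps / 16)%R with (A * (eps / (16 * A)))%R by (field; lra).
    apply Rmult_le_compat_l; lra. }
  replace (4 * A * (1 - s ^ 2))%R with (4 * (1 + s) * (A * (1 - s)))%R by ring.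
  assert (0 <= A * (1 - s))%R by (apply Rmult_le_pos; lra). nra. }
assert (Htz : forall t, Cmod t = 1%R -> t - z <> 0) by (intros t Ht; apply circ_neq with 1%R; lra).
assert (Ck : circ_cont 1 (fun t => (t + z) / (t - z))) by (apply circ_cont_szego_kernel; lra).
(* Since |t - z| >= 1 - s = |z - zeta|, the distance |t - zeta| is at most 2 |t - z|; its square
   thus cancels the denominator of the kernel at the cost of a factor 4. *)
assert (HK : forall t, Cmod t = 1%R -> (0 <= Re ((t + z) / (t - z)))%R /\
  (Cmod (t - zeta) ^ 2 * Re ((t + z) / (t - z)) <= 4 * (1 - s ^ 2))%R).
{ intros t Ht; rewrite Re_szego_kernel, Hzs by auto.
  assert (P : (0 < Cmod (t - z))%R) by (apply Cmod_gt_0, Htz, Ht).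
  assert (P2 : (0 < Cmod (t - z) ^ 2)%R) by now apply pow_lt.
  assert (Q : (0 <= 1 - s ^ 2)%R) by nra.
  split; [apply Rdiv_le_0_compat; assumption|].
  assert (D : (Cmod (t - zeta) <= 2 * Cmod (t - z))%R).
  { pose proof (circ_dist 1 z t Ht) as D1; rewrite Hzs, Rabs_pos_eq in D1 by lra.
    pose proof (Cmod_minus_triangle t z zeta) as D2.
    assert (Cmod (z - zeta) = 1 - s)%R as D3; [|lra].
    replace (z - zeta) with (RtoC (s - 1) * zeta) by (unfold z; rewrite RtoC_minus; ring).
    rewrite Cmod_mult, Hz, Cmod_R, Rabs_left1; lra. }
  apply Rmult_le_reg_r with (Cmod (t - z) ^ 2)%R; [assumption|].
  replace (Cmod (t - zeta) ^ 2 * ((1 - s ^ 2) / Cmod (t - z) ^ 2) * Cmod (t - z) ^ 2)%R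
    with ((1 - s ^ 2) * Cmod (t - zeta) ^ 2)%R by (field; lra).
  replace (4 * (1 - s ^ 2) * Cmod (t - z) ^ 2)%R
    with ((1 - s ^ 2) * (2 * Cmod (t - z)) ^ 2)%R by ring.
  apply Rmult_le_compat_l; [assumption|]; apply pow_incr; split; [apply Cmod_ge_0|assumption]. }
assert (Clk : circ_cont 1 (fun t => RtoC (l t) * ((t + z) / (t - z)))) by now apply circ_cont_mult.
assert (Cak : forall a, circ_cont 1 (fun t => RtoC a * ((t + z) / (t - z))))
  by (intros a; apply circ_cont_mult; [apply circ_cont_const|assumption]).
assert (Ma : forall a, cmean 1 (fun t => RtoC a * ((t + z) / (t - z))) = RtoC a).
{ intros a; rewrite cmean_scal, cmean_szego_kernel by (assumption || lra); ring. }
assert (T : forall t, Cmod t = 1%R ->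
  (Rabs (l t - l zeta) * Re ((t + z) / (t - z)) <=
   eps / 2 * Re ((t + z) / (t - z)) + 4 * A * (1 - s ^ 2))%R).
{ intros t Ht; destruct (HK t Ht) as [K1 K2]; specialize (Hlt t Ht).
  apply Rle_trans with ((eps / 2 + A * Cmod (t - zeta) ^ 2) * Re ((t + z) / (t - z)))%R;
    [now apply Rmult_le_compat_r|].
  assert (A * (Cmod (t - zeta) ^ 2 * Re ((t + z) / (t - z))) <= A * (4 * (1 - s ^ 2)))%R
    by (apply Rmult_le_compat_l; lra).
  lra. }
apply Rabs_le; split.
- apply Rle_trans with (- (eps / 2 + eps / 2))%R; [lra|].
  assert (Re (cmean 1 (fun t => RtoC (l zeta - eps / 2) * ((t + z) / (t - z)) -
    RtoC (4 * A * (1 - s ^ 2)))%C) <=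
    Re (cmean 1 (fun t => RtoC (l t) * ((t + z) / (t - z)))%C))%R as G.
  { apply cmean_le; [apply circ_cont_minus; [apply Cak|apply circ_cont_const]|assumption|].
    intros t Ht; specialize (T t Ht); destruct (HK t Ht) as [K1 _].
    assert (R0 : forall a b c, Re (RtoC a * b - RtoC c) = (a * Re b - c)%R)
      by (intros; unfold Re; simpl; ring).
    rewrite R0, re_scal_l.
    assert (- (Rabs (l t - l zeta)) <= l t - l zeta)%R
      by (pose proof (Rabs_maj2 (l t - l zeta)); lra).
    nra. }
  rewrite cmean_minus, Ma, cmean_const in G by (apply Cak || apply circ_cont_const).
  rewrite <- RtoC_minus, re_RtoC in G; fold z; lra.
- apply Rle_trans with (eps / 2 + eps / 2)%R; [|lra].
  assert (Re (cmean 1 (fun t => RtoC (l t) * ((t + z) / (t - z)))%C) <=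
    Re (cmean 1 (fun t => RtoC (l zeta + eps / 2) * ((t + z) / (t - z)) +
    RtoC (4 * A * (1 - s ^ 2)))%C))%R as G.
  { apply cmean_le; [assumption|apply circ_cont_plus; [apply Cak|apply circ_cont_const]|].
    intros t Ht; specialize (T t Ht); destruct (HK t Ht) as [K1 _].
    assert (R0 : forall a b c, Re (RtoC a * b + RtoC c) = (a * Re b + c)%R)
      by (intros; unfold Re; simpl; ring).
    rewrite R0, re_scal_l.
    assert (l t - l zeta <= Rabs (l t - l zeta))%R by apply Rle_abs.
    nra. }
  rewrite cmean_plus, Ma, cmean_const in G by (apply Cak || apply circ_cont_const).
  rewrite <- RtoC_plus, re_RtoC in G; fold z; lra.
Qed.

(** * Szego functions *)

(** All competitors are positive; should the infimum be infinite, [real] returns 0. *)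
Lemma rho_ge_0 w : (0 <= rho w)%R.
Proof.
unfold rho; set (P := fun s => _).
destruct (Glb_Rbar_correct P) as [_ H].
assert (H0 : Rbar_le 0 (Glb_Rbar P)).
{ apply H; intros s [Hs _]; simpl; lra. }
destruct (Glb_Rbar P); simpl in *; lra.
Qed.

Lemma weight_continuous w zeta :
  analytic_weight w -> Cmod zeta = 1%R ->
  forall eps, (0 < eps)%R -> exists d, (0 < d)%R /\ forall t, Cmod t = 1%R ->
    (Cmod (t - zeta) < d)%R -> (Rabs (ln (w t) - ln (w zeta)) < eps)%R.
Proof.
intros (Hw & U & W & _ & HU & HW & _) Hz eps He.
destruct (HU zeta Hz) as [Uz Wz].
pose proof (cdiff_ccont _ _ (ex_derive_cdiff _ _ (HW zeta Uz))) as Cw.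
assert (Cl : continuous ln (w zeta)).
{ apply (ex_derive_continuous (V := R_NormedModule)); auto_derive; now apply Hw. }
destruct (proj1 (filterlim_locally _ _) Cl (mkposreal eps He)) as [e He'].
destruct (cnear_elim _ _ (Cw e (cond_pos e))) as (d & Hd & K).
exists d; split; [assumption|]; intros t Ht Htd.
apply He'; specialize (K t Htd).
rewrite (proj2 (HU t Ht)), Wz, <- RtoC_minus, Cmod_R in K; exact K.
Qed.

Lemma log_weight_cont w :
  analytic_weight w -> circ_cont 1 (fun t => RtoC (ln (w t))).
Proof.
intros Hw x e He.
assert (H1 : forall y, Cmod (RtoC 1 * cis y) = 1%R) by (intros; apply Cmod_polar; lra).
destruct (weight_continuous w _ Hw (H1 x) e He) as (d & Hd & K).
generalize (rcont_polar 1 x d Hd); apply filter_imp; intros y Hy.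
rewrite <- RtoC_minus, Cmod_R; now apply K.
Qed.

Lemma szego_cmean w z :
  szego w z = Cexp (/ 2 * cmean 1 (fun t => RtoC (ln (w t)) * ((t + z) / (t - z)))).
Proof.
unfold szego, cmean; f_equal.
rewrite (CRInt_ext (fun x => RtoC (ln (w (RtoC 1 * cis x))) *
  ((RtoC 1 * cis x + z) / (RtoC 1 * cis x - z)))
  (fun x => RtoC (ln (w (cis x))) * ((cis x + z) / (cis x - z)))).
- replace (4 * PI)%R with (2 * (2 * PI))%R by ring.
  rewrite (RtoC_mult 2 (2 * PI)); field; apply two_PI_neq.
- apply two_PI_pos.
- intros x _; now rewrite Cmult_1_l.
Qed.

Lemma circ_cont_szego_integrand w z :
  analytic_weight w -> Cmod z <> 1%R ->
  circ_cont 1 (fun t => RtoC (ln (w t)) * ((t + z) / (t - z))).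
Proof.
intros Hw Hz; apply circ_cont_mult; [now apply log_weight_cont|].
now apply circ_cont_szego_kernel.
Qed.

(** On the unit circle log w is real and the kernel turns into minus its conjugate under z -> 1 /
    Cconj z, so the exponent does the same. *)
Lemma szego_reflect w z :
  analytic_weight w -> (1 < Cmod z)%R -> szego w z = Cconj (/ szego w (/ Cconj z)).
Proof.
intros Hw Hz.
assert (Hz0 : z <> 0) by (apply Cmod_gt_0; lra).
assert (Hy : (Cmod (/ Cconj z) < 1)%R).
{ rewrite Cmod_inv, Cmod_conj by (apply Cmod_gt_0; rewrite Cmod_conj; lra).
  rewrite <- Rinv_1; apply Rinv_lt_contravar; lra. }
rewrite !szego_cmean, Cinv_Cexp, Cconj_Cexp; f_equal.
rewrite Copp_conj, Cmult_conj, <- cmean_conj by (apply circ_cont_szego_integrand; [assumption|lra]).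
assert (Cconj (/ 2) = / 2) as ->.
{ rewrite Cconj_inv; f_equal; apply Cconj_R. }
rewrite (cmean_ext 1 (fun t => Cconj _)
  (fun t => - (1) * (RtoC (ln (w t)) * ((t + z) / (t - z))))).
- rewrite cmean_scal by (apply circ_cont_szego_integrand; [assumption|lra]); ring.
- lra.
- intros t Ht; rewrite Cmult_conj, Cconj_R, szego_kernel_conj; try assumption.
  + ring.
  + apply circ_neq with 1%R; lra.
Qed.

Lemma szego_0 w : analytic_weight w -> / szego w 0 = RtoC (tau w).
Proof.
intros Hw; rewrite szego_cmean, Cinv_Cexp.
rewrite (cmean_ext 1 _ (fun t => RtoC (ln (w t)))).
2: lra.
2: { intros t Ht; destruct (unit_conj t Ht) as [Ht0 _].
  replace ((t + 0) / (t - 0)) with (RtoC 1); [ring|].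
  replace (t - 0) with t by ring; field; assumption. }
unfold cmean; rewrite (CRInt_ext _ (fun x => RtoC (ln (w (cis x)))))
  by (apply two_PI_pos || intros x _; now rewrite Cmult_1_l).
assert (Cl : rcont_on (fun x => RtoC (ln (w (cis x)))) 0 (2 * PI)).
{ intros x _; pose proof (log_weight_cont w Hw x) as H; unfold rcont in *.
  rewrite Cmult_1_l in H; apply climit_ext with (2 := H); intros y; now rewrite Cmult_1_l. }
assert (HR : CRInt (fun x => RtoC (ln (w (cis x)))) 0 (2 * PI) =
  RtoC (RInt (fun x => ln (w (cis x))) 0 (2 * PI))).
{ pose proof (is_CRInt _ _ _ two_PI_pos Cl) as H; apply is_CRInt_pair in H as [H1 H2].
  set (I := CRInt (fun x => RtoC (ln (w (cis x)))) 0 (2 * PI)) in *.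
  apply injective_projections.
  - symmetry; apply is_RInt_unique, H1.
  - apply (is_RInt_unique (V := R_CompleteNormedModule)) in H2.
    change (Im I = 0%R); rewrite <- H2; simpl.
    rewrite RInt_const; unfold scal; simpl; unfold mult; simpl; ring. }
rewrite HR.
replace (- (/ 2 * (RtoC (RInt (fun x => ln (w (cis x))) 0 (2 * PI)) / RtoC (2 * PI)))) with
  (RtoC (- (/ (4 * PI) * RInt (fun theta => ln (w (cis theta))) 0 (2 * PI)))).
- unfold Cexp, tau; rewrite re_RtoC, im_RtoC, cis_0; ring.
- replace (4 * PI)%R with (2 * (2 * PI))%R by ring.
  pose proof PI_RGT_0.
  rewrite RtoC_opp, RtoC_mult, RtoC_inv, (RtoC_mult 2 (2 * PI)) by lra.
  field; apply two_PI_neq.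
Qed.

Section Szego.
Variables (w : C -> R) (Di De : C -> C) (r : R).
Hypotheses (Hw : analytic_weight w) (HDi : is_szego_i w Di) (HDe : is_szego_e w De).
Hypothesis Hr : (rho w < r < 1)%R.

Lemma szego_radius : (0 < r < 1)%R.
Proof. pose proof (rho_ge_0 w); lra. Qed.

Lemma inv_Di_cdiff z : (Cmod z <= / r)%R -> cdiff (fun z => / Di z) z.
Proof.
intros Hz; apply ex_derive_cdiff, HDi.
pose proof szego_radius; pose proof (rho_ge_0 w).
apply Rle_lt_trans with (rho w * / r)%R; [now apply Rmult_le_compat_l|].
apply Rmult_lt_reg_r with r; [lra|]; rewrite Rmult_assoc, Rinv_l; lra.
Qed.

Lemma De_cdiff z : (r <= Cmod z)%R -> cdiff De z.
Proof. intros Hz; apply ex_derive_cdiff, HDe; lra. Qed.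

Lemma inv_Di_neq_0 z : (Cmod z < 1)%R -> / Di z <> 0.
Proof.
intros Hz; rewrite (proj1 HDi z Hz), szego_cmean, Cinv_Cexp; apply Cexp_neq_0.
Qed.

Lemma inv_Di_0 : / Di 0 = RtoC (tau w).
Proof. rewrite (proj1 HDi 0) by (rewrite Cmod_0; lra); now apply szego_0. Qed.

Lemma De_reflect z : (1 < Cmod z)%R -> De z = Cconj (/ Di (/ Cconj z)).
Proof.
intros Hz; rewrite (proj1 HDe z Hz), (szego_reflect w z) by assumption.
do 2 f_equal; symmetry; apply (proj1 HDi).
rewrite Cmod_inv, Cmod_conj by (apply Cmod_gt_0; rewrite Cmod_conj; lra).
rewrite <- Rinv_1; apply Rinv_lt_contravar; lra.
Qed.

Lemma inv_r_gt_1 : (1 < / r)%R.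
Proof. pose proof szego_radius; rewrite <- Rinv_1; apply Rinv_lt_contravar; lra. Qed.

(** The reflection formula is available for |z| > 1 only. Both sides are continuous at the circle,
    so it is carried there by letting the radius decrease to 1. *)
Lemma De_circle z : Cmod z = 1%R -> De z = Cconj (/ Di z).
Proof.
intros Hz; destruct (unit_conj z Hz) as [Hz0 Hzc].
assert (L1 : climit (at_right 1) (fun s : R => RtoC s) 1).
{ intros e He; exists (mkposreal e He); intros s Hs _.
  rewrite <- RtoC_minus, Cmod_R; exact Hs. }
assert (F : Filter (at_right 1)) by apply at_right_proper_filter.
assert (L2 : climit (at_right 1) (fun s => RtoC s * z) z).
{ pose proof (climit_mult _ (fun _ => z) _ z L1 (climit_const z)) as H.
  now rewrite Cmult_1_l in H. }
assert (L3 : climit (at_right 1) (fun s => / RtoC s * z) z).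
{ pose proof (climit_mult _ (fun _ => z) _ z (climit_inv _ _ L1 C1_nz) (climit_const z)) as H.
  replace (/ 1 * z) with z in H by field; exact H. }
pose proof szego_radius; pose proof inv_r_gt_1.
apply (climit_unique (F := at_right 1) (fun s => De (RtoC s * z))).
- apply (climit_comp _ De); [apply cdiff_ccont, De_cdiff; lra|exact L2].
- apply climit_ext_loc with (fun s => Cconj (/ Di (/ RtoC s * z))).
  + exists (mkposreal 1 Rlt_0_1); intros s _ Hs.
    rewrite De_reflect by (rewrite Cmod_mult, Hz, Cmod_R, Rabs_pos_eq; lra).
    do 3 f_equal; rewrite Cmult_conj, Cconj_R, Hzc.
    field; split; [assumption|]; intros E; apply RtoC_inj in E; lra.
  + apply climit_conj, (climit_comp _ (fun z => / Di z)); [|exact L3].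
    apply cdiff_ccont, inv_Di_cdiff; lra.
Qed.

(** The factor 1/2 in the exponent of D disappears on squaring, leaving the Poisson integral of log
    w. *)
Lemma inv_Di_mod_inside z :
  (Cmod z < 1)%R -> / Di z * Cconj (/ Di z) =
  RtoC (exp (- Re (cmean 1 (fun t => RtoC (ln (w t)) * ((t + z) / (t - z)))%C))).
Proof.
intros Hz; rewrite <- Cmod2_conj, (proj1 HDi z Hz), szego_cmean, Cinv_Cexp, Cmod_Cexp.
set (I := cmean 1 _); rewrite <- Rsqr_pow2; unfold Rsqr; rewrite <- exp_plus.
do 2 f_equal.
assert (/ 2 * I = RtoC (/ 2) * I) as -> by (rewrite RtoC_inv by lra; reflexivity).
change (Re (- (RtoC (/ 2) * I))) with (- Re (RtoC (/ 2) * I))%R.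
rewrite re_scal_l; field.
Qed.

(** Radial limit from inside: [/ Di] is continuous up to the circle, and the Poisson integral of log
    w tends to log w. *)
Lemma inv_Di_mod_circle z : Cmod z = 1%R -> / Di z * Cconj (/ Di z) = / RtoC (w z).
Proof.
intros Hz; assert (Hwz : (0 < w z)%R) by now apply (proj1 Hw).
assert (F : Filter (at_left 1)) by apply at_left_proper_filter.
assert (L1 : climit (at_left 1) (fun s : R => RtoC s) 1).
{ intros e He; exists (mkposreal e He); intros s Hs _.
  rewrite <- RtoC_minus, Cmod_R; exact Hs. }
assert (L2 : climit (at_left 1) (fun s => RtoC s * z) z).
{ pose proof (climit_mult _ (fun _ => z) _ z L1 (climit_const z)) as H.
  now rewrite Cmult_1_l in H. }
pose proof inv_r_gt_1.
apply (climit_unique (F := at_left 1)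
  (fun s => / Di (RtoC s * z) * Cconj (/ Di (RtoC s * z)))).
- assert (L3 : climit (at_left 1) (fun s => / Di (RtoC s * z)) (/ Di z)).
  { apply (climit_comp _ (fun z => / Di z)); [|exact L2].
    apply cdiff_ccont, inv_Di_cdiff; lra. }
  apply climit_mult; [exact L3|now apply climit_conj].
- apply climit_ext_loc with (fun s => RtoC (exp (- Re (cmean 1
    (fun t => RtoC (ln (w t)) * ((t + RtoC s * z) / (t - RtoC s * z)))%C)))).
  + exists (mkposreal 1 Rlt_0_1); intros s Hs Hs1.
    change (Rabs (s - 1) < 1)%R in Hs; apply Rabs_def2 in Hs.
    rewrite inv_Di_mod_inside; [reflexivity|].
    rewrite Cmod_mult, Hz, Cmod_R, Rabs_pos_eq; lra.
  + intros e He.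
    assert (Ce : continuous (fun x => exp (- x)) (ln (w z))).
    { apply (ex_derive_continuous (V := R_NormedModule)); auto_derive; exact I. }
    destruct (proj1 (filterlim_locally _ _) Ce (mkposreal e He)) as [e' He'].
    assert (P : (0 < e' / 2)%R) by (pose proof (cond_pos e'); lra).
    destruct (poisson_limit (fun t => ln (w t)) z Hz (log_weight_cont w Hw)
      (weight_continuous w z Hw Hz) _ P) as (d & Hd & K).
    assert (Pd : (0 < Rmin d 1)%R) by (apply Rmin_pos; lra).
    exists (mkposreal _ Pd); intros s Hs Hs1.
    change (Rabs (s - 1) < Rmin d 1)%R in Hs; apply Rabs_def2 in Hs.
    pose proof (Rmin_l d 1); pose proof (Rmin_r d 1).
    specialize (K s ltac:(lra) ltac:(lra)).
    assert (Hx := He' (Re (cmean 1 (fun t => RtoC (ln (w t)) *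
      ((t + RtoC s * z) / (t - RtoC s * z)))))).
    assert (E : / RtoC (w z) = RtoC (exp (- ln (w z)))).
    { rewrite exp_Ropp, exp_ln, RtoC_inv by lra; reflexivity. }
    rewrite E, <- RtoC_minus, Cmod_R; apply Hx.
    eapply Rle_lt_trans; [exact K|]; lra.
Qed.

Lemma weight_circle z : Cmod z = 1%R -> RtoC (w z) = / (/ Di z * De z) /\ / Di z <> 0.
Proof.
intros Hz; assert (Hwz : (0 < w z)%R) by now apply (proj1 Hw).
assert (Hw0 : RtoC (w z) <> 0) by (intros E; apply RtoC_inj in E; lra).
pose proof (inv_Di_mod_circle z Hz) as H; split.
- rewrite De_circle, H by assumption; now rewrite Cinv_inv.
- intros E; rewrite E, Cmult_0_l in H; apply Hw0.
  rewrite <- (Cinv_inv (RtoC (w z))), <- H; apply Cinv_0.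
Qed.

End Szego.

(** * Orthogonal polynomials *)

Lemma cdiff_sum (b : nat -> C) (f : nat -> C -> C) n z :
  (forall k, cdiff (f k) z) ->
  cdiff (fun t => sum_n (G := C_AbelianMonoid) (fun k => b k * f k t) n) z.
Proof.
intros Hf; induction n as [|n IH].
- apply cdiff_ext with (fun t => b 0%nat * f 0%nat t).
  + intros t; now rewrite csum_0.
  + apply cdiff_mult; [apply cdiff_const|apply Hf].
- apply cdiff_ext with (fun t => sum_n (G := C_AbelianMonoid) (fun k => b k * f k t) n +
    b (S n) * f (S n) t).
  + intros t; now rewrite csum_S.
  + apply cdiff_plus; [exact IH|]; apply cdiff_mult; [apply cdiff_const|apply Hf].
Qed.

Lemma poly_val_cdiff c n z : cdiff (poly_val c n) z.
Proof. apply cdiff_sum; intros k; apply cdiff_pow, cdiff_id. Qed.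

Lemma monic_val_cdiff c n z : cdiff (monic_val c n) z.
Proof. apply cdiff_mult; [apply poly_val_cdiff|apply cdiff_const]. Qed.

(** The reversed monic polynomial Phi_n^*, that is z^n times the conjugate of Phi_n at 1 / Cconj z.
    The coefficient form makes it meaningful at 0, where it picks the leading coefficient. *)
Definition reversed_val (c : nat -> nat -> C) (n : nat) (z : C) : C :=
  sum_n (G := C_AbelianMonoid) (fun k => Cconj (c n k / c n n) * z ^ (n - k)) n.

Lemma reversed_val_cdiff c n z : cdiff (reversed_val c n) z.
Proof. apply cdiff_sum; intros k; apply cdiff_pow, cdiff_id. Qed.

Lemma reversed_val_circle c n t :
  Cmod t = 1%R -> reversed_val c n t = t ^ n * Cconj (monic_val c n t).
Proof.
intros Ht; destruct (unit_conj t Ht) as [Ht0 Htc].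
assert (H : forall m, (m <= n)%nat ->
  sum_n (G := C_AbelianMonoid) (fun k => Cconj (c n k / c n n) * t ^ (n - k)) m =
  t ^ n * Cconj (sum_n (G := C_AbelianMonoid) (fun k => c n k * t ^ k) m / c n n)).
{ assert (T : forall k, (k <= n)%nat ->
    Cconj (c n k / c n n) * t ^ (n - k) = t ^ n * Cconj (c n k * t ^ k / c n n)).
  { intros k Hk; unfold Cdiv; rewrite !Cmult_conj, Cpow_conj, Htc, Cpow_inv by assumption.
    replace (t ^ n) with (t ^ (n - k) * t ^ k)
      by (rewrite <- Cpow_add_r; f_equal; lia).
    field; now apply Cpow_nz. }
  induction m as [|m IH]; intros Hm.
  - rewrite !csum_0; apply T; lia.
  - rewrite !csum_S, IH, T by lia.
    rewrite <- Cmult_plus_distr_l, <- Cplus_conj; do 2 f_equal; unfold Cdiv; ring. }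
apply H; lia.
Qed.

Lemma reversed_val_0 (c : nat -> nat -> C) n : c n n <> 0 -> reversed_val c n 0 = 1.
Proof.
intros Hc; unfold reversed_val.
assert (H : forall m, (m < n)%nat ->
  (sum_n (G := C_AbelianMonoid) (fun k => Cconj (c n k / c n n) * 0 ^ (n - k)) m : C) = 0).
{ assert (T : forall k, (k < n)%nat -> Cconj (c n k / c n n) * 0 ^ (n - k) = 0).
  { intros k Hk; replace (n - k)%nat with (S (n - k - 1)) by lia; simpl; ring. }
  induction m as [|m IH]; intros Hm.
  - rewrite csum_0; apply T; lia.
  - rewrite csum_S, IH, T by lia; ring. }
assert (E : Cconj (c n n / c n n) * 0 ^ (n - n) = 1).
{ rewrite Nat.sub_diag; replace (c n n / c n n) with (RtoC 1) by (field; assumption).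
  rewrite Cconj_R; simpl; ring. }
destruct n as [|n]; [now rewrite csum_0|].
rewrite csum_S, H, E by lia; ring.
Qed.

Lemma lead_coef_neq_0 w (c : nat -> nat -> C) n : orthonormal_polynomials w c -> c n n <> 0.
Proof.
intros [H _] E; destruct (H n) as [_ P]; rewrite E in P; simpl in P; lra.
Qed.

(** Triangularity: each power t^j is recovered from the j-th polynomial and lower powers, because
    the leading coefficient is nonzero. [Q] covers all k <= j so that the lower powers are known to
    drop out. *)
Lemma orthogonal_pow w c N :
  orthonormal_polynomials w c -> circ_cont 1 (fun t => RtoC (w t)) ->
  forall j, (j < N)%nat ->
  cmean 1 (fun t => poly_val c N t * Cconj (t ^ j) * RtoC (w t)) = 0.
Proof.
intros Hop Cw.
set (ip := fun g : C -> C => cmean 1 (fun t => poly_val c N t * Cconj (g t) * RtoC (w t))).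
assert (Cp : forall m, circ_cont 1 (poly_val c m))
  by (intros m; apply cdiff_circ; [lra|intros; apply poly_val_cdiff]).
assert (Cip : forall g, circ_cont 1 g ->
  circ_cont 1 (fun t => poly_val c N t * Cconj (g t) * RtoC (w t))).
{ intros g Hg; apply circ_cont_mult; [|assumption].
  apply circ_cont_mult; [apply Cp|now apply circ_cont_conj]. }
assert (Ct : forall k, circ_cont 1 (fun t => t ^ k))
  by (intros k; apply circ_cont_pow, circ_cont_id).
assert (ip_ext : forall f g, (forall t : C, f t = g t) -> ip f = ip g).
{ intros f g E; unfold ip; apply cmean_ext; [lra|]; intros t _; now rewrite E. }
assert (ip_scal : forall b g, circ_cont 1 g -> ip (fun t => b * g t) = Cconj b * ip g).
{ intros b g Hg; unfold ip; rewrite <- cmean_scal by now apply Cip.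
  apply cmean_ext; [lra|]; intros t _; rewrite Cmult_conj; ring. }
assert (ip_plus : forall f g, circ_cont 1 f -> circ_cont 1 g ->
  ip (fun t => f t + g t) = ip f + ip g).
{ intros f g Hf Hg; unfold ip; rewrite <- cmean_plus by now apply Cip.
  apply cmean_ext; [lra|]; intros t _; rewrite Cplus_conj; ring. }
assert (Csum : forall b m,
  circ_cont 1 (fun t => sum_n (G := C_AbelianMonoid) (fun k => b k * t ^ k) m)).
{ intros b m; apply cdiff_circ; [lra|]; intros z _; apply cdiff_sum; intros k.
  apply cdiff_pow, cdiff_id. }
assert (ip_sum : forall b m, (forall k, (k <= m)%nat -> ip (fun t => t ^ k) = 0) ->
  ip (fun t => sum_n (G := C_AbelianMonoid) (fun k => b k * t ^ k) m) = 0).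
{ intros b m Hm; induction m as [|m IH].
  - transitivity (ip (fun t => b 0%nat * t ^ 0)).
    + apply ip_ext; intros t; apply csum_0.
    + rewrite ip_scal, Hm by (apply Ct || lia); ring.
  - transitivity (ip (fun t => sum_n (G := C_AbelianMonoid) (fun k => b k * t ^ k) m +
      b (S m) * t ^ S m)).
    + apply ip_ext; intros t; apply csum_S.
    + rewrite ip_plus, ip_scal, Hm, IH; try (apply Ct || apply Csum || lia); [ring| |].
      * intros k Hk; apply Hm; lia.
      * apply circ_cont_mult; [apply circ_cont_const|apply Ct]. }
assert (ip_poly : forall j, (j < N)%nat -> ip (poly_val c j) = 0).
{ intros j Hj; destruct Hop as [_ H]; specialize (H N j).
  assert (E : Nat.eqb N j = false) by (apply Nat.eqb_neq; lia).
  rewrite E in H; unfold ip, cmean.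
  rewrite (CRInt_ext _ (fun theta => poly_val c N (cis theta) *
    Cconj (poly_val c j (cis theta)) * RtoC (w (cis theta)))).
  - rewrite H; unfold Cdiv; ring.
  - apply two_PI_pos.
  - intros x _; now rewrite Cmult_1_l. }
assert (Hcj : forall j, Cconj (c j j) <> 0).
{ intros j; apply Cmod_gt_0; rewrite Cmod_conj; apply Cmod_gt_0.
  now apply (lead_coef_neq_0 w). }
assert (Z : forall a b : C, a <> 0 -> a * b = 0 -> b = 0).
{ intros a b Ha Hab; replace b with (/ a * (a * b)) by (field; assumption).
  rewrite Hab; ring. }
assert (Q : forall j, (j < N)%nat -> forall k, (k <= j)%nat -> ip (fun t => t ^ k) = 0).
{ induction j as [|j IH]; intros Hj k Hk.
  - apply (Z (Cconj (c 0%nat 0%nat))); [apply Hcj|].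
    rewrite <- ip_scal by apply Ct; rewrite <- (ip_poly 0%nat Hj).
    replace k with 0%nat by lia; apply ip_ext; intros t; symmetry; apply csum_0.
  - destruct (Nat.eq_dec k (S j)) as [->|Hne]; [|apply IH; lia].
    apply (Z (Cconj (c (S j) (S j)))); [apply Hcj|].
    rewrite <- ip_scal by apply Ct.
    pose proof (ip_poly (S j) Hj) as Hp.
    assert (E : ip (poly_val c (S j)) =
      ip (fun t => sum_n (G := C_AbelianMonoid) (fun k => c (S j) k * t ^ k) j +
        c (S j) (S j) * t ^ S j)).
    { apply ip_ext; intros t; apply csum_S. }
    rewrite E, ip_plus, ip_sum in Hp; [|apply IH; lia|apply Csum|].
    + rewrite <- Hp; ring.
    + apply circ_cont_mult; [apply circ_cont_const|apply Ct]. }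
intros j Hj; exact (Q j Hj j (Nat.le_refl j)).
Qed.

(** One factor t is split off at a time: the moment of order N of u = t^N p is the mean of p, and
    once it vanishes the backward shift divides p by t. *)
Lemma disk_factor u N :
  disk_alg u -> (forall j, (j < N)%nat -> cmean 1 (fun t => u t * Cconj (t ^ j)) = 0) ->
  exists p, disk_alg p /\ forall t, Cmod t = 1%R -> u t = t ^ N * p t.
Proof.
intros Hu; induction N as [|N IH]; intros H.
- exists u; split; [assumption|]; intros t _; simpl; ring.
- destruct IH as (p & Hp & E); [intros j Hj; apply H; lia|].
  exists (fun t => (p t - cmean 1 p) / t); split; [now apply disk_shift|].
  assert (H0 : cmean 1 p = 0).
  { rewrite <- (H N) by lia; apply cmean_ext; [lra|]; intros t Ht.
    destruct (unit_conj t Ht) as [Ht0 Htc].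
    rewrite E, Cpow_conj, Htc, Cpow_inv by assumption.
    field; now apply Cpow_nz. }
  intros t Ht; destruct (unit_conj t Ht) as [Ht0 _].
  rewrite E, H0 by assumption; simpl; field; assumption.
Qed.

Section Exact.
Variables (w : C -> R) (c : nat -> nat -> C) (Di De : C -> C) (r : R) (N : nat).
Hypotheses (Hw : analytic_weight w) (HDi : is_szego_i w Di) (HDe : is_szego_e w De).
Hypotheses (Hr : (rho w < r < 1)%R) (Hc : orthonormal_polynomials w c).

(** Inside the disc [/ Di] is an exponential, and on the circle its squared modulus is 1/w. Both
    give zero-freeness on a compact set, with a margin by uniform continuity; reflection transfers
    this to [De]. *)
Lemma szego_annulus : exists R, (1 < R < / r)%R /\
  (forall z, (Cmod z <= R)%R -> / Di z <> 0) /\ (forall z, (/ R <= Cmod z)%R -> De z <> 0).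
Proof.
pose proof (szego_radius w r Hr); pose proof (inv_r_gt_1 w r Hr).
destruct (nonzero_near_circle (fun z => / Di z) r (/ r)) as (d1 & Hd1 & K1); try lra.
{ intros z Hz; apply cdiff_ccont, (inv_Di_cdiff w Di r); tauto || lra. }
{ intros z Hz; now apply (weight_circle w Di De r). }
destruct (nonzero_near_circle De r (/ r)) as (d2 & Hd2 & K2); try lra.
{ intros z Hz; apply cdiff_ccont, (De_cdiff w De r); tauto || lra. }
{ intros z Hz; rewrite (De_circle w Di De r) by assumption.
  apply Cmod_gt_0; rewrite Cmod_conj; apply Cmod_gt_0.
  now apply (weight_circle w Di De r). }
(* With R = 1 + eta / 2, the product (1 - eta / 2) R is below 1, so the inner radius 1/R stays
   within the margin as well. *)
set (eta := Rmin (/ r - 1) (Rmin d1 d2)).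
assert (He : (0 < eta)%R) by (apply Rmin_pos; [lra|now apply Rmin_pos]).
assert (He1 : (eta <= / r - 1 /\ eta <= d1 /\ eta <= d2)%R).
{ unfold eta; repeat split; [apply Rmin_l
    |eapply Rle_trans; [apply Rmin_r|apply Rmin_l]
    |eapply Rle_trans; [apply Rmin_r|apply Rmin_r]]. }
set (R := (1 + eta / 2)%R).
assert (HR : (1 < R < / r)%R) by (unfold R; lra).
exists R; split; [assumption|]; split; intros z Hz.
- destruct (Rlt_le_dec (Cmod z) 1) as [Hz1|Hz1]; [now apply (inv_Di_neq_0 w)|].
  apply K1; [lra|]; unfold R in Hz; rewrite Rabs_pos_eq; lra.
- destruct (Rlt_le_dec 1 (Cmod z)) as [Hz1|Hz1].
  + rewrite (De_reflect w Di De) by assumption.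
    apply Cmod_gt_0; rewrite Cmod_conj; apply Cmod_gt_0, (inv_Di_neq_0 w); [assumption|].
    assert (Hz0 : Cconj z <> 0) by (apply Cmod_gt_0; rewrite Cmod_conj; lra).
    rewrite Cmod_inv, Cmod_conj by assumption.
    rewrite <- Rinv_1; apply Rinv_lt_contravar; lra.
  + assert (HR1 : (1 - eta / 2 < / R)%R).
    { apply Rmult_lt_reg_r with R; [lra|]; rewrite Rinv_l by lra; unfold R; nra. }
    assert (HR2 : (r < / R)%R).
    { rewrite <- (Rinv_inv r); apply Rinv_lt_contravar; [|lra].
      apply Rmult_lt_0_compat; lra. }
    apply K2; [lra|]; rewrite Rabs_left1; lra.
Qed.

Lemma weight_circ_cont : circ_cont 1 (fun t => RtoC (w t)).
Proof.
pose proof (szego_radius w r Hr); pose proof (inv_r_gt_1 w r Hr).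
apply circ_cont_ext with (fun t => / (/ Di t * De t)); [lra| |].
- intros t Ht; symmetry; now apply (weight_circle w Di De r).
- apply circ_cont_inv; [lra| |].
  + intros t Ht; apply Cmult_neq_0; [now apply (weight_circle w Di De r)|].
    rewrite (De_circle w Di De r) by assumption.
    apply Cmod_gt_0; rewrite Cmod_conj; apply Cmod_gt_0.
    now apply (weight_circle w Di De r).
  + apply circ_cont_mult; apply cdiff_circ; try lra; intros z Hz.
    * apply (inv_Di_cdiff w Di r); tauto || lra.
    * apply (De_cdiff w De r); tauto || lra.
Qed.

(** On the annulus between 1/R and R, Phi_N w continues to Phi_N / (E * De), with E = [/ Di].
    Cauchy's formula splits it into u and q, and orthogonality to 1, ..., t^(N-1) makes u divisible
    by t^N. *)
Lemma monic_weight_split :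
  exists p q, disk_alg p /\ disk_neg q /\ forall t, Cmod t = 1%R ->
    monic_val c N t * RtoC (w t) = t ^ N * p t + q t.
Proof.
pose proof (szego_radius w r Hr).
destruct szego_annulus as (R & HR & HE & HD).
assert (HR' : (0 < / R < 1)%R).
{ split; [apply Rinv_0_lt_compat; lra|]; rewrite <- Rinv_1; apply Rinv_lt_contravar; lra. }
assert (HrR : (r < / R)%R).
{ rewrite <- (Rinv_inv r); apply Rinv_lt_contravar; [|lra].
  apply Rmult_lt_0_compat; lra. }
set (g := fun t => monic_val c N t * / (/ Di t * De t)).
assert (Hg : forall z, (/ R <= Cmod z <= R)%R -> cdiff g z).
{ intros z Hz; apply cdiff_mult; [apply monic_val_cdiff|apply cdiff_inv].
  - apply cdiff_mult; [apply (inv_Di_cdiff w Di r)|apply (De_cdiff w De r)]; tauto || lra.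
  - apply Cmult_neq_0; [apply HE|apply HD]; lra. }
assert (Cg : forall s, (/ R <= s <= R)%R -> circ_cont s g).
{ intros s Hs; apply cdiff_circ; [lra|]; intros z Hz; apply Hg; lra. }
set (u := cauchy_int R g); set (q := fun z => - (1) * cauchy_int (/ R) g z).
assert (Hu : disk_alg u) by (apply cauchy_int_disk; [lra|apply Cg; lra]).
assert (Hq : disk_neg q).
{ apply disk_neg_scal, cauchy_int_neg; [assumption|apply Cg; lra]. }
assert (Hs : forall t, Cmod t = 1%R -> monic_val c N t * RtoC (w t) = u t + q t).
{ intros t Ht; rewrite (proj1 (weight_circle w Di De r Hw HDi HDe Hr t Ht)).
  change (g t = u t + q t); rewrite (cauchy_formula g (/ R) R) by (assumption || lra).
  unfold u, q; ring. }
destruct (disk_factor u N Hu) as (p & Hp & E).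
- intros j Hj.
  assert (Cu : circ_cont 1 (fun t => u t * Cconj (t ^ j))).
  { apply circ_cont_mult; [now apply disk_circ_cont|].
    apply circ_cont_conj, circ_cont_pow, circ_cont_id. }
  assert (Cq : circ_cont 1 (fun t => t ^ j * Cconj (q t))).
  { apply circ_cont_mult; [apply circ_cont_pow, circ_cont_id|].
    now apply circ_cont_conj, disk_neg_circ_cont. }
  assert (Cw : circ_cont 1 (fun t => poly_val c N t * Cconj (t ^ j) * RtoC (w t))).
  { apply circ_cont_mult; [|apply weight_circ_cont].
    apply circ_cont_mult; [apply cdiff_circ; [lra|intros; apply poly_val_cdiff]|].
    apply circ_cont_conj, circ_cont_pow, circ_cont_id. }
  (* The moments of u are those of Phi_N w, zero by orthogonality, minus those of q, zero because q
     has negative frequencies only. *)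
  transitivity (/ c N N * cmean 1 (fun t => poly_val c N t * Cconj (t ^ j) * RtoC (w t)) -
    Cconj (cmean 1 (fun t => t ^ j * Cconj (q t)))).
  + rewrite <- cmean_scal, <- cmean_conj, <- cmean_minus; try assumption.
    * apply cmean_ext; [lra|]; intros t Ht; specialize (Hs t Ht).
      rewrite Cmult_conj, Cconj_conj.
      replace (u t) with (monic_val c N t * RtoC (w t) - q t) by (rewrite Hs; ring).
      unfold monic_val, Cdiv; ring.
    * apply circ_cont_mult; [apply circ_cont_const|assumption].
    * now apply circ_cont_conj.
  + rewrite (orthogonal_pow w), disk_neg_orth; try assumption.
    * rewrite Cconj_R; ring.
    * apply disk_pow.
    * apply weight_circ_cont.
- exists p, q; repeat split; try assumption.
  intros t Ht; rewrite Hs, E by assumption; reflexivity.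
Qed.

End Exact.

(** * The iterated operators *)

Lemma climit_lim {T} (F : (T -> Prop) -> Prop) {FF : ProperFilter F} (f : T -> C) (l : C) :
  climit F f l -> lim (T := C_CompleteNormedModule) (filtermap f F) = l.
Proof.
intros H.
assert (Hc : cauchy (T := C_CompleteNormedModule) (filtermap f F)).
{ intros e; exists l; unfold filtermap.
  generalize (H e (cond_pos e)); apply filter_imp; intros x Hx.
  apply C_NormedModule_mixin_compat1; exact Hx. }
assert (FP : ProperFilter (filtermap f F)) by now apply filtermap_proper_filter.
assert (Hl : climit F f (lim (T := C_CompleteNormedModule) (filtermap f F))).
{ intros e He.
  (* Balls of the product structure are squares; the side is shrunk by sqrt 2 so that the square
     lies in the disc of radius e. *)
  assert (Hs : (0 < sqrt 2)%R) by (apply sqrt_lt_R0; lra).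
  assert (P : (0 < e / sqrt 2)%R) by now apply Rdiv_lt_0_compat.
  pose proof (complete_cauchy (T := C_CompleteNormedModule) _ FP Hc (mkposreal _ P)) as K.
  unfold filtermap in K at 1; revert K; apply filter_imp; intros x Hx.
  apply C_NormedModule_mixin_compat2 in Hx; simpl in Hx.
  replace e with (sqrt 2 * (e / sqrt 2))%R by (field; lra); exact Hx. }
exact (climit_unique f _ _ Hl H).
Qed.

Lemma is_series_climit (a : nat -> C) (l : C) :
  is_series (V := C_NormedModule) a l ->
  climit eventually (sum_n (G := C_AbelianMonoid) a) l.
Proof.
intros H e He.
assert (Hs : (0 < sqrt 2)%R) by (apply sqrt_lt_R0; lra).
assert (P : (0 < e / sqrt 2)%R) by now apply Rdiv_lt_0_compat.
generalize (proj1 (filterlim_locally (U := C_NormedModule) _ _) H (mkposreal _ P)).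
apply filter_imp; intros x Hx.
apply C_NormedModule_mixin_compat2 in Hx; simpl in Hx.
replace e with (sqrt 2 * (e / sqrt 2))%R by (field; lra); exact Hx.
Qed.

(** Each operator will only be applied to a function continuous across its circle of integration, so
    the one-sided boundary value is the ordinary value. *)
Lemma ext_bv_ccont s f t : (0 < s)%R -> Cmod t = s -> ccont f t -> ext_bv s f t = f t.
Proof.
intros Hs Ht Hf; unfold ext_bv.
set (F := within (fun z => (s < Cmod z)%R) (locally (T := C_UniformSpace) t)).
assert (FF : Filter F) by (apply within_filter, locally_filter).
assert (FP : ProperFilter F).
{ split; [|exact FF]; intros P HP.
  assert (HP' : cnear t (fun z => (s < Cmod z)%R -> P z)) by now apply locally_C.
  destruct (cnear_elim _ _ HP') as (d & Hd & K).
  (* Moving t outward along its ray by d / 2 gives an exterior point in any neighbourhood, so the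
     restricted filter is proper. *)
  exists (RtoC (1 + d / (2 * s)) * t); apply K.
  - replace (RtoC (1 + d / (2 * s)) * t - t) with (RtoC (d / (2 * s)) * t)
      by (rewrite RtoC_plus; ring).
    assert (0 < d / (2 * s))%R by (apply Rdiv_lt_0_compat; lra).
    rewrite Cmod_mult, Ht, Cmod_R, Rabs_pos_eq by lra.
    replace (d / (2 * s) * s)%R with (d / 2)%R by (field; lra); lra.
  - assert (0 < d / (2 * s))%R by (apply Rdiv_lt_0_compat; lra).
    rewrite Cmod_mult, Ht, Cmod_R, Rabs_pos_eq by lra; nra. }
apply (climit_lim F).
intros e He; specialize (Hf e He); apply locally_C in Hf.
unfold F, within; revert Hf; apply filter_imp; auto.
Qed.

(** The factor t in the kernel of [cauchy_int] is the one in dt = i t dtheta. *)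
Lemma circle_int_kernel s (f g : C -> C) z :
  (0 < s)%R -> Cmod z <> s -> circ_cont s f ->
  (forall t, Cmod t = s -> g t = f t / (t - z)) ->
  circle_int s g = RtoC (2 * PI) * Ci * cauchy_int s f z.
Proof.
intros Hs Hz Hf E; unfold circle_int, cauchy_int, cmean.
assert (Ck : circ_cont s (fun t => f t * (t / (t - z))))
  by (apply circ_cont_mult; [assumption|apply circ_cont_kernel; lra]).
rewrite (CRInt_ext _ (fun x => Ci *
  (f (RtoC s * cis x) * ((RtoC s * cis x) / (RtoC s * cis x - z))))).
- rewrite CRInt_scal by (apply two_PI_pos || exact (circ_cont_on s _ _ _ Ck)).
  field; apply two_PI_neq.
- apply two_PI_pos.
- intros x _; cbv zeta; rewrite E by (apply Cmod_polar; lra); unfold Cdiv; ring.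
Qed.

Lemma tau_neq_0 w : RtoC (tau w) <> 0.
Proof.
intros E; apply RtoC_inj in E; revert E; unfold tau; apply Rgt_not_eq, exp_pos.
Qed.

Lemma two_PI_Ci : 2 * RtoC PI * Ci = RtoC (2 * PI) * Ci.
Proof. rewrite RtoC_mult; reflexivity. Qed.

Lemma Mi_cauchy w F r n f z :
  (0 < r)%R -> Cmod z <> r -> (forall t, Cmod t = r -> ccont f t) -> circ_cont r F ->
  Mi w F r n f z =
  - / RtoC (tau w) ^ 2 * cauchy_int r (fun t => f t * (F t * t ^ n)) z.
Proof.
intros Hr Hz Hf HF; unfold Mi.
rewrite (circle_int_kernel r (fun t => f t * (F t * t ^ n)) _ z).
- rewrite two_PI_Ci; pose proof (tau_neq_0 w); pose proof two_PI_neq; pose proof Ci_nz.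
  field; repeat split; assumption.
- assumption.
- assumption.
- apply circ_cont_mult; [apply ccont_circ; [lra|assumption]|].
  apply circ_cont_mult; [assumption|apply circ_cont_pow, circ_cont_id].
- intros t Ht; rewrite ext_bv_ccont by (assumption || now apply Hf); unfold Cdiv; ring.
Qed.

(** Continuity is asked of 1/F, not of F, which may have poles on this circle. *)
Lemma Me_cauchy w F r n f z :
  (0 < r)%R -> (Cmod z <> / r)%R -> (forall t, (Cmod t = / r)%R -> ccont f t) ->
  circ_cont (/ r) (fun t => / F t) ->
  Me w F r n f z =
  RtoC (tau w) ^ 2 * cauchy_int (/ r) (fun t => f t * / (F t * t ^ n)) z.
Proof.
intros Hr Hz Hf HF; unfold Me.
assert (Hr' : (0 < / r)%R) by now apply Rinv_0_lt_compat.
rewrite (circle_int_kernel (/ r) (fun t => f t * / (F t * t ^ n)) _ z).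
- rewrite two_PI_Ci; pose proof two_PI_neq; pose proof Ci_nz.
  field; repeat split; assumption.
- assumption.
- assumption.
- apply circ_cont_mult; [apply ccont_circ; [lra|assumption]|].
  apply circ_cont_ext with (fun t => / F t * / t ^ n); [lra|intros; now rewrite Cinv_mul|].
  apply circ_cont_mult; [assumption|].
  apply circ_cont_inv; [lra| |apply circ_cont_pow, circ_cont_id].
  intros t Ht; apply Cpow_nz, Cmod_gt_0; lra.
- intros t Ht; rewrite ext_bv_ccont by (assumption || now apply Hf).
  unfold Cdiv; rewrite !Cinv_mul; ring.
Qed.

(** * The iterates on the unit circle and the exact solution *)

Section Main.
Variables (w : C -> R) (c : nat -> nat -> C) (Di De : C -> C) (r : R) (N : nat).
Hypotheses (Hw : analytic_weight w) (HDi : is_szego_i w Di) (HDe : is_szego_e w De).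
Hypotheses (Hr : (rho w < r < 1)%R) (Hc : orthonormal_polynomials w c).

Let E := fun z => / Di z.
Let F := calF Di De.
Let f k := fseq w F r N k.
Let S t := t ^ N * (Cconj (E t) / E t).

Lemma calF_div t : F t = De t / E t.
Proof. unfold F, calF, E, Cdiv; rewrite Cinv_inv; ring. Qed.

Lemma fseq_odd k : f (2 * k + 1) = Mi w F r N (f (2 * k)).
Proof.
unfold f; rewrite Nat.add_1_r; cbn [fseq].
now rewrite Nat.even_mul.
Qed.

Lemma fseq_even k : f (2 * Datatypes.S k) = Me w F r N (f (2 * k + 1)).
Proof.
unfold f; replace (2 * Datatypes.S k)%nat with (Datatypes.S (2 * k + 1)) by lia.
cbn [fseq]; now rewrite Nat.even_add, Nat.even_mul.
Qed.

Lemma radii : (0 < r < 1)%R /\ (1 < / r)%R.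
Proof. split; [now apply (szego_radius w)|now apply (inv_r_gt_1 w)]. Qed.

Lemma E_cdiff z : (Cmod z <= / r)%R -> cdiff E z.
Proof. now apply (inv_Di_cdiff w Di r). Qed.

Lemma D_cdiff z : (r <= Cmod z)%R -> cdiff De z.
Proof. now apply (De_cdiff w De r). Qed.

Lemma calF_circ_cont : circ_cont r F.
Proof.
destruct radii; destruct (szego_annulus w Di De r Hw HDi HDe Hr) as (R & HR & HE & _).
apply cdiff_circ; [lra|]; intros z Hz.
apply cdiff_ext with (fun t => De t / E t); [intros; now rewrite calF_div|].
apply cdiff_mult; [apply D_cdiff; lra|apply cdiff_inv; [apply E_cdiff; lra|apply HE; lra]].
Qed.

Lemma inv_calF_circ_cont : circ_cont (/ r) (fun t => / F t).
Proof.
destruct radii; destruct (szego_annulus w Di De r Hw HDi HDe Hr) as (R & HR & _ & HD).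
assert (/ R < 1)%R by (rewrite <- Rinv_1; apply Rinv_lt_contravar; lra).
apply cdiff_circ; [lra|]; intros z Hz.
apply cdiff_ext with (fun t => E t * / De t).
{ intros t; rewrite calF_div; unfold Cdiv; rewrite Cinv_mul, Cinv_inv; ring. }
apply cdiff_mult; [apply E_cdiff; lra|apply cdiff_inv; [apply D_cdiff; lra|apply HD; lra]].
Qed.

Lemma symbol_calF t : Cmod t = 1%R -> S t = F t * t ^ N.
Proof.
intros Ht; unfold S; rewrite calF_div.
rewrite (De_circle w Di De r Hw HDi HDe Hr t Ht); unfold E; ring.
Qed.

Lemma fseq_odd_cauchy k z :
  (forall t, (Cmod t < / r)%R -> cdiff (f (2 * k)) t) -> Cmod z <> r ->
  f (2 * k + 1) z = - / RtoC (tau w) ^ 2 *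
    cauchy_int r (fun t => f (2 * k) t * (F t * t ^ N)) z.
Proof.
intros H Hz; destruct radii; rewrite fseq_odd; apply Mi_cauchy; try lra.
- intros t Ht; apply cdiff_ccont, H; lra.
- apply calF_circ_cont.
Qed.

Lemma fseq_even_integrand_cont k :
  (forall t, (Cmod t < / r)%R -> cdiff (f (2 * k)) t) ->
  circ_cont r (fun t => f (2 * k) t * (F t * t ^ N)).
Proof.
intros H; destruct radii.
apply circ_cont_mult; [apply cdiff_circ; [lra|intros z Hz; apply H; lra]|].
apply circ_cont_mult; [apply calF_circ_cont|apply circ_cont_pow, circ_cont_id].
Qed.

Lemma fseq_odd_cdiff k z :
  (forall t, (Cmod t < / r)%R -> cdiff (f (2 * k)) t) -> (r < Cmod z)%R ->
  cdiff (f (2 * k + 1)) z.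
Proof.
intros H Hz; destruct radii.
apply cdiff_ext_loc with (fun z => - / RtoC (tau w) ^ 2 *
  cauchy_int r (fun t => f (2 * k) t * (F t * t ^ N)) z).
- assert (P : (0 < Cmod z - r)%R) by lra.
  generalize (cnear_ball z _ P); apply filter_imp; intros t Ht.
  symmetry; apply fseq_odd_cauchy; [assumption|].
  rewrite Cmod_minus_sym in Ht; pose proof (Cmod_triangle_inv z t); lra.
- apply cdiff_mult; [apply cdiff_const|].
  apply cauchy_int_cdiff; [lra|lra|now apply fseq_even_integrand_cont].
Qed.

Lemma fseq_odd_integrand_cont k :
  (forall t, (Cmod t < / r)%R -> cdiff (f (2 * k)) t) ->
  circ_cont (/ r) (fun t => f (2 * k + 1) t * / (F t * t ^ N)).
Proof.
intros H; destruct radii.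
apply circ_cont_mult.
- apply cdiff_circ; [lra|intros z Hz; apply fseq_odd_cdiff; [assumption|lra]].
- apply circ_cont_ext with (fun t => / F t * / t ^ N); [lra|intros; now rewrite Cinv_mul|].
  apply circ_cont_mult; [apply inv_calF_circ_cont|].
  apply circ_cont_inv; [lra| |apply circ_cont_pow, circ_cont_id].
  intros t Ht; apply Cpow_nz, Cmod_gt_0; lra.
Qed.

Lemma fseq_even_cauchy k z :
  (forall t, (Cmod t < / r)%R -> cdiff (f (2 * k)) t) -> (Cmod z <> / r)%R ->
  f (2 * Datatypes.S k) z = RtoC (tau w) ^ 2 *
    cauchy_int (/ r) (fun t => f (2 * k + 1) t * / (F t * t ^ N)) z.
Proof.
intros H Hz; destruct radii; rewrite fseq_even; apply Me_cauchy; try lra.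
- intros t Ht; apply cdiff_ccont, fseq_odd_cdiff; [assumption|lra].
- apply inv_calF_circ_cont.
Qed.

(** The two parities feed each other: holomorphy of an even iterate in |z| < 1/r makes the next odd
    one a Cauchy integral over |t| = r, holomorphic outside; the following even one is then a Cauchy
    integral over |t| = 1/r. *)
Lemma fseq_even_cdiff k t : (Cmod t < / r)%R -> cdiff (f (2 * k)) t.
Proof.
revert t; induction k as [|k IH]; intros z Hz; [exact (cdiff_const (RtoC 1) z)|].
destruct radii.
apply cdiff_ext_loc with (fun z => RtoC (tau w) ^ 2 *
  cauchy_int (/ r) (fun t => f (2 * k + 1) t * / (F t * t ^ N)) z).
- assert (P : (0 < / r - Cmod z)%R) by lra.
  generalize (cnear_ball z _ P); apply filter_imp; intros t Ht.
  symmetry; apply fseq_even_cauchy; [assumption|].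
  pose proof (Cmod_triangle_inv t z); lra.
- apply cdiff_mult; [apply cdiff_const|].
  apply cauchy_int_cdiff; [lra|lra|now apply fseq_odd_integrand_cont].
Qed.

Lemma fseq_even_disk k : disk_alg (f (2 * k)).
Proof.
destruct radii; destruct (szego_annulus w Di De r Hw HDi HDe Hr) as (R & HR & _ & _).
apply cdiff_disk with R; [lra|]; intros z Hz; apply fseq_even_cdiff; lra.
Qed.

Let v k z := RtoC (tau w) ^ 2 * f (2 * k + 1) z.

Lemma v_cauchy k z : Cmod z <> r ->
  v k z = - (1) * cauchy_int r (fun t => f (2 * k) t * (F t * t ^ N)) z.
Proof.
intros Hz; unfold v; rewrite fseq_odd_cauchy by (assumption || apply fseq_even_cdiff).
pose proof (tau_neq_0 w); field; assumption.
Qed.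

Lemma fseq_odd_neg k : disk_neg (v k).
Proof.
destruct radii.
apply disk_neg_ext with
  (fun z => - (1) * cauchy_int r (fun t => f (2 * k) t * (F t * t ^ N)) z).
- intros t Ht; symmetry; apply v_cauchy; lra.
- apply disk_neg_scal, cauchy_int_neg; [lra|].
  apply fseq_even_integrand_cont, fseq_even_cdiff.
Qed.

(** Cauchy's formula between r and R: [v k] is minus the integral over the inner circle, so the
    difference is the integral over the outer one. Beyond the unit circle F is holomorphic only as
    far as E has no zero, whence R instead of 1/r. *)
Lemma fseq_even_odd k : disk_alg (fun t => S t * f (2 * k) t - v k t).
Proof.
destruct radii; destruct (szego_annulus w Di De r Hw HDi HDe Hr) as (R & HR & HE & _).
set (g := fun t => f (2 * k) t * (De t / E t * t ^ N)).
assert (Hg : forall z, (r <= Cmod z <= R)%R -> cdiff g z).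
{ intros z Hz; apply cdiff_mult; [apply fseq_even_cdiff; lra|].
  apply cdiff_mult; [|apply cdiff_pow, cdiff_id].
  apply cdiff_mult; [apply D_cdiff; lra|].
  apply cdiff_inv; [apply E_cdiff; lra|apply HE; lra]. }
apply disk_ext with (cauchy_int R g).
- intros t Ht; rewrite v_cauchy, symbol_calF, calF_div by lra.
  replace (De t / E t * t ^ N * f (2 * k) t) with (g t) by (unfold g; ring).
  rewrite (cauchy_formula g r R) by (assumption || lra).
  assert (cauchy_int r (fun u => f (2 * k) u * (F u * u ^ N)) t = cauchy_int r g t) as ->; [|ring].
  unfold cauchy_int; apply cmean_ext; [lra|]; intros u _; unfold g; now rewrite calF_div.
- apply cauchy_int_disk; [lra|].
  apply cdiff_circ; [lra|intros z Hz; apply Hg; lra].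
Qed.

(** The mirror image, between 1/R and 1/r: the even iterate is the integral over the outer circle,
    and minus the inner integral remains. *)
Lemma fseq_odd_even k : disk_neg (fun t => v k t / S t - f (2 * Datatypes.S k) t).
Proof.
destruct radii; destruct (szego_annulus w Di De r Hw HDi HDe Hr) as (R & HR & _ & HD).
assert (HR' : (0 < / R < 1)%R).
{ split; [apply Rinv_0_lt_compat; lra|]; rewrite <- Rinv_1; apply Rinv_lt_contravar; lra. }
assert (HrR : (r < / R)%R).
{ rewrite <- (Rinv_inv r); apply Rinv_lt_contravar; [|lra].
  apply Rmult_lt_0_compat; lra. }
set (g := fun t => f (2 * k + 1) t * (E t * / De t * / t ^ N)).
assert (Hg : forall z, (/ R <= Cmod z <= / r)%R -> cdiff g z).
{ intros z Hz; apply cdiff_mult.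
  - apply fseq_odd_cdiff; [apply fseq_even_cdiff|lra].
  - apply cdiff_mult; [apply cdiff_mult; [apply E_cdiff; lra|]|].
    + apply cdiff_inv; [apply D_cdiff; lra|apply HD; lra].
    + apply cdiff_inv; [apply cdiff_pow, cdiff_id|].
      apply Cpow_nz, Cmod_gt_0; lra. }
assert (HF : forall t, / (F t * t ^ N) = E t * / De t * / t ^ N).
{ intros t; rewrite calF_div; unfold Cdiv; rewrite !Cinv_mul, Cinv_inv; ring. }
apply disk_neg_ext with (fun z => - RtoC (tau w) ^ 2 * cauchy_int (/ R) g z).
- intros t Ht; rewrite fseq_even_cauchy, symbol_calF by (apply fseq_even_cdiff || lra).
  unfold v, Cdiv; rewrite HF.
  replace (RtoC (tau w) ^ 2 * f (2 * k + 1) t * (E t * / De t * / t ^ N)) with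
    (RtoC (tau w) ^ 2 * g t) by (unfold g; ring).
  rewrite (cauchy_formula g (/ R) (/ r)) by (assumption || lra).
  assert (cauchy_int (/ r) (fun u => f (2 * k + 1) u * / (F u * u ^ N)) t =
    cauchy_int (/ r) g t) as ->; [|ring].
  unfold cauchy_int; apply cmean_ext; [lra|]; intros u _; unfold g; now rewrite HF.
- apply disk_neg_scal, cauchy_int_neg; [assumption|].
  apply cdiff_circ; [lra|intros z Hz; apply Hg; lra].
Qed.

(** The point 0 lies inside the circle of integration, so this is not a value of the exterior
    function on the unit circle. There the kernel is 1, the integral is a mean, and the contour
    moves from r to 1. *)
Lemma fseq_odd_0 k :
  f (2 * k + 1) 0 = - / RtoC (tau w) ^ 2 * cmean 1 (fun t => S t * f (2 * k) t).
Proof.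
destruct radii; destruct (szego_annulus w Di De r Hw HDi HDe Hr) as (R & HR & HE & _).
rewrite fseq_odd_cauchy; [|apply fseq_even_cdiff|rewrite Cmod_0; lra].
f_equal; unfold cauchy_int.
set (g := fun t => f (2 * k) t * (De t / E t * t ^ N)).
transitivity (cmean r g).
- apply cmean_ext; [lra|]; intros t Ht; unfold g; rewrite calF_div.
  assert (t <> 0) by (apply Cmod_gt_0; lra).
  replace (t / (t - 0)) with (RtoC 1); [ring|].
  replace (t - 0) with t by ring; field; assumption.
- rewrite (cmean_annulus g r 1).
  + apply cmean_ext; [lra|]; intros t Ht; rewrite symbol_calF, calF_div by assumption.
    unfold g; ring.
  + lra.
  + intros z Hz; apply cdiff_mult; [apply fseq_even_cdiff; lra|].
    apply cdiff_mult; [|apply cdiff_pow, cdiff_id].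
    apply cdiff_mult; [apply D_cdiff; lra|].
    apply cdiff_inv; [apply E_cdiff; lra|apply HE; lra].
Qed.

Lemma E_disk : disk_alg E.
Proof. destruct radii; apply cdiff_disk with (/ r)%R; [lra|exact E_cdiff]. Qed.

Lemma inv_E_disk : disk_alg (fun t => / E t).
Proof.
destruct radii; destruct (szego_annulus w Di De r Hw HDi HDe Hr) as (R & HR & HE & _).
apply cdiff_disk with R; [lra|]; intros z Hz.
apply cdiff_inv; [apply E_cdiff; lra|now apply HE].
Qed.

Lemma E_circle_neq_0 t : Cmod t = 1%R -> E t <> 0.
Proof. intros Ht; now apply (weight_circle w Di De r). Qed.

(* The exact solution [h] of [h - T h = 1], [T] being the composition of the two
   operators, read off from the orthogonal polynomial. *)
Lemma exact_solution :
  exists h v0, disk_alg h /\ disk_neg v0 /\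
    disk_alg (fun t => S t * h t - v0 t) /\
    disk_neg (fun t => v0 t / S t - (h t - 1)) /\
    cmean 1 (fun t => S t * h t) = monic_val c N 0.
Proof.
destruct radii; destruct (szego_annulus w Di De r Hw HDi HDe Hr) as (R & HR & HE & _).
destruct (monic_weight_split w c Di De r N Hw HDi HDe Hr Hc) as (p & q & Hp & Hq & Hpq).
pose proof (tau_neq_0 w) as Ht0; set (ta := RtoC (tau w)) in *.
assert (E0 : E 0 = ta) by now apply (inv_Di_0 w Di).
set (h := fun t => ta * (p t * E t)); set (v0 := fun t => - ta * (q t * Cconj (E t))).
assert (HD : forall t, Cmod t = 1%R -> De t = Cconj (E t))
  by (intros t Ht; now apply (De_circle w Di De r)).
assert (HEc : forall t, Cmod t = 1%R -> Cconj (E t) <> 0).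
{ intros t Ht; apply Cmod_gt_0; rewrite Cmod_conj; apply Cmod_gt_0.
  now apply E_circle_neq_0. }
assert (Hp' : forall t, Cmod t = 1%R ->
  p t = / t ^ N * (monic_val c N t / (E t * Cconj (E t)) - q t)).
{ intros t Ht; destruct (unit_conj t Ht) as [Htn _].
  pose proof (Hpq t Ht) as H1.
  rewrite (proj1 (weight_circle w Di De r Hw HDi HDe Hr t Ht)) in H1.
  fold (E t) in H1; rewrite HD in H1 by assumption.
  unfold Cdiv; rewrite H1; field; now apply Cpow_nz. }
assert (Hh : disk_alg h) by (apply disk_scal, disk_mult; [assumption|apply E_disk]).
assert (Hv0 : disk_neg v0) by (apply disk_neg_scal, disk_neg_mult; [assumption|apply E_disk]).
(* On the circle this is S h - v0, because S E = t^N Cconj (E t) and w = 1 / (E * Cconj E). It is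
   holomorphic up to R, hence the nonnegative part of S h. *)
set (g := fun t => ta * monic_val c N t / E t).
assert (Hg : forall z, (Cmod z <= R)%R -> cdiff g z).
{ intros z Hz; apply cdiff_mult.
  - apply cdiff_mult; [apply cdiff_const|apply monic_val_cdiff].
  - apply cdiff_inv; [apply E_cdiff; lra|now apply HE]. }
assert (Eg : forall t, Cmod t = 1%R -> g t = S t * h t - v0 t).
{ intros t Ht; destruct (unit_conj t Ht) as [Htn _].
  unfold g, S, h, v0; rewrite Hp' by assumption.
  pose proof (E_circle_neq_0 t Ht); pose proof (HEc t Ht).
  field; repeat split; try assumption; now apply Cpow_nz. }
assert (Hgd : disk_alg g) by (apply cdiff_disk with R; [lra|assumption]).
exists h, v0; split; [assumption|]; split; [assumption|]; split; [|split].
- now apply disk_ext with (1 := Eg).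
(* [G] is the conjugate of v0 / S - (h - 1) on the circle. It vanishes at 0, since Phi_N^* is 1
   there and [E 0 = ta]; so the shift divides it by t and yields the witness for [disk_neg]. *)
- set (G := fun t => 1 - ta * (reversed_val c N t / E t)).
  assert (HG : forall z, (Cmod z <= R)%R -> cdiff G z).
  { intros z Hz; apply cdiff_minus; [apply cdiff_const|].
    apply cdiff_mult; [apply cdiff_const|].
    apply cdiff_mult; [apply reversed_val_cdiff|].
    apply cdiff_inv; [apply E_cdiff; lra|now apply HE]. }
  assert (HG0 : cmean 1 G = 0).
  { rewrite cmean_disk by (lra || intros z Hz; apply HG; lra).
    unfold G; rewrite reversed_val_0, E0 by now apply (lead_coef_neq_0 w).
    field; assumption. }
  assert (HGd : disk_alg G) by (apply cdiff_disk with R; [lra|assumption]).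
  exists (fun t => (G t - cmean 1 G) / t); split; [now apply disk_shift|].
  intros t Ht; destruct (unit_conj t Ht) as [Htn Htc].
  replace (t * ((G t - cmean 1 G) / t)) with (G t) by (rewrite HG0; field; assumption).
  pose proof (E_circle_neq_0 t Ht); pose proof (HEc t Ht).
  unfold G; rewrite reversed_val_circle by assumption.
  rewrite Cminus_conj, Cmult_conj; unfold Cdiv; rewrite !Cmult_conj, Cconj_inv, Cconj_conj,
    Cpow_conj, Htc, !Cconj_R, Cpow_inv by assumption.
  unfold ta; rewrite Cconj_R; fold ta.
  unfold v0, h, S; rewrite Hp' by assumption.
  field; repeat split; try assumption; now apply Cpow_nz.
- assert (Cv : circ_cont 1 v0) by now apply disk_neg_circ_cont.
  assert (Mv : cmean 1 v0 = 0).
  { rewrite <- (Cconj_conj (cmean 1 v0)), <- cmean_conj by assumption.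
    rewrite (cmean_ext 1 _ (fun t => 1 * Cconj (v0 t))) by (lra || intros; ring).
    rewrite (disk_neg_orth (fun _ => 1)) by (assumption || apply disk_const).
    apply Cconj_R. }
  transitivity (cmean 1 g + cmean 1 v0).
  + rewrite <- cmean_plus by (assumption || now apply disk_circ_cont).
    apply cmean_ext; [lra|]; intros t Ht; rewrite Eg by assumption; ring.
  + rewrite Mv, cmean_disk by (lra || intros z Hz; apply Hg; lra).
    unfold g; rewrite E0; field; assumption.
Qed.

Lemma fseq_series :
  is_series (V := C_NormedModule) (fun k => f (2 * k + 1) 0)
    (- / RtoC (tau w) ^ 2 * monic_val c N 0).
Proof.
destruct exact_solution as (h & v0 & Hh & Hv0 & H1 & H2 & Hm).
rewrite <- Hm.
apply (is_series_ext (V := C_NormedModule)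
  (fun k => - / RtoC (tau w) ^ 2 * cmean 1 (fun t => S t * f (2 * k) t))).
{ intros k; symmetry; apply fseq_odd_0. }
apply (is_series_scal (K := C_AbsRing) (V := C_NormedModule) (- / RtoC (tau w) ^ 2)).
apply (neumann_series E N E_disk inv_E_disk E_circle_neq_0 h v0 (fun k => f (2 * k)) v);
  try assumption.
- intros t _; reflexivity.
- apply fseq_even_disk.
- apply fseq_odd_neg.
- apply fseq_even_odd.
- apply fseq_odd_even.
Qed.

End Main.

(** For N = n + 1 the series converges to - Phi_{n+1}(0) / tau^2, so the total limit in [calI] is
    this value; the two conjugations in Cconj alpha_n leave - Phi_{n+1}(0). *)
Theorem corollary1 :
  forall (w : C -> R) (c : nat -> nat -> C) (Di De : C -> C) (r : R),
    analytic_weight w ->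
    orthonormal_polynomials w c ->
    is_szego_i w Di ->
    is_szego_e w De ->
    (rho w < r < 1)%R ->
    forall n : nat,
      is_series (V := C_NormedModule)
        (fun k => fseq w (calF Di De) r (S n) (2 * k + 1) (RtoC 0))
        (calI w (calF Di De) r (S n) (RtoC 0)) /\
      Cconj (verblunsky c n)
      = (RtoC (tau w) ^ 2 * calI w (calF Di De) r (S n) (RtoC 0))%C.
Proof.
intros w c Di De r Hw Hc HDi HDe Hr n.
pose proof (fseq_series w c Di De r (S n) Hw HDi HDe Hr Hc) as H.
assert (HI : calI w (calF Di De) r (S n) 0 = - / RtoC (tau w) ^ 2 * monic_val c (S n) 0).
{ apply (climit_lim eventually); now apply is_series_climit. }
rewrite HI; split; [exact H|].
unfold verblunsky; rewrite Copp_conj, Cconj_conj.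
pose proof (tau_neq_0 w); field; assumption.
Qed.
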